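(* Let $\Omega\subseteq\mathbb R^d$ be open, let $u_n\rightharpoonup0$ weakly in $L^2_{\rm loc}(\Omega;\mathbb C^r)$, and let $(\omega_n)$ be a sequence of positive numbers with $\omega_n\to0^+$. Then there exist a subsequence $(u_{n'})$ and an $r\times r$ hermitian non-negative matrix Radon measure $\mu$ on $\Omega\times\mathrm K_{0,\infty}(\mathbb R^d)$ such that for all $\varphi_1,\varphi_2\in C_c(\Omega)$ and all $\psi\in C(\mathrm K_{0,\infty}(\mathbb R^d))$ $$\lim_{n'}\int_{\mathbb R^d}\big(\widehat{\varphi_1u_{n'}}(\xi)\otimes\widehat{\varphi_2u_{n'}}(\xi)\big)\psi(\omega_{n'}\xi)\,d\xi=\int_{\Omega\times\mathrm K_{0,\infty}(\mathbb R^d)}\varphi_1(x)\overline{\varphi_2(x)}\psi(\xi)\,d\bar\mu(x,\xi),$$ where $\bar\mu$ denotes the entrywise complex conjugate of $\mu$.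
   Context: Conventions: functions on $\Omega$ are extended by zero to $\mathbb R^d$; $\hat u(\xi)=\int_{\mathbb R^d}e^{-2\pi i x\cdot\xi}u(x)\,dx$; $(a\otimes b)_{ij}=a_i\overline{b_j}$. Radon measures are not necessarily bounded (elements of the dual of $C_c(\Omega\times\mathrm K_{0,\infty}(\mathbb R^d))$). Compactification: $\mathrm K_{0,\infty}(\mathbb R^d)$ is the compactification of $\mathbb R^d\setminus\{0\}$ obtained by adjoining a unit sphere $\Sigma_0=\{0^e:e\in S^{d-1}\}$ at the origin and a unit sphere $\Sigma_\infty=\{\infty^e:e\in S^{d-1}\}$ at infinity, with the topology of $S^{d-1}\times[0,\infty]$ (the point $re$ corresponds to $(e,r)$, $0^e$ to $(e,0)$, $\infty^e$ to $(e,\infty)$). Thus $C(\mathrm K_{0,\infty}(\mathbb R^d))$ is identified with the space of continuous $\psi$ on $\mathbb R^d\setminus\{0\}$ for which there are $\psi_0,\psi_\infty\in C(S^{d-1})$ with $\psi(\xi)-\psi_0(\xi/|\xi|)\to0$ as $|\xi|\to0$ and $\psi(\xi)-\psi_\infty(\xi/|\xi|)\to0$ as $|\xi|\to\infty$; then $\psi(0^e)=\psi_0(e)$, $\psi(\infty^e)=\psi_\infty(e)$. *)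

(* Defs.v *)
From HB Require Import structures.
From mathcomp Require Import all_boot all_order all_algebra.
From mathcomp Require Import all_classical all_reals all_analysis.
From mathcomp Require Import complex.

Set Implicit Arguments.
Unset Strict Implicit.
Unset Printing Implicit Defensive.

Import Order.TTheory GRing.Theory Num.Theory.
Import numFieldNormedType.Exports.

Local Open Scope classical_set_scope.
Local Open Scope ring_scope.
Local Open Scope complex_scope.

(* R^d is 'rV[R]_d, with the sigma-algebra generated by the coordinates, which
   is the Borel sigma-algebra. *)
Definition measure_row_display : measure_display.
Proof. exact: default_measure_display. Qed.

Section measurable_row.
Context {R : realType} (d : nat).

Let coord (i : 'I_d) (x : 'rV[R]_d) : R := x 0 i.

Let row_set0 : g_sigma_preimage coord set0.
Proof. exact: sigma_algebra0. Qed.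

Let row_setC A : g_sigma_preimage coord A -> g_sigma_preimage coord (~` A).
Proof. exact: sigma_algebraC. Qed.

Let row_bigcup (F : (set _)^nat) : (forall i, g_sigma_preimage coord (F i)) ->
  g_sigma_preimage coord (\bigcup_i F i).
Proof. exact: sigma_algebra_bigcup. Qed.

HB.instance Definition _ := @isMeasurable.Build measure_row_display
  'rV[R]_d (g_sigma_preimage coord) row_set0 row_setC row_bigcup.

End measurable_row.

Section lebesgue_row.
Context {R : realType}.

Lemma measurable_coord d (i : 'I_d) :
  measurable_fun [set: 'rV[R]_d] (fun x : 'rV[R]_d => x 0 i).
Proof.
move=> _ Y mY; rewrite setTI; apply: sub_sigma_algebra => /=.
rewrite -bigcup_seq/=; exists i => /=; first by rewrite mem_index_enum.
by exists Y => //; rewrite setTI.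
Qed.

Lemma measurable_fun_rowP d1 (T : measurableType d1) d (f : T -> 'rV[R]_d) :
  (forall i, measurable_fun [set: T] (fun x => f x 0 i)) ->
  measurable_fun [set: T] f.
Proof.
move=> mf.
have sub : g_sigma_preimage (fun i x => f x 0 i) `<=` @measurable _ T.
  apply: smallest_sub; first exact: sigma_algebra_measurable.
  case: d => [|d] in f mf *; first by rewrite big_ord0.
  rewrite -bigcup_mkord_ord; apply: bigcup_sub => i Ii.
  by move=> A [B mB <-]; exact: mf.
move=> _ A mA; rewrite setTI; apply: sub.
rewrite (g_sigma_preimage_comp (fun i (x : 'rV[R]_d) => x 0 i) f).
by exists A => //; rewrite setTI.
Qed.

Definition row_cons d (p : measurableTypeR R * 'rV[R]_d) : 'rV[R]_d.+1 :=
  \row_i oapp (fun j => p.2 0 j) (p.1 : R) (unlift ord0 i).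

Definition row_uncons d (x : 'rV[R]_d.+1) : measurableTypeR R * 'rV[R]_d :=
  (x 0 ord0, \row_j x 0 (lift ord0 j)).

Lemma row_consK d : cancel (@row_cons d) (@row_uncons d).
Proof.
move=> [a x]; rewrite /row_uncons /row_cons mxE unlift_none; congr pair.
by apply/rowP => j; rewrite !mxE liftK.
Qed.

Lemma measurable_row_cons d : measurable_fun setT (@row_cons d).
Proof.
apply: measurable_fun_rowP => i; rewrite /row_cons.
under eq_fun do rewrite mxE.
case: unliftP => [j _|_] /=; last exact: measurable_fst.
apply: (@measurableT_comp _ _ _ _ _ _ (fun y : 'rV[R]_d => y 0 j)).
- exact: measurable_coord.
- exact: measurable_snd.
Qed.

Lemma measurable_row_uncons d : measurable_fun setT (@row_uncons d).
Proof.
apply: measurable_fun_pair; first exact: measurable_coord.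
apply: measurable_fun_rowP => i.
by under eq_fun do rewrite mxE; exact: measurable_coord.
Qed.

Section step.
Variables (d : nat) (m : {sigma_finite_measure set 'rV[R]_d -> \bar R}).

Definition lebesgue_row_step : set 'rV[R]_d.+1 -> \bar R :=
  pushforward (@lebesgue_measure R \x m)%E (@row_cons d).

Let step0 : lebesgue_row_step set0 = 0%E.
Proof. by rewrite /lebesgue_row_step /pushforward preimage_set0 measure0. Qed.

Let step_ge0 A : (0 <= lebesgue_row_step A)%E.
Proof. by rewrite /lebesgue_row_step /pushforward measure_ge0. Qed.

Let step_sigma_additive : semi_sigma_additive lebesgue_row_step.
Proof.
move=> F mF tF mUF; rewrite /lebesgue_row_step /pushforward preimage_bigcup.
apply: measure_semi_sigma_additive.
- by move=> n; rewrite -[X in measurable X]setTI; exact: measurable_row_cons.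
- apply/trivIsetP => /= i j _ _ ij; rewrite -preimage_setI.
  by move/trivIsetP : tF => /(_ _ _ _ _ ij) ->//; rewrite preimage_set0.
- rewrite -preimage_bigcup -[X in measurable X]setTI.
  exact: measurable_row_cons.
Qed.

HB.instance Definition _ := isMeasure.Build _ _ _ lebesgue_row_step
  step0 step_ge0 step_sigma_additive.

Let lebesgue_row_step_sigma_finite : sigma_finite setT lebesgue_row_step.
Proof.
have /sigma_finiteP[F [TF ndF Foo]] := sigma_finiteT (@lebesgue_measure R).
have /sigma_finiteP[G [TG ndG Goo]] := sigma_finiteT m.
exists (fun k => @row_uncons d @^-1` (F k `*` G k)).
  rewrite -preimage_bigcup (_ : \bigcup_k _ = setT) ?preimage_setT//.
  rewrite -subTset => -[x y] _.
  have [n _ Fnx] : (\bigcup_n F n) x by rewrite -TF.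
  have [k _ Gky] : (\bigcup_n G n) y by rewrite -TG.
  exists (maxn n k) => //; split => /=.
  - by move: x Fnx; exact/subsetPset/ndF/leq_maxl.
  - by move: y Gky; exact/subsetPset/ndG/leq_maxr.
move=> k; have [mF Fk] := Foo k; have [mG Gk] := Goo k; split.
  rewrite -[X in measurable X]setTI; apply: measurable_row_uncons => //.
  exact: measurableX.
rewrite /lebesgue_row_step /pushforward -comp_preimage.
rewrite (_ : _ \o _ = id); last by apply/funext => p /=; rewrite row_consK.
by rewrite preimage_id product_measure1E// lte_mul_pinfty// ge0_fin_numE.
Qed.

HB.instance Definition _ := Measure_isSigmaFinite.Build _ _ _
  lebesgue_row_step lebesgue_row_step_sigma_finite.

End step.

(* R^0 is a point of mass 1, and Lebesgue measure on R^(d+1) is the image of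
   the product of Lebesgue measures on R and R^d. *)
Fixpoint lebesgue_row d : {sigma_finite_measure set 'rV[R]_d -> \bar R} :=
  match d with
  | 0 => dirac (0 : 'rV[R]_0)
  | d'.+1 => lebesgue_row_step (lebesgue_row d')
  end.

End lebesgue_row.

Section complex_functions.
Context {R : realType}.

Definition cmeasurable d (T : measurableType d) (D : set T) (f : T -> R[i]) :=
  measurable_fun D (fun x => complex.Re (f x)) /\
  measurable_fun D (fun x => complex.Im (f x)).

Definition cintegral d (T : measurableType d)
    (mu : {measure set T -> \bar R}) (D : set T) (f : T -> R[i]) : R[i] :=
  (\int[mu]_(x in D) complex.Re (f x)) +i*
  (\int[mu]_(x in D) complex.Im (f x)).

Definition expi (t : R) : R[i] := cos t +i* sin t.

(* R[i]^o is R[i] with the topology of its norm. *)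
Definition ccontinuous (T : topologicalType) (f : T -> R[i]) :=
  continuous (f : T -> R[i]^o).

Definition Cc (T : topologicalType) (f : T -> R[i]) :=
  ccontinuous f /\ exists2 K, compact K & forall x, ~ K x -> f x = 0.

(* A Radon measure on T, given as an element of the dual of Cc(T) with its
   inductive limit topology. Only the values on Cc(T) are relevant. *)
Definition radon_measure (T : topologicalType) (L : (T -> R[i]) -> R[i]) :=
  (forall (a : R[i]) f g, Cc f -> Cc g ->
     L (fun x => a * f x + g x) = a * L f + L g) /\
  (forall K, compact K -> exists M : R, forall (f : T -> R[i]) (B : R),
     Cc f -> (forall x, ~ K x -> f x = 0) ->
     (forall x, Normc.normc (f x) <= B) -> Normc.normc (L f) <= M * B).

(* mu f is the matrix of the integrals of f against the entries of mu. *)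
Definition matrix_radon_measure (T : topologicalType) r
    (mu : (T -> R[i]) -> 'M[R[i]]_r) :=
  forall j k, radon_measure (fun f => mu f j k).

(* Integration against the entrywise complex conjugate of mu. *)
Definition conj_measure (T : topologicalType) r
    (mu : (T -> R[i]) -> 'M[R[i]]_r) (f : T -> R[i]) : 'M[R[i]]_r :=
  map_mx Num.conj (mu (fun x => Num.conj (f x))).

Definition hermitian_measure (T : topologicalType) r
    (mu : (T -> R[i]) -> 'M[R[i]]_r) :=
  forall f, Cc f -> mu f = (conj_measure mu f)^T.

(* In R[i], 0 <= z means that z is real and nonnegative. *)
Definition nonneg_measure (T : topologicalType) r
    (mu : (T -> R[i]) -> 'M[R[i]]_r) :=
  forall f, Cc f -> (forall x, 0 <= f x) ->
  forall z : 'cV[R[i]]_r, 0 <= ((map_mx Num.conj z)^T *m mu f *m z) 0 0.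

End complex_functions.

Section euclidean.
Context {R : realType} {d : nat}.

Local Notation leb := (@lebesgue_row R d).

Definition dotr (x y : 'rV[R]_d) : R := \sum_i x 0 i * y 0 i.

(* The library norm on 'rV[R]_d is the maximum norm. *)
Definition enorm (x : 'rV[R]_d) : R := Num.sqrt (dotr x x).

(* K_{0,oo}(R^d): (e, r) stands for r e if 0 < r < +oo, (e, 0) for 0^e and
   (e, +oo) for oo^e. *)
Definition K0inf : set ('rV[R]_d * \bar R) :=
  [set p | enorm p.1 = 1 /\ (0 <= p.2)%E].

Definition polar (x : 'rV[R]_d) : 'rV[R]_d * \bar R :=
  ((enorm x)^-1 *: x, (enorm x)%:E).

(* 'valL_ 0 f extends by 0 a function f defined on a subset. *)
Definition symbol (psi : K0inf -> R[i]) (xi : 'rV[R]_d) : R[i] :=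
  'valL_ 0 psi (polar xi).

Definition fourier r (v : 'rV[R]_d -> 'cV[R[i]]_r) (xi : 'rV[R]_d) :
    'cV[R[i]]_r :=
  \col_j cintegral leb setT
    (fun x => expi (- (2 * pi * dotr x xi)) * v x j 0).

Definition tensor r (a b : 'cV[R[i]]_r) : 'M[R[i]]_r :=
  \matrix_(j, k) (a j 0 * (b k 0)^*).

Definition mxintegral r (F : 'rV[R]_d -> 'M[R[i]]_r) : 'M[R[i]]_r :=
  \matrix_(j, k) cintegral leb setT (fun xi => F xi j k).

Definition square_integrable (D : set 'rV[R]_d) (f : 'rV[R]_d -> R[i]) :=
  cmeasurable D f /\ leb.-integrable D (fun x => (Normc.normc (f x) ^+ 2)%:E).

(* Members of L^2_loc(Omega; C^r) are represented by functions on R^d, of which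
   only the values on Omega matter. *)
Definition L2loc (Omega : set 'rV[R]_d) r (u : 'rV[R]_d -> 'cV[R[i]]_r) :=
  forall j, cmeasurable Omega (fun x => u x j 0) /\
    forall K, compact K -> K `<=` Omega ->
      square_integrable K (fun x => u x j 0).

(* The dual of L^2_loc: square integrable functions that vanish outside a
   compact subset of Omega. *)
Definition L2comp (Omega : set 'rV[R]_d) r (v : 'rV[R]_d -> 'cV[R[i]]_r) :=
  (forall j, square_integrable Omega (fun x => v x j 0)) /\
  exists K, [/\ compact K, K `<=` Omega & forall x, ~ K x -> v x = 0].

Definition weakly_null_L2loc (Omega : set 'rV[R]_d) r
    (u : nat -> 'rV[R]_d -> 'cV[R[i]]_r) :=
  (forall n, L2loc Omega (u n)) /\
  forall v : 'rV[R]_d -> 'cV[R[i]]_r, L2comp Omega v ->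
    (fun n => cintegral leb Omega
       (fun x => \sum_j u n x j 0 * (v x j 0)^*)) @ \oo --> (0 : R[i]^o).

End euclidean.

(* Main.v *)
(** Localize: let theta_i be a partition of unity (with sum of theta_i ^ 2 equal
    to 1) subordinate to balls of radius eps in a compact exhaustion of Omega, and
    cut the compactified frequency space into finitely many cells of diameter eps.
    The limits along an ultrafilter of the integrals over the l-th cell (dilated
    by 1 / omega_n) of the matrices of Fourier transforms of theta_i u_n define
    point masses at (q_i, s_l), and mu is a limit of these discrete nonnegative
    measures as eps -> 0; a subsequence is extracted for these countably many
    numbers only. The discrete measures approximate the given integrals because,
    for weakly null sequences, multiplication by theta_i asymptotically commutes
    with the Fourier multiplier psi(omega_n xi) (Tartar's first commutation
    lemma): for a character of R^d the multiplier is shifted, which changes it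
    little at high frequencies, while the low frequencies of a weakly null
    sequence vanish in the limit; functions with this commutation property form a
    uniformly closed algebra, so they include the theta_i. *)

(* The squares of the theta_i sum to 1 for two reasons. Commutation turns the form at (theta_i^2 f,
   g) into the form at (theta_i f, theta_i g); with the same cutoff in both slots the coefficient
   matrices are positive semidefinite exactly, before any limit. And the squared norms of the
   theta_i f add up to at most that of f, so freezing phi1, phi2 and psi on each block costs an
   error that does not grow with the number of blocks. Commutation is applied to psi(omega_n xi)
   itself, since the indicators of the cells are not slowly varying; psi is replaced by a step
   function only afterwards, block by block. A symbol may be discontinuous at the origin, but this
   concerns a frequency box of fixed size, where the transforms tend to 0 boundedly. Every error is
   an upper bound by L^2 norms, which is why Plancherel appears as an inequality. The limit as the
   mesh tends to 0 may stay an ultralimit: one fine mesh already approximates the integrals for all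
   large n, so only the coefficients at each mesh have to converge along the subsequence. *)
Require Import Defs.
From HB Require Import structures.
From mathcomp Require Import all_boot all_order all_algebra.
From mathcomp Require Import all_classical all_reals all_analysis.
From mathcomp Require Import measurable_realfun complex ring lra.

Set Implicit Arguments.
Unset Strict Implicit.
Unset Printing Implicit Defensive.

Import Order.TTheory GRing.Theory Num.Theory.
Import numFieldNormedType.Exports.

Local Open Scope classical_set_scope.
Local Open Scope ring_scope.

(** * Complex-valued integration *)

Section complex_modulus.
Context {R : realType}.
Implicit Types (z w : R[i]) (t : R).
Local Notation N := (@Normc.normc R).

Lemma normcC z : `|z| = (N z)%:C%C. Proof. by []. Qed.

Lemma cmod_inj z w : `|z| = `|w| -> N z = N w. Proof. by case. Qed.

Lemma cmod_ge0 z : 0 <= N z.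
Proof. by rewrite -lecR; exact: (normr_ge0 z). Qed.

Lemma cmodM z w : N (z * w) = N z * N w.
Proof. exact: Normc.normcM. Qed.

Lemma cmodD z w : N (z + w) <= N z + N w.
Proof. exact: (@le_normcD R). Qed.

Lemma cmodN z : N (- z) = N z.
Proof. exact: (@normcN R). Qed.

Lemma cmodB z w : N (z - w) <= N z + N w.
Proof. by rewrite -(cmodN w); exact: cmodD. Qed.

Lemma cmodBC z w : N (z - w) = N (w - z).
Proof. by rewrite -cmodN opprB. Qed.

Lemma cmod0 : N 0 = 0. Proof. exact: Normc.normc0. Qed.

Lemma cmod1 : N 1 = 1. Proof. exact: Normc.normc1. Qed.

Lemma cmodJ z : N z^* = N z.
Proof. by apply: cmod_inj; exact: normcJ. Qed.

Lemma cmod_eq0 z : (N z == 0) = (z == 0).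
Proof.
apply/eqP/eqP => [/Normc.eq0_normc//|->]; exact: cmod0.
Qed.

Lemma cmodR t : N t%:C%C = `|t|.
Proof. by rewrite /Normc.normc /= expr0n/= addr0 sqrtr_sqr. Qed.

Lemma cmod_sum I (r : seq I) (P : pred I) (F : I -> R[i]) :
  N (\sum_(i <- r | P i) F i) <= \sum_(i <- r | P i) N (F i).
Proof.
elim/big_rec2 : _ => [|i x y _ xy]; first by rewrite cmod0.
by rewrite (le_trans (cmodD _ _))// lerD2l.
Qed.

Lemma sqr_cmod z : (N z) ^+ 2 = complex.Re z ^+ 2 + complex.Im z ^+ 2.
Proof. by case: z => a b; rewrite /= sqr_sqrtr ?addr_ge0 ?sqr_ge0. Qed.

Lemma Re_le_cmod z : `|complex.Re z| <= N z.
Proof.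
by rewrite -(ler_pXn2r (n := 2)) ?nnegrE ?cmod_ge0// real_normK ?num_real// sqr_cmod lerDl sqr_ge0.
Qed.

Lemma Im_le_cmod z : `|complex.Im z| <= N z.
Proof.
by rewrite -(ler_pXn2r (n := 2)) ?nnegrE ?cmod_ge0// real_normK ?num_real// sqr_cmod lerDr sqr_ge0.
Qed.

Lemma cmod_le z : N z <= `|complex.Re z| + `|complex.Im z|.
Proof.
rewrite -(ler_pXn2r (n := 2)) ?nnegrE ?cmod_ge0// ?addr_ge0//.
rewrite sqr_cmod sqrrD !real_normK ?num_real// lerD2r lerDl.
by rewrite mulrn_wge0// mulr_ge0.
Qed.

Lemma mul_conjc z : z * z^* = ((N z) ^+ 2)%:C%C.
Proof.
case: z => a b; rewrite /= sqr_sqrtr ?addr_ge0 ?sqr_ge0//.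
by apply/eqP; rewrite eq_complex /=; apply/andP; split; apply/eqP; ring.
Qed.

Lemma ReD z w : complex.Re (z + w) = complex.Re z + complex.Re w.
Proof. by case: z => a b; case: w. Qed.
Lemma ImD z w : complex.Im (z + w) = complex.Im z + complex.Im w.
Proof. by case: z => a b; case: w. Qed.
Lemma ReN z : complex.Re (- z) = - complex.Re z.
Proof. by case: z. Qed.
Lemma ImN z : complex.Im (- z) = - complex.Im z.
Proof. by case: z. Qed.
Lemma ReM z w : complex.Re (z * w) =
  complex.Re z * complex.Re w - complex.Im z * complex.Im w.
Proof. by case: z => a b; case: w. Qed.
Lemma ImM z w : complex.Im (z * w) =
  complex.Re z * complex.Im w + complex.Im z * complex.Re w.
Proof. by case: z => a b; case: w. Qed.
Lemma ReJ z : complex.Re z^* = complex.Re z.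
Proof. by case: z. Qed.
Lemma ImJ z : complex.Im z^* = - complex.Im z.
Proof. by case: z. Qed.

Lemma complex_ext z w : complex.Re z = complex.Re w ->
  complex.Im z = complex.Im w -> z = w.
Proof. by case: z => a b; case: w => c e /= -> ->. Qed.

Lemma cmod_expi t : N (expi t) = 1.
Proof. by rewrite /expi /= cos2Dsin2 sqrtr1. Qed.

Lemma expiD t s : expi (t + s) = expi t * expi s.
Proof.
by apply: complex_ext; rewrite ?ReM ?ImM /= ?cosD ?sinD 1?addrC// (mulrC (cos s)).
Qed.

Lemma expiN t : expi (- t) = (expi t)^*.
Proof. by apply: complex_ext; rewrite ?ReJ ?ImJ /= ?cosN ?sinN. Qed.

Lemma expi0 : expi (0 : R) = 1.
Proof. by rewrite /expi cos0 sin0. Qed.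

End complex_modulus.

Section cmeasurable_theory.
Context {R : realType} {d} {T : measurableType d}.
Implicit Types (D : set T) (f g : T -> R[i]).
Local Notation N := (@Normc.normc R).

Lemma cmeasurable_cst D c : cmeasurable D (fun=> c : R[i]).
Proof. by split; exact: measurable_cst. Qed.

Lemma cmeasurableD D f g : cmeasurable D f -> cmeasurable D g ->
  cmeasurable D (fun x => f x + g x).
Proof.
move=> [f1 f2] [g1 g2]; split.
- by under eq_fun do rewrite ReD; exact: measurable_funD.
- by under eq_fun do rewrite ImD; exact: measurable_funD.
Qed.

Lemma cmeasurableN D f : cmeasurable D f -> cmeasurable D (fun x => - f x).
Proof.
move=> [f1 f2]; split.
- by under eq_fun do rewrite ReN; exact: measurableT_comp.
- by under eq_fun do rewrite ImN; exact: measurableT_comp.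
Qed.

Lemma cmeasurableB D f g : cmeasurable D f -> cmeasurable D g ->
  cmeasurable D (fun x => f x - g x).
Proof. by move=> mf mg; apply: cmeasurableD => //; exact: cmeasurableN. Qed.

Lemma cmeasurableM D f g : cmeasurable D f -> cmeasurable D g ->
  cmeasurable D (fun x => f x * g x).
Proof.
move=> [f1 f2] [g1 g2]; split.
- under eq_fun do rewrite ReM.
  by apply: measurable_funB; exact: measurable_funM.
- under eq_fun do rewrite ImM.
  by apply: measurable_funD; exact: measurable_funM.
Qed.

Lemma cmeasurableJ D f : cmeasurable D f -> cmeasurable D (fun x => (f x)^*).
Proof.
move=> [f1 f2]; split.
- by under eq_fun do rewrite ReJ.
- by under eq_fun do rewrite ImJ; exact: measurableT_comp.
Qed.

Lemma cmeasurableR D (f : T -> R) : measurable_fun D f ->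
  cmeasurable D (fun x => (f x)%:C%C).
Proof. by move=> mf; split => //; exact: measurable_cst. Qed.

Lemma cmeasurable_sum D I (r : seq I) (P : pred I) (F : I -> T -> R[i]) :
  (forall i, cmeasurable D (F i)) ->
  cmeasurable D (fun x => \sum_(i <- r | P i) F i x).
Proof.
move=> mF; elim: r => [|i r ih].
  by under eq_fun do rewrite big_nil; exact: cmeasurable_cst.
under eq_fun do rewrite big_cons.
by case: (P i) => //; exact: cmeasurableD.
Qed.

Lemma measurable_cmod D f : cmeasurable D f -> measurable_fun D (fun x => N (f x)).
Proof.
move=> [f1 f2].
under eq_fun => x do rewrite -[N _]ger0_norm ?cmod_ge0// -sqrtr_sqr sqr_cmod.
apply: (@measurableT_comp _ _ _ _ _ _ (@Num.sqrt R)).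
  by apply: continuous_measurable_fun; exact: sqrt_continuous.
by apply: measurable_funD; exact: measurable_funX.
Qed.

Lemma measurable_sqr_cmod D f : cmeasurable D f ->
  measurable_fun D (fun x => N (f x) ^+ 2).
Proof. by move=> mf; apply: measurable_funX; exact: measurable_cmod. Qed.

Lemma cmeasurable_expi D (f : T -> R) : measurable_fun D f ->
  cmeasurable D (fun x => expi (f x)).
Proof.
move=> mf; split => /=.
- apply: measurableT_comp mf; apply: continuous_measurable_fun.
  exact: continuous_cos.
- apply: measurableT_comp mf; apply: continuous_measurable_fun.
  exact: continuous_sin.
Qed.

Lemma cmeasurable_comp d' (T' : measurableType d') f (h : T' -> T) :
  cmeasurable setT f -> measurable_fun setT h -> cmeasurable setT (f \o h).
Proof.
by move=> [f1 f2] mh; split; [exact: (measurableT_comp f1)|exact: (measurableT_comp f2)].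
Qed.

End cmeasurable_theory.

Section cintegral_theory.
Context {R : realType} {d} {T : measurableType d}.
Variable mu : {measure set T -> \bar R}.
Implicit Types (f g : T -> R[i]).
Local Notation N := (@Normc.normc R).
Local Notation int := (cintegral mu setT).

Definition cintegrable f :=
  mu.-integrable setT (fun x => (complex.Re (f x))%:E) /\
  mu.-integrable setT (fun x => (complex.Im (f x))%:E).

Lemma cintegrable_measurable f : cintegrable f -> cmeasurable setT f.
Proof.
case=> f1 f2; split; apply/measurable_EFinP.
- exact: measurable_int f1.
- exact: measurable_int f2.
Qed.

Lemma cintegrable_cmod f : cmeasurable setT f ->
  cintegrable f <-> mu.-integrable setT (fun x => (N (f x))%:E).
Proof.
move=> mf; split=> [[f1 f2]|Nf].
- have := integrableD measurableT (integrable_norm f1) (integrable_norm f2).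
  apply: le_integrable => //; first exact/measurable_EFinP/measurable_cmod.
  move=> x _ /=; rewrite lee_fin ger0_norm ?cmod_ge0// ger0_norm ?addr_ge0//.
  exact: cmod_le.
- case: (mf) => f1 f2; split.
  + apply: le_integrable Nf => //; first exact/measurable_EFinP.
    by move=> x _ /=; rewrite lee_fin (ger0_norm (cmod_ge0 _)) Re_le_cmod.
  + apply: le_integrable Nf => //; first exact/measurable_EFinP.
    by move=> x _ /=; rewrite lee_fin (ger0_norm (cmod_ge0 _)) Im_le_cmod.
Qed.

Lemma le_cintegrable f (g : T -> R) : cmeasurable setT f ->
  (forall x, N (f x) <= g x) -> mu.-integrable setT (fun x => (g x)%:E) ->
  cintegrable f.
Proof.
move=> mf fg ig; apply/cintegrable_cmod => //; apply: le_integrable ig => //.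
  exact/measurable_EFinP/measurable_cmod.
move=> x _ /=; rewrite lee_fin (ger0_norm (cmod_ge0 _)).
exact: (le_trans (fg x) (ler_norm _)).
Qed.

Lemma cintegrableD f g : cintegrable f -> cintegrable g ->
  cintegrable (fun x => f x + g x).
Proof.
move=> [f1 f2] [g1 g2]; split.
- by under eq_fun do rewrite ReD EFinD; exact: integrableD.
- by under eq_fun do rewrite ImD EFinD; exact: integrableD.
Qed.

Lemma cintegrableZ c f : cintegrable f -> cintegrable (fun x => c * f x).
Proof.
move=> [f1 f2]; split.
- under eq_fun do rewrite ReM EFinB !EFinM.
  by apply: integrableB => //; exact: integrableZl.
- under eq_fun do rewrite ImM EFinD !EFinM.
  by apply: integrableD => //; exact: integrableZl.
Qed.

Lemma cintegrable0 : cintegrable (fun=> 0).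
Proof. by split; exact: integrable0. Qed.

Lemma cintegrable_sum I (r : seq I) (P : pred I) (F : I -> T -> R[i]) :
  (forall i, P i -> cintegrable (F i)) ->
  cintegrable (fun x => \sum_(i <- r | P i) F i x).
Proof.
move=> mF; elim: r => [|i r ih].
  by under eq_fun do rewrite big_nil; exact: cintegrable0.
under eq_fun do rewrite big_cons.
by case: (boolP (P i)) => [Pi|_] //; apply: cintegrableD => //; exact: mF.
Qed.

Lemma cintegralD f g : cintegrable f -> cintegrable g ->
  int (fun x => f x + g x) = int f + int g.
Proof.
move=> [f1 f2] [g1 g2]; apply: complex_ext; rewrite ?ReD ?ImD /=.
- by under [LHS]eq_Rintegral do rewrite ReD; rewrite RintegralD.
- by under [LHS]eq_Rintegral do rewrite ImD; rewrite RintegralD.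
Qed.

Lemma integrableZl_EFin (k : R) (g : T -> R) : mu.-integrable setT (EFin \o g) ->
  mu.-integrable setT (EFin \o (fun x => k * g x)).
Proof.
by move=> ig; rewrite /comp; under eq_fun do rewrite EFinM; exact: integrableZl.
Qed.

Lemma cintegralZ c f : cintegrable f -> int (fun x => c * f x) = c * int f.
Proof.
move=> [f1 f2].
apply: complex_ext; rewrite ?ReM ?ImM /=.
- under [LHS]eq_Rintegral do rewrite ReM.
  rewrite RintegralB//; [|exact: integrableZl_EFin..].
  by rewrite !RintegralZl.
- under [LHS]eq_Rintegral do rewrite ImM.
  rewrite RintegralD//; [|exact: integrableZl_EFin..].
  by rewrite !RintegralZl.
Qed.

Lemma cintegral0 : int (fun=> 0) = 0.
Proof. by rewrite /cintegral /Rintegral !integral0. Qed.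

Lemma cintegralN f : cintegrable f -> int (fun x => - f x) = - int f.
Proof.
by move=> fi; rewrite -mulN1r -cintegralZ//; congr int; apply/funext => x; rewrite mulN1r.
Qed.

Lemma cintegralB f g : cintegrable f -> cintegrable g ->
  int (fun x => f x - g x) = int f - int g.
Proof.
move=> fi gi; rewrite cintegralD ?cintegralN//.
by under eq_fun do rewrite -mulN1r; exact: cintegrableZ.
Qed.

Lemma cintegral_sum I (r : seq I) (P : pred I) (F : I -> T -> R[i]) :
  (forall i, P i -> cintegrable (F i)) ->
  int (fun x => \sum_(i <- r | P i) F i x) = \sum_(i <- r | P i) int (F i).
Proof.
move=> mF; elim: r => [|i r ih].
  by under eq_fun do rewrite big_nil; rewrite big_nil cintegral0.
under eq_fun do rewrite big_cons.
rewrite big_cons -ih; case: (boolP (P i)) => [Pi|_] //; rewrite cintegralD//.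
  exact: mF.
exact: cintegrable_sum.
Qed.

Lemma cintegralJ f : cintegrable f ->
  int (fun x => (f x)^*) = (int f)^*.
Proof.
case=> f1 f2.
apply: complex_ext; rewrite ?ReJ ?ImJ /=.
- by under eq_Rintegral do rewrite ReJ.
- under eq_Rintegral do rewrite ImJ.
  rewrite -[RHS]mulN1r -RintegralZl//=.
  by under [RHS]eq_Rintegral do rewrite mulN1r.
Qed.

(* Rotate the integral to the positive real axis. *)
Lemma cmod_cintegral f : cintegrable f ->
  N (int f) <= \int[mu]_x N (f x).
Proof.
move=> fi; have mf := cintegrable_measurable fi.
have iN := (cintegrable_cmod mf).1 fi.
have [->|z0] := eqVneq (int f) 0.
  by rewrite cmod0; apply: Rintegral_ge0 => x _; exact: cmod_ge0.
have Nz : 0 < N (int f) by rewrite lt_neqAle eq_sym cmod_eq0 z0 cmod_ge0.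
rewrite -(ler_pM2l Nz) -expr2.
have -> : N (int f) ^+ 2 = complex.Re (int (fun x => (int f)^* * f x)).
  by rewrite cintegralZ// mulrC mul_conjc.
rewrite -RintegralZl//=; apply: le_Rintegral => //.
- by case: (cintegrableZ (int f)^* fi).
- exact: integrableZl_EFin.
- move=> x _; rewrite (le_trans (ler_norm _))// (le_trans (Re_le_cmod _))//.
  by rewrite cmodM cmodJ.
Qed.

End cintegral_theory.

(** * Square-integrable functions *)

Section square_integrable_theory.
Context {R : realType} {d} {T : measurableType d}.
Variable mu : {measure set T -> \bar R}.
Implicit Types (f g : T -> R[i]) (t : R).
Local Notation N := (@Normc.normc R).
Local Notation int := (cintegral mu setT).

Definition L2fun f :=
  cmeasurable setT f /\ mu.-integrable setT (fun x => (N (f x) ^+ 2)%:E).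

(** The square of the L^2 norm. Products are estimated with a free weight [t], as in [amgm_mul], in
    place of Cauchy-Schwarz; [t] is chosen where the estimate is used. *)
Definition nrm2 f : R := \int[mu]_x (N (f x) ^+ 2).

Lemma nrm2_ge0 f : 0 <= nrm2 f.
Proof. by apply: Rintegral_ge0 => x _; exact: sqr_ge0. Qed.

Lemma EFin_nrm2 f : L2fun f -> (nrm2 f)%:E = (\int[mu]_x (N (f x) ^+ 2)%:E)%E.
Proof. by move=> [_ fi]; rewrite fineK//; exact: integrable_fin_num. Qed.

Lemma le_L2fun f (g : T -> R) : cmeasurable setT f ->
  (forall x, N (f x) ^+ 2 <= g x) ->
  mu.-integrable setT (fun x => (g x)%:E) -> L2fun f.
Proof.
move=> mf fg ig; split => //; apply: le_integrable ig => //.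
  exact/measurable_EFinP/measurable_sqr_cmod.
move=> x _ /=; rewrite lee_fin (ger0_norm (sqr_ge0 _)).
exact: (le_trans (fg x) (ler_norm _)).
Qed.

Lemma L2fun_lty f : cmeasurable setT f ->
  (\int[mu]_x (N (f x) ^+ 2)%:E < +oo)%E -> L2fun f.
Proof.
move=> mf foo; split => //; apply/integrableP; split.
  exact/measurable_EFinP/measurable_sqr_cmod.
by under eq_integral do rewrite /= ger0_norm ?sqr_ge0//.
Qed.

Lemma amgm_mul t (a b : R) : 0 < t -> a * b <= (t * a ^+ 2 + t^-1 * b ^+ 2) / 2.
Proof.
move=> t0; rewrite -(ler_pM2l t0).
have -> : t * ((t * a ^+ 2 + t^-1 * b ^+ 2) / 2) = (t ^+ 2 * a ^+ 2 + b ^+ 2) / 2.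
  by field; rewrite gt_eqF.
have := sqr_ge0 (t * a - b); nra.
Qed.

Lemma cintegrableM f g : L2fun f -> L2fun g ->
  cintegrable mu (fun x => f x * g x).
Proof.
move=> [mf fi] [mg gi].
apply: (@le_cintegrable _ _ _ _ _ (fun x => N (f x) ^+ 2 + N (g x) ^+ 2)).
- exact: cmeasurableM.
- move=> x; rewrite cmodM; have := amgm_mul (N (f x)) (N (g x)) (@ltr01 R).
  by rewrite invr1 !mul1r; have := sqr_ge0 (N (f x)); have := sqr_ge0 (N (g x)); lra.
- by under eq_fun do rewrite EFinD; exact: integrableD.
Qed.

Lemma L2funZb f (h : T -> R[i]) B : L2fun f -> cmeasurable setT h ->
  (forall x, N (h x) <= B) -> L2fun (fun x => h x * f x).
Proof.
move=> [mf fi] mh hB.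
apply: (@le_L2fun _ (fun x => B ^+ 2 * N (f x) ^+ 2)).
- exact: cmeasurableM.
- move=> x; rewrite cmodM exprMn ler_wpM2r ?sqr_ge0// lerXn2r ?nnegrE ?cmod_ge0//.
  exact: le_trans (cmod_ge0 _) (hB x).
- by under eq_fun do rewrite EFinM; exact: integrableZl.
Qed.

Lemma L2funJ f : L2fun f -> L2fun (fun x => (f x)^*).
Proof.
move=> [mf fi]; split; first exact: cmeasurableJ.
by under eq_fun do rewrite cmodJ.
Qed.

Lemma L2funD f g : L2fun f -> L2fun g -> L2fun (fun x => f x + g x).
Proof.
move=> [mf fi] [mg gi].
apply: (@le_L2fun _ (fun x => 2 * (N (f x) ^+ 2) + 2 * N (g x) ^+ 2)).
- exact: cmeasurableD.
- move=> x; have := cmodD (f x) (g x).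
  have := cmod_ge0 (f x + g x); have := cmod_ge0 (f x); have := cmod_ge0 (g x).
  set a := N (f x); set b := N (g x); set c := N _ => a0 b0 c0 cab.
  have := sqr_ge0 (a - b); nra.
- under eq_fun do rewrite EFinD !EFinM.
  by apply: integrableD => //; exact: integrableZl.
Qed.

Lemma L2fun0 : L2fun (fun=> 0).
Proof.
split; first exact: cmeasurable_cst.
by under eq_fun do rewrite cmod0 expr0n/=; exact: integrable0.
Qed.

Lemma L2fun_sum I (r : seq I) (P : pred I) (F : I -> T -> R[i]) :
  (forall i, L2fun (F i)) -> L2fun (fun x => \sum_(i <- r | P i) F i x).
Proof.
move=> mF; elim: r => [|i r ih].
  by under eq_fun do rewrite big_nil; exact: L2fun0.
under eq_fun do rewrite big_cons.
by case: (P i) => //; exact: L2funD.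
Qed.

Lemma le_nrm2 f g : L2fun f -> L2fun g ->
  (forall x, N (f x) <= N (g x)) -> nrm2 f <= nrm2 g.
Proof.
move=> [_ fi] [_ gi] fg; apply: le_Rintegral => // x _.
by rewrite lerXn2r ?nnegrE ?cmod_ge0.
Qed.

Lemma nrm2Z c f : L2fun f -> nrm2 (fun x => c * f x) = N c ^+ 2 * nrm2 f.
Proof.
move=> [_ fi]; rewrite /nrm2 -RintegralZl//.
by apply: eq_Rintegral => x _; rewrite cmodM exprMn.
Qed.

Lemma cmod_cintegral_mul (h : T -> R[i]) B f g t : 0 < t -> 
  cmeasurable setT h -> (forall x, N (h x) <= B) -> L2fun f -> L2fun g ->
  N (int (fun x => h x * (f x * (g x)^*))) <= B * ((t * nrm2 f + t^-1 * nrm2 g) / 2).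
Proof.
move=> t0 mh hB Lf Lg; have [_ fi] := Lf; have [_ gi] := Lg.
have ifg : cintegrable mu (fun x => h x * (f x * (g x)^*)).
  under eq_fun do rewrite mulrA.
  by apply: cintegrableM; [exact: L2funZb hB|exact: L2funJ].
rewrite (le_trans (cmod_cintegral ifg))//.
pose k x := (t * N (f x) ^+ 2 + t^-1 * N (g x) ^+ 2) / 2.
have ik : mu.-integrable setT (EFin \o k).
  rewrite /k /comp; under eq_fun do rewrite mulrC.
  apply: integrableZl_EFin; rewrite /comp; under eq_fun do rewrite EFinD.
  by apply: integrableD => //; exact: integrableZl_EFin.
have -> : (t * nrm2 f + t^-1 * nrm2 g) / 2 = \int[mu]_x k x.
  have i1 := integrableZl_EFin t fi; have i2 := integrableZl_EFin t^-1 gi.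
  rewrite RintegralZr//; first by rewrite RintegralD// !RintegralZl.
  by rewrite /comp; under eq_fun do rewrite EFinD; exact: integrableD.
rewrite -RintegralZl//; apply: le_Rintegral => //.
- by apply/cintegrable_cmod => //; exact: cintegrable_measurable ifg.
- exact: integrableZl_EFin.
- move=> x _; rewrite !cmodM cmodJ.
  by rewrite ler_pM ?cmod_ge0 ?mulr_ge0 ?cmod_ge0//; exact: amgm_mul.
Qed.

End square_integrable_theory.

(** * Lebesgue measure on rows *)

Section row_norm.
Context {R : realType} (d : nat).
Implicit Types x y : 'rV[R]_d.

Lemma row_normP x (e : R) : 0 < e -> (`|x| < e) <-> (forall i, `|x 0 i| < e).
Proof.
move=> e0; split => [xe i|xe]; last first.
  rewrite [X in X < _]/Num.Def.normr/= mx_normrE; apply/bigmax_ltP; split => //.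
  by move=> [j i] _ /=; rewrite (ord1 j).
apply: le_lt_trans xe; rewrite [X in _ <= X]/Num.Def.normr/= mx_normrE.
exact: (le_bigmax _ (fun i => `|x i.1 i.2|) (0, i)).
Qed.

Lemma row_norm_leP x (e : R) : 0 <= e -> (`|x| <= e) <-> (forall i, `|x 0 i| <= e).
Proof.
move=> e0; split => [xe i|xe]; last first.
  rewrite [X in X <= _]/Num.Def.normr/= mx_normrE; apply/bigmax_leP; split => //.
  by move=> [j i] _ /=; rewrite (ord1 j).
apply: le_trans xe; rewrite [X in _ <= X]/Num.Def.normr/= mx_normrE.
exact: (le_bigmax _ (fun i => `|x i.1 i.2|) (0, i)).
Qed.

Definition row_box (q : 'rV[R]_d) (e : R) : set 'rV[R]_d :=
  [set x | forall i, `|q 0 i - x 0 i| < e].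

Lemma measurable_row_box q e : measurable (row_box q e).
Proof.
rewrite (_ : row_box q e = \big[setI/setT]_(i < d)
    ((fun x : 'rV[R]_d => x 0 i) @^-1` (ball (q 0 i) e))); last first.
  rewrite -bigcap_seq; apply/seteqP; split => [x qx i _|x qx i]; first exact: qx.
  by apply: (qx i) => /=; rewrite mem_index_enum.
apply: bigsetI_measurable => i _.
rewrite -[X in measurable X]setTI; apply: measurable_coord => //.
exact: measurable_ball.
Qed.
End row_norm.

Section row_borel.
Context {R : realType} {d : nat}.

Lemma row_ballE (q : 'rV[R]_d) (e : R) : 0 < e -> ball q e = row_box q e.
Proof.
move=> e0; apply/seteqP; split => x; rewrite -ball_normE /=.
  by move=> /(row_normP _ e0) h i; have := h i; rewrite !mxE.
by move=> h; apply/(row_normP _ e0) => i; rewrite !mxE; exact: h.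
Qed.

(** An open set is the union of the boxes contained in it that have a rational centre and a radius 1
    / (n + 1), and there are countably many of these. *)
Lemma open_measurable_row (A : set 'rV[R]_d) : open A -> measurable A.
Proof.
move=> oA.
pose B (p : 'rV[rat]_d * nat) : set 'rV[R]_d :=
  let b := row_box (map_mx ratr p.1) (p.2.+1%:R^-1 : R) in
  if pselect (b `<=` A) then b else set0.
have -> : A = \bigcup_(p in setT) B p.
  apply/seteqP; split => [x Ax|x [p _]]; last first.
    by rewrite /B; case: pselect => //= bA; exact: bA.
  have /nbhs_ballP[e /= e0 eA] : nbhs x A by exact: open_nbhs_nbhs.
  have [n ne] : exists n : nat, n.+1%:R^-1 + n.+1%:R^-1 < e :> R.
    have [n _ ne] := near_infty_natSinv_lt (PosNum (divr_gt0 e0 (ltr0n _ 2))).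
    exists n; have : n.+1%:R^-1 < e / 2 by exact: (ne n (leqnn n)).
    by rewrite ltr_pdivlMr// mulr2n mulrDr mulr1.
  have /choice[q qx] : forall i : 'I_d, exists q : rat,
      `|ratr q - x 0 i| < n.+1%:R^-1.
    move=> i; have n0 : 0 < n.+1%:R^-1 :> R by rewrite invr_gt0.
    have /rat_in_itvoo[q] : x 0 i - n.+1%:R^-1 < x 0 i + n.+1%:R^-1.
      by rewrite ltrBlDr -addrA ltrDl addr_gt0.
    by rewrite in_itv/= => q1; exists q; rewrite ltr_distl.
  exists (\row_i q i, n) => //; rewrite /B.
  have xb : row_box (map_mx ratr (\row_i q i)) (n.+1%:R^-1 : R) x.
    by move=> i; rewrite !mxE; exact: qx.
  case: pselect => //= nbA; exfalso; apply: nbA => y yb; apply: eA.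
  rewrite row_ballE// => i; apply: le_lt_trans ne.
  rewrite (le_trans (ler_distD (ratr (q i)) _ _))// lerD//.
    by rewrite distrC ltW.
  by have := yb i; rewrite !mxE => /ltW.
apply: countable_bigcupT_measurable; first exact: countableP.
move=> p; rewrite /B; case: pselect => ? /=; [exact: measurable_row_box|exact: measurable0].
Qed.

Lemma closed_measurable_row (A : set 'rV[R]_d) : closed A -> measurable A.
Proof.
by move=> cA; rewrite -[A]setCK; apply: measurableC; apply: open_measurable_row; exact: closed_openC.
Qed.

Lemma compact_measurable_row (A : set 'rV[R]_d) : compact A -> measurable A.
Proof.
move=> cA; apply: closed_measurable_row; apply: compact_closed => //.
Qed.

Lemma continuous_measurable_row (A : set 'rV[R]_d) (f : 'rV[R]_d -> R) :
  open A -> {in A, continuous f} -> measurable_fun A f.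
Proof.
move=> oA cf; apply: (measurability _ (RGenOInfty.measurableE R)) => //.
move=> _ [_ [a ->] <-]; apply: open_measurable_row.
rewrite openE => x [Ax fax]; near=> y; split; first by near: y; exact: open_nbhs_nbhs.
near: y; apply: cf; first by rewrite inE.
by apply: open_nbhs_nbhs; split => //; exact: interval_open.
Unshelve. all: end_near. Qed.

End row_borel.

(** * Tonelli, translations, and finite measure of compact sets *)

Section row_integral.
Context {R : realType}.
Local Notation leb := (@lebesgue_measure R).
Local Open Scope ereal_scope.

Lemma ge0_integral_row_cons d (f : 'rV[R]_d.+1 -> \bar R) :
  measurable_fun setT f -> (forall x, 0 <= f x) ->
  \int[lebesgue_row d.+1]_x f x =
  \int[leb]_x \int[lebesgue_row d]_y f (row_cons (x, y)).
Proof.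
move=> mf f0.
transitivity (\int[pushforward (leb \x lebesgue_row d) (@row_cons R d)]_x f x).
  by [].
rewrite ge0_integral_pushforward//; last exact: measurable_row_cons.
rewrite preimage_setT fubini_tonelli1//.
- exact: (measurableT_comp mf (@measurable_row_cons R d)).
- by move=> x /=; exact: f0.
Qed.

Lemma lebesgue_measure_shift (a : R) (A : set R) : measurable A ->
  pushforward leb ((fun x : R => x + a)%R : _ -> measurableTypeR R) A = leb A.
Proof.
move=> mA; apply/esym/lebesgue_measure_unique => //=; first exact: measurable_funD.
  move=> _ _ [[b c]] _ <-.
  rewrite /pushforward (_ : _ @^-1` _ = `](b - a)%R, (c - a)%R]%classic).
    rewrite !lebesgue_measure_itv/= !lte_fin ltrD2r.
    by case: ifP => // _; rewrite -!EFinB; congr (_%:E); lra.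
  by apply/seteqP; split => x /=; rewrite !in_itv/= ltrBlDr lerBrDr.
Qed.

Lemma ge0_integral_shift (a : R) (f : R -> \bar R) :
  measurable_fun setT f -> (forall x, 0 <= f x) ->
  \int[leb]_x f (x + a)%R = \int[leb]_x f x.
Proof.
move=> mf f0.
transitivity (\int[pushforward leb ((fun x : R => x + a)%R : _ -> measurableTypeR R)]_x f x).
  rewrite ge0_integral_pushforward//; exact: measurable_funD.
apply: eq_measure_integral => [|? A mA _]; first exact: measurable_funD.
exact: lebesgue_measure_shift.
Qed.

Lemma row_consD d (x : R) (y : 'rV[R]_d) (a : 'rV[R]_d.+1) :
  (row_cons (x, y) + a =
  row_cons ((x + a 0 ord0), (y + \row_j a 0 (lift ord0 j))))%R.
Proof.
apply/rowP => i; rewrite !mxE; case: unliftP => [j ->|->] //=.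
by rewrite !mxE.
Qed.

Lemma row_cons0 d (x : R) (y : 'rV[R]_d) : row_cons (x, y) 0%R ord0 = x.
Proof. by rewrite mxE unlift_none. Qed.

Lemma row_consS d (x : R) (y : 'rV[R]_d) i :
  row_cons (x, y) 0%R (lift ord0 i) = y 0%R i.
Proof. by rewrite mxE liftK. Qed.

Lemma measurable_row_shift d (a : 'rV[R]_d) :
  measurable_fun setT (fun x : 'rV[R]_d => (x + a)%R).
Proof.
apply: measurable_fun_rowP => i; under eq_fun do rewrite mxE.
by apply: measurable_funD => //; exact: measurable_coord.
Qed.

Lemma measurable_row_cons_l d (x : R) :
  measurable_fun setT (fun y : 'rV[R]_d => row_cons (x, y)).
Proof. exact: (measurableT_comp (@measurable_row_cons R d)). Qed.

Lemma ge0_integral_row_shift d (a : 'rV[R]_d) (f : 'rV[R]_d -> \bar R) :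
  measurable_fun setT f -> (forall x, 0 <= f x) ->
  \int[lebesgue_row d]_x f (x + a)%R = \int[lebesgue_row d]_x f x.
Proof.
elim: d => [|d ih] in a f *; move=> mf f0.
  by apply: eq_integral => x _; congr f; apply/rowP => -[].
have mfa := measurableT_comp mf (measurable_row_shift a).
rewrite (ge0_integral_row_cons mf f0).
rewrite (ge0_integral_row_cons mfa (fun x => f0 (x + a)%R)) /=.
under eq_integral => x _.
  under eq_integral => y _ do rewrite row_consD.
  rewrite (ih _ (fun y => f (row_cons ((x + a 0 ord0)%R, y))))//; last first.
    apply: (measurableT_comp mf); exact: measurable_row_cons_l.
  over.
rewrite (ge0_integral_shift _ (f := fun x => \int[lebesgue_row d]_y f (row_cons (x, y))))//.
- apply: (@measurable_fun_fubini_tonelli_F _ _ _ _ R (lebesgue_row d) (fun p => f (row_cons p))) => //.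
  exact: (measurableT_comp mf (@measurable_row_cons R d)).
- by move=> x; exact: integral_ge0.
Qed.

Lemma integral_row_shift d (a : 'rV[R]_d) (f : 'rV[R]_d -> \bar R) :
  measurable_fun setT f ->
  \int[lebesgue_row d]_x f (x + a)%R = \int[lebesgue_row d]_x f x.
Proof.
move=> mf; rewrite integralE [RHS]integralE; congr (_ - _).
- have := @ge0_integral_row_shift d a (f^\+)%E (measurable_funepos mf) (fun x => funepos_ge0 f x).
  by move=> <-; apply: eq_integral => x _; rewrite !funeposE.
- have := @ge0_integral_row_shift d a (f^\-)%E (measurable_funeneg mf) (fun x => funeneg_ge0 f x).
  by move=> <-; apply: eq_integral => x _; rewrite !funenegE.
Qed.

Lemma cintegral_row_shift d (a : 'rV[R]_d) (f : 'rV[R]_d -> R[i]) :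
  cmeasurable setT f ->
  cintegral (lebesgue_row d) setT (fun x => f (x + a)%R) =
  cintegral (lebesgue_row d) setT f.
Proof.
move=> [f1 f2]; rewrite /cintegral /Rintegral; congr (fine _ +i* fine _)%C.
- by rewrite (integral_row_shift a (f := fun x => (complex.Re (f x))%:E))//; exact/measurable_EFinP.
- by rewrite (integral_row_shift a (f := fun x => (complex.Im (f x))%:E))//; exact/measurable_EFinP.
Qed.

Lemma lebesgue_row_box d (M : R) : lebesgue_row d (row_box 0%R M) < +oo.
Proof.
elim: d => [|d ih].
  by rewrite /= diracE; case: (_ \in _); rewrite ltry.
rewrite [lebesgue_row _ _](_ : _ =
  (leb \x lebesgue_row d) (ball 0%R M `*` row_box 0%R M)).
  rewrite product_measure1E//; last 2 first.
  - exact: measurable_ball.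
  - exact: measurable_row_box.
  have [M0|M0] := leP M 0%R.
    rewrite (_ : ball _ _ = set0) ?measure0 ?mul0e ?ltry//.
    by rewrite -subset0 => x; rewrite /ball/= => /(le_lt_trans (normr_ge0 _)); rewrite ltNge M0.
  rewrite (_ : _ (ball _ _) = (M *+ 2)%:E); last exact: lebesgue_measure_ball (ltW M0).
  by rewrite lte_mul_pinfty// ?lee_fin// mulrn_wge0// ltW.
rewrite /= /lebesgue_row_step /pushforward; congr (_ _).
apply/seteqP; split => -[x y] /=; rewrite /row_box /ball /=.
- move=> h; split; first by have := h ord0; rewrite row_cons0 mxE.
  by move=> i; have := h (lift ord0 i); rewrite row_consS !mxE.
- move=> [hx hy] i; case: (unliftP ord0 i) => [j ->|->].
    by rewrite row_consS mxE; have := hy j; rewrite mxE.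
  by rewrite row_cons0 mxE.
Qed.

Lemma compact_row_box d (K : set 'rV[R]_d) : compact K ->
  exists M : R, (0 < M)%R /\ K `<=` row_box 0%R M.
Proof.
move=> /compact_bounded[M [_ KM]]; exists (`|M| + 1)%R; split => [|x Kx].
  by rewrite ltr_wpDl.
rewrite -row_ballE ?ltr_wpDl// -ball_normE/= sub0r normrN.
have M1 : (M < `|M| + 1/2)%R by rewrite (le_lt_trans (ler_norm _))// ltrDl.
by rewrite (le_lt_trans (KM _ M1 _ Kx))// ltrD2l; lra.
Qed.

Lemma compact_lty d (K : set 'rV[R]_d) : compact K -> lebesgue_row d K < +oo.
Proof.
move=> cK; have [M [_ KM]] := compact_row_box cK.
apply: le_lt_trans (lebesgue_row_box d M); apply: le_measure => //; rewrite inE.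
- exact: compact_measurable_row.
- exact: measurable_row_box.
Qed.

End row_integral.

(** * The Plancherel inequality *)

Section parametric_integrals.
Context {R : realType} {d1 d2} {T1 : measurableType d1} {T2 : measurableType d2}.
Variables (m1 : {sigma_finite_measure set T1 -> \bar R})
  (m2 : {sigma_finite_measure set T2 -> \bar R}).

(** Sections need not be integrable: the integral is the difference of those of the positive and
    negative parts, and Tonelli gives the measurability of each. *)
Lemma measurable_Rintegral_param (f : T1 * T2 -> R) : measurable_fun setT f ->
  measurable_fun setT (fun x => \int[m2]_y f (x, y)).
Proof.
move=> mf; rewrite /Rintegral.
apply: (@measurableT_comp _ _ _ _ _ _ (@fine R)) => //.
under eq_fun do rewrite integralE.
have mE : measurable_fun setT (EFin \o f) by exact/measurable_EFinP.
apply: emeasurable_funB.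
- under eq_fun => x.
    rewrite (_ : funepos _ = (fun y => (EFin \o f)^\+%E (x, y))); last first.
      by apply/funext => y; rewrite !funeposE.
    over.
  apply: (@measurable_fun_fubini_tonelli_F _ _ _ _ R m2 ((EFin \o f)^\+)%E).
  + exact: measurable_funepos.
  + by move=> x; exact: funepos_ge0.
- under eq_fun => x.
    rewrite (_ : funeneg _ = (fun y => (EFin \o f)^\-%E (x, y))); last first.
      by apply/funext => y; rewrite !funenegE.
    over.
  apply: (@measurable_fun_fubini_tonelli_F _ _ _ _ R m2 ((EFin \o f)^\-)%E).
  + exact: measurable_funeneg.
  + by move=> x; exact: funeneg_ge0.
Qed.

Lemma cmeasurable_param (f : T1 * T2 -> R[i]) : cmeasurable setT f ->
  cmeasurable setT (fun x => cintegral m2 setT (fun y => f (x, y))).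
Proof.
move=> [f1 f2]; split => /=.
- exact: (measurable_Rintegral_param f1).
- exact: (measurable_Rintegral_param f2).
Qed.

Lemma ae_eq_Rintegral (f g : T1 -> R) : measurable_fun setT f ->
  measurable_fun setT g -> {ae m1, forall x, f x = g x} ->
  \int[m1]_x f x = \int[m1]_x g x.
Proof.
move=> mf mg fg; rewrite /Rintegral; congr fine; apply: ae_eq_integral => //.
- exact/measurable_EFinP.
- exact/measurable_EFinP.
- by apply: filterS fg => x -> _.
Qed.

Lemma ae_eq_cintegral (f g : T1 -> R[i]) : cmeasurable setT f ->
  cmeasurable setT g -> {ae m1, forall x, f x = g x} ->
  cintegral m1 setT f = cintegral m1 setT g.
Proof.
move=> [f1 f2] [g1 g2] fg; apply: complex_ext => /=; apply: ae_eq_Rintegral => //.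
- by apply: filterS fg => x ->.
- by apply: filterS fg => x ->.
Qed.

Lemma Rintegral_prod (f : T1 * T2 -> R) :
  (m1 \x m2)%E.-integrable setT (EFin \o f) ->
  \int[(m1 \x m2)%E]_p f p = \int[m1]_x \int[m2]_y f (x, y).
Proof.
move=> fi; rewrite {1}/Rintegral -integral12_prod_meas1//.
rewrite [RHS]/Rintegral; congr fine.
have mf : measurable_fun setT f by apply/measurable_EFinP; exact: measurable_int fi.
apply: ae_eq_integral => //.
- by have /measurable_int := integrable_fubini_F fi.
- exact/measurable_EFinP/measurable_Rintegral_param.
- have := integrable_ae measurableT (integrable_fubini_F fi).
  by apply: filterS => x /(_ I) h _; rewrite fineK.
Qed.

Lemma ae_cintegrable_section (f : T1 * T2 -> R[i]) : cintegrable (m1 \x m2)%E f ->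
  {ae m1, forall x, cintegrable m2 (fun y => f (x, y))}.
Proof.
move=> [/ae_integrable1 f1 /ae_integrable1 f2].
by move: f1 f2; apply: filterS2 => x h1 h2; split.
Qed.

End parametric_integrals.

(** * Bessel's inequality and Plancherel on the line *)

Section bessel.
Context {R : realType}.
Local Notation leb := (@lebesgue_measure R).
Local Notation N := (@Normc.normc R).
Variable (T : R).
Hypothesis T0 : 0 < T.

Lemma sin_natpi n : sin (pi * n%:R) = 0 :> R.
Proof.
elim: n => [|n ih]; first by rewrite mulr0 sin0.
by rewrite -natr1 mulrDr mulr1 sinDpi ih oppr0.
Qed.

(** The condition on [sin] makes the primitive [c^-1 * sin (c * x)] vanish at both ends of the
    interval; the other primitive is even. *)
Lemma cintegral_expi_itv (c : R) : c != 0 -> sin (c * T) = 0 ->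
  cintegral leb setT (fun x => (\1_(`[- T, T]) x)%:C%C * expi (c * x)) = 0.
Proof.
move=> c0 scT.
have TT : - T < T by rewrite gtrN.
have dM (x : R) : is_derive x (1 : R) ( *%R c) c.
  have := @is_deriveZ R R R id c x 1 1 (is_derive_id _ _).
  by rewrite /GRing.scale/= mulr1.
have dS (x : R) : is_derive x (1 : R) (fun x : R => c^-1 * sin (c * x)) (cos (c * x)).
  have := @is_deriveZ R R R (fun x => sin (c * x)) c^-1 x 1 (c * cos (c * x)).
  rewrite /GRing.scale/= mulrA mulVf// mul1r; apply.
  have h := @is_derive1_comp R sin (fun x => c * x) x (cos (c * x)) c.
  by rewrite [c * cos _]mulrC; apply: h.
have dC (x : R) : is_derive x (1 : R) (fun x : R => - c^-1 * cos (c * x)) (sin (c * x)).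
  have := @is_deriveZ R R R (fun x => cos (c * x)) (- c^-1) x 1 (c * (- sin (c * x))).
  rewrite /GRing.scale/= mulrA mulNr mulVf// mulrNN mul1r; apply.
  have h := @is_derive1_comp R cos (fun x => c * x) x (- sin (c * x)) c.
  by rewrite [c * - sin _]mulrC; apply: h.
have key (F f : R -> R) : (forall x : R, is_derive x (1:R) F (f x)) -> continuous f ->
    F T = F (- T) -> \int[leb]_x (\1_(`[- T, T]) x * f x) = 0.
  move=> dF cf FT.
  rewrite (_ : (fun x => \1_(`[- T, T]) x * f x) = (f \_ `[- T, T])); last first.
    by apply/funext => x; rewrite patchE indicE; case: ifP => _; rewrite ?mul1r ?mul0r.
  rewrite -Rintegral_mkcond /Rintegral.
  rewrite (continuous_FTC2 TT (F := F)) ?FT -?EFinB ?subrr//.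
  - by apply: continuous_subspaceT => x; exact: cf.
  - have cF : continuous F.
      by move=> x; apply: differentiable_continuous; apply/derivable1_diffP.
    split.
    + by move=> x _.
    + by apply: cvg_at_right_filter; exact: cF.
    + by apply: cvg_at_left_filter; exact: cF.
  - by move=> x _; rewrite derive1E; exact: derive_val.
apply: complex_ext => /=.
- under eq_Rintegral do rewrite mul0r subr0.
  apply: (key _ _ dS).
  + by move=> x; apply: continuous_comp; [exact: mulrl_continuous|exact: continuous_cos].
  + by rewrite mulrN sinN scT oppr0.
- under eq_Rintegral do rewrite mul0r addr0.
  apply: (key _ _ dC).
  + by move=> x; apply: continuous_comp; [exact: mulrl_continuous|exact: continuous_sin].
  + by rewrite mulrN cosN.
Qed.


Definition hat1 (h : measurableTypeR R -> R[i]) (xi : R) : R[i] :=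
  cintegral leb setT (fun x => expi (- (2 * pi * (x * xi))) * h x).

(** A character cut off to an interval of length 2 T, on which frequencies spaced by 1 / (2 T) are
    orthogonal. *)
Let wave (xi x : R) : R[i] := (\1_(`[- T, T]) x)%:C%C * expi (2 * pi * xi * x).

Lemma cintegral_sqr_cmod d (X : measurableType d) (mu : {measure set X -> \bar R})
    (f : X -> R[i]) :
  cintegral mu setT (fun x => f x * (f x)^*) = (nrm2 mu f)%:C%C.
Proof.
apply: complex_ext => /=.
- by apply: eq_Rintegral => x _; rewrite mul_conjc.
- under eq_Rintegral do rewrite mul_conjc/=.
  by rewrite /Rintegral integral0.
Qed.

Let wave_L2 xi : L2fun leb (wave xi).
Proof.
apply: (@le_L2fun R _ (measurableTypeR R) leb _ (\1_(`[- T, T]) : R -> R)).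
- apply: cmeasurableM.
    by apply: cmeasurableR; apply: measurable_indic; exact: measurable_itv.
  by apply: cmeasurable_expi; exact: mulrl_measurable.
- move=> x; rewrite cmodM cmod_expi mulr1 cmodR indicE.
  by case: (_ \in _); rewrite ?normr1 ?normr0 ?expr1n// expr0n.
- exact: integrable_indic_itv.
Qed.

Let wave_orth (a : R) (k l : nat) :
  cintegral leb setT (fun x => wave (a + k%:R / (2 * T)) x *
    (wave (a + l%:R / (2 * T)) x)^*) = (if k == l then 2 * T else 0)%:C%C.
Proof.
have TT : - T < T by rewrite gtrN.
have T2 : 2 * T != 0 by rewrite mulf_neq0// gt_eqF.
have -> : (fun x => wave (a + k%:R / (2 * T)) x * (wave (a + l%:R / (2 * T)) x)^*) =
    (fun x => (\1_(`[- T, T]) x)%:C%C * expi (pi * (k%:R - l%:R) / T * x)).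
  apply/funext => x; rewrite /wave rmorphM/= -expiN mulrACA -expiD.
  congr (_ * expi _).
    rewrite indicE; case: (_ \in _); apply: complex_ext;
      by rewrite ?ReM ?ImM ?ReJ ?ImJ /= ?(mulr1, mulr0, mul0r, oppr0, subr0, addr0).
  by field; rewrite gt_eqF.
have [->|kl] := eqVneq k l.
  rewrite subrr mulr0 mul0r.
  under eq_fun do rewrite mul0r expi0 mulr1.
  apply: complex_ext => /=; last by rewrite /Rintegral integral0.
  rewrite /Rintegral integral_indic// setIT.
  rewrite [X in fine X](lebesgue_measure_itv `[- T, T]) /= lte_fin TT.
  by rewrite -EFinB/= opprK mulr_natl mulr2n.
apply: cintegral_expi_itv.
- apply: mulf_neq0; last by rewrite invr_neq0 ?gt_eqF.
  apply: mulf_neq0; first by rewrite gt_eqF ?pi_gt0.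
  by rewrite subr_eq0 eqr_nat.
- rewrite mulfVK ?gt_eqF// mulrBr sinB !sin_natpi; ring.
Qed.

Lemma bessel (h : measurableTypeR R -> R[i]) (a : R) (m : nat) : L2fun leb h ->
  (forall x, ~ (`|x| < T) -> h x = 0) ->
  \sum_(k < m) N (hat1 h (a + k%:R / (2 * T))) ^+ 2 <= 2 * T * nrm2 leb h.
Proof.
move=> Lh hT.
pose e (k : nat) := wave (a + k%:R / (2 * T)).
pose c (k : nat) := hat1 h (a + k%:R / (2 * T)).
have cE k : c k = cintegral leb setT (fun x => h x * (e k x)^*).
  rewrite /c /hat1; congr cintegral; apply/funext => x.
  rewrite /e /wave; have [xT|/hT ->] := pselect (`|x| < T); last by rewrite mulr0 mul0r.
  rewrite indicE mem_set ?mul1r; last first.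
    by move: xT; rewrite /= in_itv/= ltr_norml => /andP[/ltW -> /ltW ->].
  by rewrite mulrC -expiN; congr (_ * expi _); ring.
set S := \sum_(k < m) N (hat1 h _) ^+ 2.
(* [G] is 2 T times the projection of [h] on the span of the [e k]. By orthogonality its inner
   product with [h] is [S], and its squared norm is 2 T S. *)
pose G x := \sum_(k < m) c k * e k x.
have LG : L2fun leb G.
  apply: L2fun_sum => k.
  apply: (L2funZb (B := N (c k))) => //; first [exact: wave_L2|exact: cmeasurable_cst].
have iee k l : cintegrable leb (fun x => e k x * (e l x)^*).
  by apply: cintegrableM; [exact: wave_L2|apply: L2funJ; exact: wave_L2].
have he k : cintegrable leb (fun x => h x * (e k x)^*).
  by apply: cintegrableM => //; apply: L2funJ; exact: wave_L2.
have JG x : (G x)^* = \sum_(k < m) (c k)^* * (e k x)^*.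
  by rewrite /G rmorph_sum/=; apply: eq_bigr => k _; rewrite rmorphM.
have hG : cintegral leb setT (fun x => 1 * (h x * (G x)^*)) = S%:C%C.
  under eq_fun => x.
    rewrite mul1r JG mulr_sumr.
    under eq_bigr do rewrite mulrCA.
    over.
  rewrite cintegral_sum => [|k _]; last exact: cintegrableZ.
  have -> : S%:C%C = \sum_(l < m) (N (c l) ^+ 2)%:C%C by rewrite /S rmorph_sum.
  apply: eq_bigr => k _.
  by rewrite cintegralZ// -cE mulrC mul_conjc.
have GG : nrm2 leb G = 2 * T * S.
  suff : (nrm2 leb G)%:C%C = (2 * T * S)%:C%C by case.
  rewrite -cintegral_sqr_cmod.
  under eq_fun => x.
    rewrite JG mulr_sumr.
    under eq_bigr => l _.
      rewrite mulrCA /G mulr_suml mulr_sumr.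
      under eq_bigr => k _ do rewrite -mulrA.
      over.
    over.
  rewrite cintegral_sum => [|l _]; last first.
    by apply: cintegrable_sum => k _; do 2 apply: cintegrableZ.
  have -> : (2 * T * S)%:C%C = \sum_(l < m) (2 * T * N (c l) ^+ 2)%:C%C.
    by rewrite /S mulr_sumr rmorph_sum.
  apply: eq_bigr => l _.
  rewrite cintegral_sum => [|k _]; last by do 2 apply: cintegrableZ.
  rewrite (bigD1 l)//= big1 ?addr0 => [|k kl]; last first.
    rewrite !cintegralZ//; last exact: cintegrableZ.
    by rewrite wave_orth ifF ?mulr0//; exact/negbTE.
  rewrite !cintegralZ//; last exact: cintegrableZ.
  by rewrite wave_orth eqxx mulrA (mulrC _^* _) mul_conjc -rmorphM/= mulrC.
(* The weight 2 T turns the product bound into S <= (2 T * nrm2 h + S) / 2, and the [S] on the right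
   is absorbed. *)
have T20 : 0 < 2 * T by rewrite mulr_gt0.
have N1 (x : measurableTypeR R) : N ((fun=> 1) x) <= 1 by rewrite cmod1.
have := cmod_cintegral_mul T20 (cmeasurable_cst _ _) N1 Lh LG.
rewrite hG cmodR GG ger0_norm; last by apply: sumr_ge0 => k _; exact: sqr_ge0.
rewrite mulKf ?gt_eqF// mul1r ler_pdivlMr// [S * 2]mulr_natr mulr2n lerD2r.
exact.
Qed.


Lemma cmeasurable_hat1 (h : measurableTypeR R -> R[i]) : cmeasurable setT h ->
  cmeasurable setT (hat1 h).
Proof.
move=> mh; pose f (p : measurableTypeR R * measurableTypeR R) : R[i] :=
  expi (- (2 * pi * ((p.2 : R) * (p.1 : R)))) * h p.2.
apply: (@cmeasurable_param R _ _ (measurableTypeR R) (measurableTypeR R) leb f).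
apply: cmeasurableM.
- apply: cmeasurable_expi; apply: measurable_funN; apply: measurable_funM => //.
  by apply: measurable_funM; [exact: measurable_snd|exact: measurable_fst].
- exact: (cmeasurable_comp mh measurable_snd).
Qed.

(** Folds an interval of [m] periods onto the single period [0, l). *)
Lemma ge0_integral_itv_shift (G : R -> \bar R) (b l : R) (m : nat) : 0 < l ->
  measurable_fun setT G -> (forall x, 0 <= G x)%E ->
  (\int[leb]_(x in `[b, (b + m%:R * l)%R[) G x =
   \sum_(k < m) \int[leb]_(x in `[0%R, l[) G (b + k%:R * l + x)%R)%E.
Proof.
move=> l0 mG G0; elim: m => [|m ih].
  by rewrite mul0r addr0 set_itvco0 integral_set0 big_ord0.
have mml : b <= b + m%:R * l by rewrite lerDl mulr_ge0// ltW.
have mSl : b + m%:R * l <= b + m.+1%:R * l.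
  by rewrite lerD2l ler_wpM2r ?(ltW l0)// ler_nat.
rewrite big_ord_recr/= -ih.
rewrite (@itv_bndbnd_setU _ _ _ (BLeft (b + m%:R * l)))//.
rewrite ge0_integral_setU//; last 2 first.
- exact: measurable_funTS.
- rewrite disj_set2E; apply/eqP; rewrite -subset0 => x /= [].
  by rewrite !in_itv/= => /andP[_ +] /andP[+ _]; move=> /lt_le_trans /[apply]; rewrite ltxx.
congr (_ + _)%E.
rewrite integral_mkcond -(ge0_integral_shift (b + m%:R * l)%R); last 2 first.
- apply/(measurable_restrictT _ _).1 => //; exact: measurable_funTS.
- by move=> x; rewrite erestrict_ge0.
rewrite [RHS]integral_mkcond; apply: eq_integral => x _.
rewrite !patchE.
have -> : (x + (b + m%:R * l) \in `[(b + m%:R * l)%R, (b + m.+1%:R * l)%R[%classic) =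
  (x \in `[0%R, l[%classic).
  have E : (b + m%:R * l <= x + (b + m%:R * l) < b + m.+1%:R * l) = (0 <= x < l).
    by rewrite lerDr -natr1 mulrDl mul1r [X in _ < X]addrA [x + _]addrC ltrD2l.
  by apply/idP/idP; rewrite !inE/= !in_itv/= E.
by rewrite addrC.
Qed.

(** Bessel's inequality is integrated over an offset in [0, l) with l = 1 / (2 T). The sum over
    shifted frequencies becomes an integral over [-n l, n l), and the factor 2 T cancels the length
    of the period; then n tends to infinity. *)
Lemma plancherel1 (h : measurableTypeR R -> R[i]) : cmeasurable setT h ->
  (forall x, ~ (`|x| < T) -> h x = 0) ->
  (\int[leb]_x (N (hat1 h x) ^+ 2)%:E <= \int[leb]_x (N (h x) ^+ 2)%:E)%E.
Proof.
move=> mh hT.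
have [hoo|] := ltP (\int[leb]_x (N (h x) ^+ 2)%:E)%E +oo%E; last first.
  by rewrite leye_eq => /eqP ->; rewrite leey.
have Lh := L2fun_lty mh hoo.
rewrite -(EFin_nrm2 Lh).
set G := fun x => (N (hat1 h x) ^+ 2)%:E.
have mG : measurable_fun setT G.
  by apply/measurable_EFinP/measurable_sqr_cmod/cmeasurable_hat1.
have G0 x : (0 <= G x)%E by rewrite lee_fin sqr_ge0.
pose l := (2 * T)^-1.
have l0 : 0 < l by rewrite invr_gt0 mulr_gt0.
pose F (n : nat) : set (measurableTypeR R) := `[(- (n%:R * l)), (- (n%:R * l) + n.*2%:R * l)[%classic.
have FE n : F n = `[(- (n%:R * l)), (n%:R * l)[%classic.
  rewrite /F; have -> // : - (n%:R * l) + n.*2%:R * l = n%:R * l.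
  by rewrite -addnn natrD mulrDl addKr.
have UF : \bigcup_n F n = setT.
  rewrite -subTset => x _; have [n xn] : exists n : nat, `|x| / l < n%:R.
    by exists (Num.truncn (`|x| / l)).+1; exact: truncnS_gt.
  exists n => //; rewrite FE/= in_itv/=.
  by move: xn; rewrite ltr_pdivrMr// ltr_norml => /andP[/ltW -> ->].
rewrite -UF.
have cF := @ge0_nondecreasing_set_cvg_integral _ (measurableTypeR R) R F G leb.
have ndF : {homo F : n m / (n <= m)%N >-> (n <= m)%O}.
  move=> n k nk; rewrite subsetEset !FE => x /=.
  rewrite !in_itv/= => /andP[h1 h2]; apply/andP; split.
    by rewrite (le_trans _ h1)// lerN2 ler_wpM2r ?(ltW l0)// ler_nat.
  by rewrite (lt_le_trans h2)// ler_wpM2r ?(ltW l0)// ler_nat.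
have mF i : measurable (F i) by exact: measurable_itv.
have mGF i : measurable_fun (F i) G by exact: measurable_funTS.
apply: (cvge_to_le (cF ndF mF mGF (fun _ x _ => G0 x))).
near=> n; rewrite /F ge0_integral_itv_shift//.
rewrite -ge0_integral_sum//; last first.
  move=> k; apply: measurable_funTS.
  apply: (measurableT_comp mG); exact: measurable_funD.
have le1 : (\int[leb]_(x in `[0%R, l[) (\sum_(k < n.*2) G (- (n%:R * l) + k%:R * l + x)%R)
    <= \int[leb]_(x in `[0%R, l[) (cst (2 * T * nrm2 leb h)%:E x))%E.
  apply: ge0_le_integral => //.
  - by move=> x _; apply: sume_ge0 => k _; exact: G0.
  - apply: emeasurable_sum => k; apply: measurable_funTS.
    apply: (measurableT_comp mG); exact: measurable_funD.
  - move=> x _; rewrite /G sumEFin lee_fin.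
    have := @bessel h (- (n%:R * l) + x) n.*2 Lh hT.
    apply: le_trans; rewrite le_eqVlt; apply/orP; left; apply/eqP.
    by apply: eq_bigr => k _; congr (N (hat1 h _) ^+ 2); rewrite /l; ring.
apply: (le_trans le1); rewrite integral_cst//.
rewrite [X in (_ * X)%E](lebesgue_measure_itv `[0, l[) /= lte_fin l0 sube0.
rewrite -EFinM lee_fin /l mulrAC mulfV ?mul1r// mulf_neq0// gt_eqF//.
Unshelve. all: end_near. Qed.

End bessel.

(** * Plancherel in several variables *)

Section plancherel.
Context {R : realType}.
Local Notation leb := (@lebesgue_measure R).
Local Notation N := (@Normc.normc R).

Definition hat d (f : 'rV[R]_d -> R[i]) (xi : 'rV[R]_d) : R[i] :=
  cintegral (lebesgue_row d) setT (fun x => expi (- (2 * pi * dotr x xi)) * f x).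

Lemma measurable_dotr d1 (X : measurableType d1) d (f g : X -> 'rV[R]_d) :
  measurable_fun setT f -> measurable_fun setT g ->
  measurable_fun setT (fun x => dotr (f x) (g x)).
Proof.
move=> mf mg; rewrite /dotr; apply: measurable_sum => i.
apply: measurable_funM.
- exact: (measurableT_comp (measurable_coord i)).
- exact: (measurableT_comp (measurable_coord i)).
Qed.

Lemma cmeasurable_wave d1 (X : measurableType d1) d (f g : X -> 'rV[R]_d) :
  measurable_fun setT f -> measurable_fun setT g ->
  cmeasurable setT (fun x => expi (- (2 * pi * dotr (f x) (g x)))).
Proof.
move=> mf mg; apply: cmeasurable_expi; apply: measurable_funN.
by apply: measurable_funM => //; exact: measurable_dotr.
Qed.

Lemma cmeasurable_hat d (f : 'rV[R]_d -> R[i]) : cmeasurable setT f ->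
  cmeasurable setT (hat f).
Proof.
move=> mf; pose g (p : 'rV[R]_d * 'rV[R]_d) : R[i] :=
  expi (- (2 * pi * dotr p.2 p.1)) * f p.2.
apply: (@cmeasurable_param R _ _ _ _ (lebesgue_row d) g).
apply: cmeasurableM.
- by apply: cmeasurable_wave; [exact: measurable_snd|exact: measurable_fst].
- exact: (cmeasurable_comp mf measurable_snd).
Qed.

Lemma dotr_cons d (x xi : R) (y eta : 'rV[R]_d) :
  dotr (row_cons (x, y)) (row_cons (xi, eta)) = x * xi + dotr y eta.
Proof.
rewrite /dotr big_ord_recl !row_cons0; congr (_ + _).
by apply: eq_bigr => i _; rewrite !row_consS.
Qed.

Lemma integrable_row_cons d (f : 'rV[R]_d.+1 -> R) :
  (lebesgue_row d.+1).-integrable setT (EFin \o f) ->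
  (leb \x lebesgue_row d)%E.-integrable setT (EFin \o (f \o @row_cons R d)) /\
  \int[lebesgue_row d.+1]_x f x =
  \int[leb]_x \int[lebesgue_row d]_y f (row_cons (x, y)).
Proof.
move=> fi; have mf : measurable_fun setT (EFin \o f) := measurable_int _ fi.
have mc := @measurable_row_cons R d.
have mfc : measurable_fun setT ((EFin \o f) \o @row_cons R d).
  exact: (measurableT_comp mf mc).
have fci : (leb \x lebesgue_row d)%E.-integrable setT (EFin \o (f \o @row_cons R d)).
  apply/integrableP; split => //.
  move/integrableP : fi => [_]; apply: le_lt_trans.
  rewrite (_ : (\int[lebesgue_row d.+1]_x `|(EFin \o f) x|)%E =
    (\int[pushforward (leb \x lebesgue_row d)%E (@row_cons R d)]_x `|(EFin \o f) x|)%E)//.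
  rewrite ge0_integral_pushforward//; exact: measurableT_comp.
split => //.
rewrite -(Rintegral_prod fci) /Rintegral; congr fine.
rewrite (_ : (\int[lebesgue_row d.+1]_x (f x)%:E)%E =
    (\int[pushforward (leb \x lebesgue_row d)%E (@row_cons R d)]_x (f x)%:E)%E)//.
by rewrite integral_pushforward.
Qed.

Lemma cintegral_row_cons d (f : 'rV[R]_d.+1 -> R[i]) :
  cintegrable (lebesgue_row d.+1) f ->
  cintegrable (leb \x lebesgue_row d)%E (f \o @row_cons R d) /\
  cintegral (lebesgue_row d.+1) setT f =
  cintegral leb setT (fun x =>
    cintegral (lebesgue_row d) setT (fun y => f (row_cons (x, y)))).
Proof.
move=> [/integrable_row_cons[i1 e1] /integrable_row_cons[i2 e2]].
split; first by split.
by apply: complex_ext.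
Qed.

Lemma cintegrable_box d (f : 'rV[R]_d -> R[i]) (T : R) :
  L2fun (lebesgue_row d) f -> (forall x, ~ row_box 0 T x -> f x = 0) ->
  cintegrable (lebesgue_row d) f.
Proof.
move=> Lf fT.
have mb := measurable_row_box (0 : 'rV[R]_d) T.
have -> : f = (fun x => f x * (\1_(row_box 0 T) x)%:C%C).
  apply/funext => x; rewrite indicE; case: (boolP (x \in _)) => [_|].
    by rewrite mulr1.
  by rewrite notin_setE => /fT ->; rewrite mul0r.
apply: cintegrableM => //; apply: (@le_L2fun _ _ _ _ _ (\1_(row_box 0 T))).
- by apply: cmeasurableR; exact: measurable_indic.
- move=> x; rewrite cmodR indicE.
  by case: (_ \in _); rewrite ?normr1 ?normr0 ?expr1n// expr0n.
- apply/integrableP; split; first exact/measurable_EFinP/measurable_indic.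
  under eq_integral do rewrite /= ger0_norm//.
  by rewrite integral_indic// setIT; exact: lebesgue_row_box.
Qed.

Lemma cintegrableMb d1 (X : measurableType d1) (mu : {measure set X -> \bar R})
    (h f : X -> R[i]) (B : R) :
  cintegrable mu f -> cmeasurable setT h -> (forall x, N (h x) <= B) ->
  cintegrable mu (fun x => h x * f x).
Proof.
move=> fi mh hB; have mf := cintegrable_measurable fi.
apply: (@le_cintegrable _ _ _ _ _ (fun x => B * N (f x))).
- exact: cmeasurableM.
- by move=> x; rewrite cmodM ler_wpM2r ?cmod_ge0.
- by apply: integrableZl_EFin; exact/(cintegrable_cmod _ mf).
Qed.

(** Bounded support makes [f] integrable, so Fubini applies. The sections in [y] are integrable for
    almost every [x] only, hence the factor depending on [x] leaves the inner integral almost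
    everywhere. *)
Lemma hat_row_cons d (f : 'rV[R]_d.+1 -> R[i]) (T : R) (xi : R) (eta : 'rV[R]_d) :
  L2fun (lebesgue_row d.+1) f -> (forall x, ~ row_box 0 T x -> f x = 0) ->
  hat f (row_cons (xi, eta)) =
  hat1 (fun x => hat (fun y => f (row_cons (x, y))) eta) xi.
Proof.
move=> Lf fT; have fi := cintegrable_box Lf fT.
have [mf _] := Lf.
rewrite /hat.
have mw : cmeasurable setT (fun x => expi (- (2 * pi * dotr x (row_cons (xi, eta))))).
  by apply: cmeasurable_wave => //; exact: measurable_id.
have w1 (x : 'rV[R]_d.+1) : N (expi (- (2 * pi * dotr x (row_cons (xi, eta))))) <= 1.
  by rewrite cmod_expi.
have efi := cintegrableMb fi mw w1.
have [efi2 ->] := cintegral_row_cons efi.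
have [fi2 _] := cintegral_row_cons fi.
rewrite /hat1; apply: ae_eq_cintegral.
- apply: (@cmeasurable_param R _ _ _ _ (lebesgue_row d)
    (fun p => expi (- (2 * pi * dotr (row_cons p) (row_cons (xi, eta)))) * f (row_cons p))).
  exact: cintegrable_measurable efi2.
- apply: cmeasurableM.
    apply: cmeasurable_expi; apply: measurable_funN; apply: measurable_funM => //.
    by apply: measurable_funM.
  apply: (@cmeasurable_param R _ _ _ _ (lebesgue_row d)
    (fun p : measurableTypeR R * 'rV[R]_d => expi (- (2 * pi * dotr p.2 eta)) * f (row_cons p))).
  apply: cmeasurableM; last exact: cintegrable_measurable fi2.
  by apply: cmeasurable_wave => //; exact: measurable_snd.
- have := ae_cintegrable_section fi2; apply: filterS => x fx.
  rewrite -cintegralZ.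
    congr cintegral; apply/funext => y; rewrite dotr_cons mulrA -expiD.
    by congr (expi _ * _); ring.
  apply: (@cintegrableMb _ _ _ _ _ 1) => //.
    by apply: cmeasurable_wave => //; exact: measurable_id.
  by move=> y; rewrite cmod_expi.
Qed.

(* One coordinate at a time: the one-dimensional inequality in the first
   variable, the induction hypothesis in the others. *)
Lemma plancherel_le d (f : 'rV[R]_d -> R[i]) (T : R) : 0 < T ->
  cmeasurable setT f -> (forall x, ~ row_box 0 T x -> f x = 0) ->
  (\int[lebesgue_row d]_x (N (hat f x) ^+ 2)%:E <=
   \int[lebesgue_row d]_x (N (f x) ^+ 2)%:E)%E.
Proof.
move=> T0; elim: d => [|d ih] in f *; move=> mf fT.
  (* In dimension 0 the measure is a point mass and the transform is the identity. *)
  apply: ge0_le_integral => //.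
  - by move=> x _; rewrite lee_fin sqr_ge0.
  - exact/measurable_EFinP/measurable_sqr_cmod/cmeasurable_hat.
  - exact/measurable_EFinP/measurable_sqr_cmod.
  move=> x _; rewrite lee_fin.
  suff -> : hat f x = f x by [].
  have mw : cmeasurable setT (fun y : 'rV[R]_0 => expi (- (2 * pi * dotr y x)) * f y).
    by apply: cmeasurableM => //; apply: cmeasurable_wave => //; exact: measurable_id.
  have E0 : expi (- (2 * pi * dotr 0 x)) * f 0 = f x.
    rewrite /dotr big_ord0 mulr0 oppr0 expi0 mul1r; congr (f _).
    by apply/rowP => -[].
  have intd (g : 'rV[R]_0 -> R) : measurable_fun setT g ->
      \int[\d_(0 : 'rV[R]_0)]_y g y = g 0.
    move=> mg; rewrite /Rintegral integral_dirac//.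
      by rewrite diracE mem_set// mul1e.
    exact/measurable_EFinP.
  case: mw => mw1 mw2.
  by apply: complex_ext; rewrite -E0; [exact: (intd _ mw1)|exact: (intd _ mw2)].
have [foo|] := ltP (\int[lebesgue_row d.+1]_x (N (f x) ^+ 2)%:E)%E +oo%E; last first.
  by rewrite leye_eq => /eqP ->; rewrite leey.
have Lf := L2fun_lty mf foo.
(* The partial transform in all variables but the first. *)
pose H (p : measurableTypeR R * 'rV[R]_d) : R[i] := hat (fun y => f (row_cons (p.1, y))) p.2.
have mfc : cmeasurable setT (f \o @row_cons R d).
  exact: (cmeasurable_comp mf (@measurable_row_cons R d)).
have mH : cmeasurable setT H.
  pose g (q : (measurableTypeR R * 'rV[R]_d) * 'rV[R]_d) : R[i] :=
    expi (- (2 * pi * dotr q.2 q.1.2)) * f (row_cons (q.1.1, q.2)).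
  apply: (@cmeasurable_param R _ _ _ _ (lebesgue_row d) g).
  apply: cmeasurableM.
    by apply: cmeasurable_wave; [exact: measurable_snd|exact: measurableT_comp].
  apply: (cmeasurable_comp mfc (h := fun q : (measurableTypeR R * 'rV[R]_d) * 'rV[R]_d => (q.1.1, q.2))).
  by apply: measurable_fun_pair => //; exact: measurableT_comp.
have mH2 : measurable_fun setT (fun p => (N (H p) ^+ 2)%:E).
  exact/measurable_EFinP/measurable_sqr_cmod.
have m1 : measurable_fun setT (fun x => (N (hat f x) ^+ 2)%:E).
  exact/measurable_EFinP/measurable_sqr_cmod/cmeasurable_hat.
have m2 : measurable_fun setT (fun x => (N (f x) ^+ 2)%:E).
  exact/measurable_EFinP/measurable_sqr_cmod.
rewrite (ge0_integral_row_cons m1); last by move=> x; rewrite lee_fin sqr_ge0.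
rewrite (ge0_integral_row_cons m2); last by move=> x; rewrite lee_fin sqr_ge0.
apply: (@le_trans _ _ (\int[leb]_x \int[lebesgue_row d]_y (N (H (x, y)) ^+ 2)%:E)%E).
  (* The integral in the first frequency is moved inside, so that [plancherel1] applies to [H] at
     each fixed [y]. *)
  have swap (g : measurableTypeR R * 'rV[R]_d -> \bar R) : measurable_fun setT g ->
      (forall p, (0 <= g p)%E) ->
      (\int[leb]_x \int[lebesgue_row d]_y g (x, y) =
       \int[lebesgue_row d]_y \int[leb]_x g (x, y))%E.
    by move=> mg g0; rewrite fubini_tonelli.
  rewrite [leLHS](swap (fun p => (N (hat f (row_cons p)) ^+ 2)%:E)); last 2 first.
  - exact: (measurableT_comp m1 (@measurable_row_cons R d)).
  - by move=> x; rewrite lee_fin sqr_ge0.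
  rewrite [leRHS](swap (fun p => (N (H p) ^+ 2)%:E) mH2); last first.
    by move=> x; rewrite lee_fin sqr_ge0.
  apply: ge0_le_integral => //.
  - by move=> y _; apply: integral_ge0 => x _; rewrite lee_fin sqr_ge0.
  - apply: (@measurable_fun_fubini_tonelli_G _ _ _ _ R leb (fun p => (N (hat f (row_cons p)) ^+ 2)%:E)).
      exact: (measurableT_comp m1 (@measurable_row_cons R d)).
    by move=> x; rewrite lee_fin sqr_ge0.
  - apply: (@measurable_fun_fubini_tonelli_G _ _ _ _ R leb (fun p => (N (H p) ^+ 2)%:E)) => //.
    by move=> x; rewrite lee_fin sqr_ge0.
  move=> y _; under eq_integral do rewrite (hat_row_cons _ _ Lf fT).
  apply: (@plancherel1 R T T0 (fun x => H (x, y))).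
  - exact: (cmeasurable_comp mH (measurable_pair2 y)).
  - move=> x xT; rewrite /H /hat/= -[RHS](@cintegral0 _ _ _ (lebesgue_row d)).
    congr cintegral; apply/funext => z; rewrite fT ?mulr0// => /(_ ord0).
    by rewrite row_cons0 mxE sub0r normrN.
apply: ge0_le_integral => //.
- by move=> x _; apply: integral_ge0 => y _; rewrite lee_fin sqr_ge0.
- apply: (@measurable_fun_fubini_tonelli_F _ _ _ _ R (lebesgue_row d) (fun p => (N (H p) ^+ 2)%:E)) => //.
  by move=> x; rewrite lee_fin sqr_ge0.
- apply: (@measurable_fun_fubini_tonelli_F _ _ _ _ R (lebesgue_row d)
    (fun p => (N (f (row_cons p)) ^+ 2)%:E)).
    exact: (measurableT_comp m2 (@measurable_row_cons R d)).
  by move=> x; rewrite lee_fin sqr_ge0.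
move=> x _; apply: (ih (fun y => f (row_cons (x, y)))).
- exact: (cmeasurable_comp mf (@measurable_row_cons_l R d x)).
- move=> y yT; apply: fT => h; apply: yT => i; have := h (lift ord0 i).
  by rewrite row_consS !mxE.
Qed.

End plancherel.

(** * Weakly null sequences are bounded *)

Section weakly_null_bounded.
Context d (T : measurableType d) (R : realType) (mu : {measure set T -> \bar R}).
Implicit Types f g : T -> R.

Definition RL2 f := measurable_fun setT f /\
  mu.-integrable setT (EFin \o (fun x => f x ^+ 2)).

Definition ip f g : R := \int[mu]_x (f x * g x).

Lemma ipC f g : ip f g = ip g f.
Proof. by apply: eq_Rintegral => x _; rewrite mulrC. Qed.

Lemma integrable_ip f g : RL2 f -> RL2 g ->
  mu.-integrable setT (EFin \o (fun x => f x * g x)).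
Proof.
move=> [mf fi] [mg gi].
apply: (@le_integrable _ _ _ _ _ measurableT _ (EFin \o (fun x => f x ^+ 2 + g x ^+ 2))).
- by apply/measurable_EFinP; exact: measurable_funM.
- move=> x _ /=; rewrite lee_fin normrM [leRHS]ger0_norm ?addr_ge0 ?sqr_ge0//.
  rewrite -[f x ^+ 2]real_normK ?num_real// -[g x ^+ 2]real_normK ?num_real//.
  have := sqr_ge0 (`|f x| - `|g x|); have := normr_ge0 (f x); have := normr_ge0 (g x).
  nra.
- by rewrite /comp; under eq_fun do rewrite EFinD; exact: integrableD.
Qed.

Lemma ip_sum f (n : nat) (a : nat -> R) (g : nat -> T -> R) : RL2 f ->
  (forall k, RL2 (g k)) ->
  ip f (fun x => \sum_(k < n) a k * g k x) = \sum_(k < n) a k * ip f (g k).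
Proof.
move=> Lf Lg.
have ik k := integrable_ip Lf (Lg k).
have iak k : mu.-integrable setT (EFin \o (fun x => a k * (f x * g k x))).
  exact: integrableZl_EFin.
elim: n => [|n ih].
  rewrite big_ord0 /ip; under eq_Rintegral do rewrite big_ord0 mulr0.
  by rewrite /Rintegral integral0.
rewrite big_ord_recr/= -ih /ip -RintegralZl//.
rewrite -RintegralD//; last first.
  elim: (n) => [|m ihm].
    rewrite /comp; under eq_fun do rewrite big_ord0 mulr0; exact: integrable0.
  rewrite /comp; under eq_fun do rewrite big_ord_recr/= mulrDr EFinD.
  apply: integrableD => //.
  rewrite (_ : (fun x => _) = (EFin \o (fun x => a m * (f x * g m x))))//.
  by apply/funext => x /=; rewrite mulrCA.
by apply: eq_Rintegral => x _; rewrite big_ord_recr/= mulrDr mulrCA.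
Qed.

(** * Gliding hump: a test function for a nearly orthogonal, fast growing sequence *)

Section gliding_hump.
Variable g : nat -> T -> R.
Hypothesis Lg : forall k, RL2 (g k).
Hypothesis g_large : forall k, 16 ^+ k <= ip (g k) (g k).
Hypothesis g_orth : forall j k, j != k -> `|ip (g j) (g k)| <= 1.

Let A k := ip (g k) (g k).
Let A0 k : 0 < A k.
Proof. by apply: lt_le_trans (g_large k); rewrite exprn_gt0. Qed.
(** The test function is the sum of the g_k scaled to norm 2^-k. Paired with g_j, the diagonal term
    is 2^-j times the norm of g_j, hence at least 2^j, and the other terms add up to at most 2. *)
Let a k : R := 2^-1 ^+ k / Num.sqrt (A k).
Let a0 k : 0 <= a k.
Proof. by rewrite /a mulr_ge0// ?exprn_ge0// invr_ge0 sqrtr_ge0. Qed.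
Let a2 k : a k ^+ 2 * A k = 2^-1 ^+ k * 2^-1 ^+ k.
Proof.
by rewrite /a expr_div_n sqr_sqrtr ?ltW// divfK ?gt_eqF// expr2.
Qed.

(** The integral of [w k] is 2^-k, so the sum [W] is finite almost everywhere. Twice [W] bounds the
    squares of the partial sums of the test function, which is thus obtained as a pointwise
    limit. *)
Let w k x := 2^-1 ^+ k / A k * g k x ^+ 2.
Let w0 k x : 0 <= w k x.
Proof. by rewrite /w mulr_ge0 ?sqr_ge0// mulr_ge0 ?exprn_ge0// invr_ge0 ltW. Qed.
Let W x : \bar R := (\sum_(0 <= k <oo) (w k x)%:E)%E.
Let mw k : measurable_fun setT (w k).
Proof.
by have [mg _] := Lg k; apply: measurable_funM => //; exact: measurable_funX.
Qed.
Let W0 x : (0 <= W x)%E.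
Proof. by apply: nneseries_ge0 => k _ _; rewrite lee_fin. Qed.
Let mW : measurable_fun setT W.
Proof.
apply: ge0_emeasurable_sum => //.
- by move=> k x _ _; rewrite lee_fin.
- by move=> k _; exact/measurable_EFinP.
Qed.

Let intw k : (\int[mu]_x (w k x)%:E = (2^-1 ^+ k)%:E)%E.
Proof.
have [mg ig] := Lg k.
rewrite /w; under eq_integral do rewrite EFinM.
rewrite integralZl//.
have -> : (\int[mu]_x (g k x ^+ 2)%:E = (A k)%:E)%E.
  rewrite /A /ip /Rintegral fineK; first by [].
  exact: (integrable_fin_num measurableT ig).
by rewrite -EFinM divfK// gt_eqF.
Qed.

Let iW : mu.-integrable setT W.
Proof.
apply/integrableP; split => //.
under eq_integral do rewrite gee0_abs//.
rewrite /W integral_nneseries//; last 2 first.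
- by move=> n; exact/measurable_EFinP.
- by move=> n x _; rewrite lee_fin.
under eq_eseriesr do rewrite intw.
apply: (@le_lt_trans _ _ 2%:E); last by rewrite ltry.
apply: lime_le; first by apply: is_cvg_nneseries => k _ _; rewrite lee_fin exprn_ge0.
near=> n; rewrite sumEFin lee_fin big_mkord.
have := @subrX1 R 2^-1 n; rewrite (_ : 2^-1 - 1 = - 2^-1 :> R); last by field.
move=> h; have : 0 <= (2^-1 : R) ^+ n by rewrite exprn_ge0.
set S := \sum_(i < n) _ in h *; move: ((2^-1 : R) ^+ n) h => y; lra.
Unshelve. all: end_near. Qed.

Let E := [set x | (W x < +oo)%E].
Let mE : measurable E.
Proof.
rewrite -[E]setTI; exact: emeasurable_fun_infty_o.
Qed.
Let aeE : {ae mu, forall x, E x}.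
Proof.
have := integrable_ae measurableT iW; apply: filterS => x /(_ I).
by rewrite ge0_fin_numE.
Qed.

(** The indicator of [E], a set of full measure, makes the series converge at every point. *)
Let q k x := a k * (g k x * \1_E x).
Let v m x := \sum_(k < m) q k x.

Let sumw m x : E x -> \sum_(k < m) w k x <= fine (W x).
Proof.
move=> Ex; rewrite -lee_fin fineK ?ge0_fin_numE//.
rewrite -sumEFin -(big_mkord xpredT (fun k => (w k x)%:E)).
by apply: nneseries_lim_ge => k _ _; rewrite lee_fin.
Qed.

(* Weighted Cauchy-Schwarz with weights [2^-k]. *)
Let abs_bound m x : (\sum_(k < m) `|q k x|) ^+ 2 <= 2 * (fine (W x)).
Proof.
have [Ex|Ex] := pselect (E x); last first.
  rewrite big1 ?expr0n ?mulr_ge0 ?fine_ge0// => k _.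
  by rewrite /q indicE memNset// !mulr0 normr0.
set S := \sum_(k < m) _.
have W1 : 0 <= fine (W x) by rewrite fine_ge0.
have : 0 <= S by apply: sumr_ge0 => k _.
rewrite le_eqVlt => /orP[/eqP <-|S0]; first by rewrite expr0n/= mulr_ge0.
(* With this weight the bound [S1], multiplied by [S], reads S^2 <= S^2 / 2 + W. *)
pose t := S / 2.
have t0 : 0 < t by rewrite divr_gt0.
have hk k : `|q k x| <= (t * 2^-1 ^+ k + w k x / t) / 2.
  rewrite /q indicE mem_set// mulr1 normrM ger0_norm//.
  have p0 : 0 < (2^-1 : R) ^+ k by rewrite exprn_gt0.
  have e : w k x * 2^-1 ^+ k = (a k * `|g k x|) ^+ 2.
    rewrite /w exprMn real_normK ?num_real// mulrAC; congr (_ * _).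
    by apply: (mulIf (lt0r_neq0 (A0 k))); rewrite a2 mulrAC divfK// gt_eqF.
  have -> : w k x = (a k * `|g k x|) ^+ 2 / 2^-1 ^+ k by rewrite -e mulfK// gt_eqF.
  move: (a k * `|g k x|) (2^-1 ^+ k) p0 => b p p0.
  rewrite -(ler_pM2l (mulr_gt0 t0 p0)).
  have -> : t * p * ((t * p + b ^+ 2 / p / t) / 2) = ((t * p) ^+ 2 + b ^+ 2) / 2.
    by field; rewrite !gt_eqF.
  by have := sqr_ge0 (t * p - b); nra.
have S1 : S <= (t * 2 + fine (W x) / t) / 2.
  apply: (@le_trans _ _ (\sum_(k < m) (t * 2^-1 ^+ k + w k x / t) / 2)); first exact: ler_sum.
  rewrite -mulr_suml big_split/= ler_wpM2r// lerD//.
    rewrite -mulr_sumr ler_wpM2l ?(ltW t0)//.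
    have := @subrX1 R 2^-1 m; rewrite (_ : 2^-1 - 1 = - 2^-1 :> R); last by field.
    move=> h; have : 0 <= (2^-1 : R) ^+ m by rewrite exprn_ge0.
    by set S' := \sum_(i < m) 2^-1 ^+ _ in h *; move: ((2^-1 : R) ^+ m) h => y; lra.
  by rewrite -mulr_suml ler_wpM2r ?invr_ge0 ?(ltW t0)//; exact: sumw.
have : S * S <= (t * 2 + fine (W x) / t) / 2 * S by rewrite ler_wpM2r// ltW.
have -> : (t * 2 + fine (W x) / t) / 2 * S = S * S / 2 + fine (W x).
  by rewrite /t; field; rewrite gt_eqF.
rewrite expr2; move: (S * S) (fine _) => b c; lra.
Qed.

Let cvg_v x : cvgn (v ^~ x).
Proof.
have -> : v ^~ x = series (q ^~ x).
  by apply/funext => m; rewrite /v /series/= big_mkord.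
apply: normed_cvg; rewrite /normed_series_of.
apply: nondecreasing_is_cvgn.
  by apply/nondecreasing_seqP => n; rewrite /series/= big_nat_recr//= lerDl.
exists (1 + 2 * fine (W x)) => _ [m _ <-].
rewrite /series/= big_mkord.
have := abs_bound m x; have : 0 <= fine (W x) by rewrite fine_ge0.
move: (\sum_(k < m) _) (fine _) => S c c0; have := sqr_ge0 (S - 1); nra.
Qed.

Let vv x := limn (v ^~ x).

Let e k x := g k x * \1_E x.

Let Le k : RL2 (e k).
Proof.
have [mg ig] := Lg k.
have me : measurable_fun setT (e k) by apply: measurable_funM.
split => //.
apply: (@le_integrable _ _ _ _ _ measurableT _ (EFin \o (fun x => g k x ^+ 2))) => //.
- by apply/measurable_EFinP; exact: measurable_funX.
- move=> x _ /=; rewrite lee_fin ger0_norm ?sqr_ge0// ger0_norm ?sqr_ge0//.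
  rewrite /e exprMn ler_piMr ?sqr_ge0//.
Qed.

Let ip_e j k : ip (g j) (e k) = ip (g j) (g k).
Proof.
have [mj _] := Lg j; have [mk _] := Lg k; have [me _] := Le k.
rewrite /ip /Rintegral; congr fine; apply: ae_eq_integral => //.
- by apply/measurable_EFinP; exact: measurable_funM.
- by apply/measurable_EFinP; exact: measurable_funM.
- by apply: filterS aeE => x Ex _; rewrite /e indicE mem_set// mulr1.
Qed.

Let mv m : measurable_fun setT (v m).
Proof.
by apply: measurable_sum => k; apply: measurable_funM => //; case: (Le k).
Qed.

Let mvv : measurable_fun setT vv.
Proof.
apply: (@measurable_fun_cvg _ _ _ _ v) => //.
Qed.

Let v_bound m x : v m x ^+ 2 <= 2 * fine (W x).
Proof.
apply: le_trans (abs_bound m x); rewrite -real_normK ?num_real//.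
by rewrite lerXn2r ?nnegrE ?sumr_ge0// /v; exact: ler_norm_sum.
Qed.

Let vv_bound x : vv x ^+ 2 <= 2 * fine (W x).
Proof.
have h : (fun m => v m x * v m x) @ \oo --> vv x * vv x.
  by apply: cvgM; exact: cvg_v.
rewrite expr2; apply: (cvgr_to_le h); near=> m; exact: v_bound.
Unshelve. all: end_near. Qed.

Let ifW : mu.-integrable setT (EFin \o (fun x => 2 * fine (W x))).
Proof.
apply: integrableZl_EFin.
apply: (@le_integrable _ _ _ _ _ measurableT _ W) => //.
  by apply/measurable_EFinP; exact: (measurableT_comp _ mW).
move=> x _ /=; rewrite (gee0_abs (W0 x)) ger0_norm ?fine_ge0//.
by have := W0 x; case: (W x) => //= r; rewrite ?leey.
Qed.

Lemma gliding_hump_L2 : RL2 vv.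
Proof.
split; first exact: mvv.
apply: (@le_integrable _ _ _ _ _ measurableT _ (EFin \o (fun x => 2 * fine (W x)))) => //.
  by apply/measurable_EFinP; exact: measurable_funX.
move=> x _ /=; rewrite lee_fin !ger0_norm ?sqr_ge0 ?mulr_ge0 ?fine_ge0//.
Qed.

Let ip_cvg j : (fun m => ip (g j) (v m)) @ \oo --> ip (g j) vv.
Proof.
have [mg ig] := Lg j.
have := @dominated_convergence _ T R mu setT measurableT
  (fun m x => (g j x * v m x)%:E) (fun x => (g j x * vv x)%:E)
  (fun x => (g j x ^+ 2 + 2 * fine (W x))%:E).
case.
- by move=> n; apply/measurable_EFinP; exact: measurable_funM.
- by apply/measurable_EFinP; exact: measurable_funM.
- apply: aeW => x _; apply: cvg_EFin; first by near=> n.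
  by rewrite /comp/=; apply: cvgMr; exact: cvg_v.
- by under eq_fun do rewrite EFinD; exact: integrableD.
- apply: aeW => x n _ /=; rewrite lee_fin normrM.
  have := v_bound n x; rewrite -[v n x ^+ 2]real_normK ?num_real//.
  rewrite -[g j x ^+ 2]real_normK ?num_real//.
  have := sqr_ge0 (`|g j x| - `|v n x|); have := normr_ge0 (g j x); have := normr_ge0 (v n x).
  move: `|g j x| `|v n x| (fine _) => x1 x2 x3; nra.
- move=> igv _; have -> : (\int[mu]_x (g j x * vv x)%:E = (ip (g j) vv)%:E)%E.
    by rewrite /ip /Rintegral fineK//; exact: (integrable_fin_num measurableT igv).
  exact: fine_cvg.
Unshelve. all: end_near. Qed.

(** Since the norm of g_j is at least 4^j, the diagonal term is at least 2^-j 4^j = 2^j. The others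
    are bounded by 2^-k, because [a k <= 2^-1 ^+ k] and the inner products are at most 1. *)
Let ip_v j m : (j < m)%N -> 2 ^+ j - 2 <= ip (g j) (v m).
Proof.
move=> jm.
have -> : ip (g j) (v m) = \sum_(k < m) a k * ip (g j) (g k).
  rewrite (ip_sum m a (Lg j) Le); apply: eq_bigr => k _; by rewrite ip_e.
have sA k : 4 ^+ k <= Num.sqrt (A k).
  have -> : 4 ^+ k = Num.sqrt (16 ^+ k) :> R.
    have <- : (4 ^+ k) ^+ 2 = 16 ^+ k :> R.
      by rewrite -exprM mulnC exprM; congr (_ ^+ _); rewrite -natrX.
    by rewrite sqrtr_sqr ger0_norm// exprn_ge0.
  exact: ler_wsqrtr (g_large k).
have ak k : a k <= 2^-1 ^+ k.
  rewrite /a ler_piMr ?exprn_ge0// invf_le1 ?sqrtr_gt0//.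
  by apply: le_trans (sA k); rewrite exprn_ege1//; lra.
have aA : 2 ^+ j <= a j * ip (g j) (g j).
  have -> : a j * ip (g j) (g j) = 2^-1 ^+ j * Num.sqrt (A j).
    rewrite /a -/(A j) -{2}[A j]sqr_sqrtr ?ltW// expr2 mulrA divfK//.
    by rewrite gt_eqF// sqrtr_gt0.
  have -> : 2 ^+ j = 2^-1 ^+ j * 4 ^+ j :> R.
    by rewrite -exprMn; congr (_ ^+ j); lra.
  by rewrite ler_wpM2l// exprn_ge0.
rewrite (bigD1 (Ordinal jm))//=.
have : `|\sum_(k < m | k != Ordinal jm) a k * ip (g j) (g k)| <= 2.
  apply: le_trans (ler_norm_sum _ _ _) _.
  apply: (@le_trans _ _ (\sum_(k < m | k != Ordinal jm) 2^-1 ^+ k)).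
    apply: ler_sum => k kj; rewrite normrM ger0_norm// -[leRHS]mulr1 ler_pM//.
    by apply: g_orth; apply: contra kj => /eqP jk; apply/eqP/val_inj.
  apply: (@le_trans _ _ (\sum_(k < m) 2^-1 ^+ k)).
    by rewrite [leRHS](bigD1 (Ordinal jm))//= lerDr exprn_ge0.
  have := @subrX1 R 2^-1 m; rewrite (_ : 2^-1 - 1 = - 2^-1 :> R); last by field.
  move=> h; have : 0 <= (2^-1 : R) ^+ m by rewrite exprn_ge0.
  by set S' := \sum_(i < m) 2^-1 ^+ _ in h *; move: ((2^-1 : R) ^+ m) h => y; lra.
move: aA; rewrite ler_norml => aA /andP[h1 h2]; move: aA h1 h2.
by move: (\sum_(k < m | _) _) (2 ^+ j) => x y; lra.
Qed.

Lemma gliding_hump_ip j : 2 ^+ j - 2 <= ip (g j) vv.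
Proof.
apply: (cvgr_to_ge (@ip_cvg j)); near=> m; apply: ip_v; near: m.
exact: nbhs_infty_gt.
Unshelve. all: end_near. Qed.

End gliding_hump.

Lemma weakly_null_bounded (h : nat -> T -> R) : (forall n, RL2 (h n)) ->
  (forall v, RL2 v -> (fun n => ip (h n) v) @ \oo --> (0 : R)) ->
  exists M, forall n, ip (h n) (h n) <= M.
Proof.
move=> Lh wh; apply: contrapT => unb.
have big M N : exists n, (N <= n)%N /\ M <= ip (h n) (h n).
  apply: contrapT => small; apply: unb.
  exists (`|M| + \sum_(k < N) `|ip (h k) (h k)|) => n.
  have [nN|Nn] := ltnP n N.
    rewrite (le_trans (ler_norm _))// (bigD1 (Ordinal nN))//= addrCA lerDl.
    by rewrite addr_ge0// sumr_ge0.
  have : ip (h n) (h n) < M.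
    by rewrite ltNge; apply/negP => Mn; apply: small; exists n.
  move=> /ltW/le_trans; apply; rewrite (le_trans (ler_norm _))// lerDl.
  by rewrite sumr_ge0.
(* Weak convergence against the finitely many terms already chosen makes every late term nearly
   orthogonal to them, and unboundedness supplies a late term that is large. *)
have next (s : seq nat) : exists n, 16 ^+ size s <= ip (h n) (h n) /\
    forall j, j \in s -> `|ip (h n) (h j)| <= 1.
  have [N hN] : exists N, forall n, (N <= n)%N ->
      forall j, j \in s -> `|ip (h n) (h j)| <= 1.
    elim: s => [|j s [N hN]]; first by exists 0%N.
    have /cvgrPdist_le/(_ 1 ltr01)[N' _ hN'] := wh _ (Lh j).
    exists (maxn N N') => n; rewrite geq_max => /andP[Nn N'n] k.
    rewrite inE => /orP[/eqP ->|/(hN _ Nn)//].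
    by have := hN' n N'n; rewrite /= sub0r normrN.
  by have [n [Nn Mn]] := big (16 ^+ size s) N; exists n; split => //; exact: hN.
have [nx hnx] := choice next.
pose S := fix S k := if k is k'.+1 then rcons (S k') (nx (S k')) else [::] : seq nat.
have Sz k : size (S k) = k by elim: k => //= k ih; rewrite size_rcons ih.
pose g k := h (nx (S k)).
have Smem j k : (j < k)%N -> nx (S j) \in S k.
  elim: k => // k ih; rewrite ltnS leq_eqVlt => /orP[/eqP ->|/ih jk] /=.
    by rewrite mem_rcons inE eqxx.
  by rewrite mem_rcons inE jk orbT.
have g_orth j k : j != k -> `|ip (g j) (g k)| <= 1.
  by rewrite neq_ltn => /orP[|] jk; [rewrite ipC|];
    exact: ((hnx _).2 _ (Smem _ _ jk)).
have g_large k : 16 ^+ k <= ip (g k) (g k).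
  by rewrite -[X in _ ^+ X]Sz; have [] := hnx (S k).
have Lg k : RL2 (g k) by exact: Lh.
have Lv := gliding_hump_L2 Lg g_large.
have hv := gliding_hump_ip Lg g_large g_orth.
set v := (X in RL2 X) in Lv.
have /cvg_seq_bounded[M [_ hM]] : cvgn (fun n => ip (h n) v).
  by apply/cvg_ex; exists 0; exact: wh.
have {}hM n : ip (h n) v <= `|M| + 1.
  have : `|ip (h n) v| <= `|M| + 1.
    by apply: (hM (`|M| + 1)) => //; rewrite (le_lt_trans (ler_norm _))// ltrDl.
  exact: le_trans (ler_norm _).
(* Chosen so that 2^k - 2 >= k - 2 exceeds the bound |M| + 1 given by weak convergence. *)
pose k := (Num.truncn (`|M| + 3)).+1.
have k1 : `|M| + 3 < k%:R by exact: truncnS_gt.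
have k2 : k%:R <= 2 ^+ k :> R by rewrite -natrX ler_nat ltnW// ltn_expl.
have := le_trans (hv k) (hM _); move: k1 k2.
by move: (2 ^+ k) (k%:R) `|M| => x y z; lra.
Qed.

End weakly_null_bounded.

(** * Convergence of complex sequences *)

Section complex_convergence.
Context {R : realType}.
Local Notation N := (@Normc.normc R).

(** Convergence with real tolerances; the topology of [R[i]^o] quantifies over positive elements of
    [R[i]]. *)
Definition ccvg (T : Type) (F : set_system T) (f : T -> R[i]) (l : R[i]) :=
  forall e : R, 0 < e -> \forall x \near F, N (f x - l) < e.

Lemma ccvgP (T : Type) (F : set_system T) {FF : Filter F} (f : T -> R[i]) (l : R[i]) :
  (f @ F --> (l : R[i]^o)) <-> ccvg F f l.
Proof.
split => [/(@cvgrPdist_lt R[i] R[i]^o _ _ FF) h e e0|h].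
  have e0' : 0 < e%:C%C by rewrite ltcR.
  have := h _ e0'; apply: filterS => x.
  by rewrite normcC ltcR cmodBC.
apply/(@cvgrPdist_lt R[i] R[i]^o _ _ FF) => e e0.
have [e' -> e'0] : exists2 e' : R, e = e'%:C%C & 0 < e'.
  by case: e e0 => a b; rewrite ltcE/= => /andP[/eqP -> a0]; exists a.
by have := h _ e'0; apply: filterS => x; rewrite normcC ltcR cmodBC.
Qed.

Lemma ccvg_cst (T : Type) (F : set_system T) {FF : Filter F} (l : R[i]) : ccvg F (fun=> l) l.
Proof. by move=> e e0; apply: nearW => x; rewrite subrr cmod0. Qed.

Lemma ccvgD (T : Type) (F : set_system T) {FF : Filter F} (f g : T -> R[i]) (l m : R[i]) :
  ccvg F f l -> ccvg F g m -> ccvg F (fun x => f x + g x) (l + m).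
Proof.
move=> fl gm e e0; have e2 : 0 < e / 2 by rewrite divr_gt0.
move: (fl _ e2) (gm _ e2); apply: filterS2 => x h1 h2.
rewrite opprD addrACA (le_lt_trans (cmodD _ _))//.
by rewrite [ltRHS]splitr ltrD.
Qed.

Lemma ccvgZ (T : Type) (F : set_system T) {FF : Filter F} (f : T -> R[i]) (l c : R[i]) :
  ccvg F f l -> ccvg F (fun x => c * f x) (c * l).
Proof.
move=> fl e e0; have c1 : 0 < N c + 1 by rewrite ltr_wpDl// cmod_ge0.
have e2 : 0 < e / (N c + 1) by rewrite divr_gt0.
move: (fl _ e2); apply: filterS => x; rewrite ltr_pdivlMr// => h.
rewrite -mulrBr cmodM; apply: le_lt_trans h; rewrite mulrC.
by rewrite ler_wpM2l ?cmod_ge0// lerDl.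
Qed.

Lemma ccvgJ (T : Type) (F : set_system T) {FF : Filter F} (f : T -> R[i]) (l : R[i]) :
  ccvg F f l -> ccvg F (fun x => (f x)^*) l^*.
Proof.
by move=> fl e /fl; apply: filterS => x; rewrite -rmorphB cmodJ.
Qed.

Lemma ccvg_sum (T : Type) (F : set_system T) {FF : Filter F} I (s : seq I) (P : pred I)
    (f : I -> T -> R[i]) (l : I -> R[i]) :
  (forall i, P i -> ccvg F (f i) (l i)) ->
  ccvg F (fun x => \sum_(i <- s | P i) f i x) (\sum_(i <- s | P i) l i).
Proof.
move=> fl; elim: s => [|i s ih].
  rewrite big_nil [X in ccvg _ X _](_ : _ = fun=> 0); first exact: ccvg_cst.
  by apply/funext => x; rewrite big_nil.
rewrite big_cons; have [Pi|Pi] := boolP (P i).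
  rewrite [X in ccvg _ X _](_ : _ = fun x => f i x + \sum_(j <- s | P j) f j x).
    by apply: ccvgD => //; exact: fl.
  by apply/funext => x; rewrite big_cons Pi.
rewrite [X in ccvg _ X _](_ : _ = fun x => \sum_(j <- s | P j) f j x)//.
by apply/funext => x; rewrite big_cons (negbTE Pi).
Qed.

Lemma ccvg_unique (T : Type) (F : set_system T) {FF : ProperFilter F} (f : T -> R[i])
    (l m : R[i]) : ccvg F f l -> ccvg F f m -> l = m.
Proof.
move=> fl fm; apply/eqP; rewrite -subr_eq0 -cmod_eq0 eq_le cmod_ge0 andbT.
rewrite leNgt; apply/negP => lm0; have e0 : 0 < N (l - m) / 2 by rewrite divr_gt0.
have [x [h1 h2]] := filter_ex (filterI (fl _ e0) (fm _ e0)).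
have := cmodD (l - f x) (f x - m); rewrite addrA subrK cmodBC => h.
by have := le_lt_trans h (ltrD h1 h2); rewrite -splitr ltxx.
Qed.

End complex_convergence.

(** * Fourier transforms of functions supported in a compact set *)

Section hat_theory.
Context {R : realType} {d : nat}.
Local Notation N := (@Normc.normc R).
Local Notation leb := (@lebesgue_row R d).
Implicit Types (f g : 'rV[R]_d -> R[i]).

Lemma dotrDr (x y z : 'rV[R]_d) : dotr x (y + z) = dotr x y + dotr x z.
Proof. by rewrite /dotr -big_split; apply: eq_bigr => i _; rewrite mxE mulrDr. Qed.

Lemma dotrNr (x y : 'rV[R]_d) : dotr x (- y) = - dotr x y.
Proof. by rewrite /dotr -sumrN; apply: eq_bigr => i _; rewrite mxE mulrN. Qed.

Definition cexp (a x : 'rV[R]_d) : R[i] := expi (2 * pi * dotr x a).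

Lemma cmeasurable_cexp a : cmeasurable setT (cexp a).
Proof.
apply: cmeasurable_expi; apply: measurable_funM => //.
by apply: measurable_dotr => //; exact: measurable_id.
Qed.

Lemma hat_shift f a xi : hat (fun x => cexp a x * f x) xi = hat f (xi - a).
Proof.
rewrite /hat; congr cintegral; apply/funext => x.
rewrite mulrA -expiD; congr (expi _ * _).
by rewrite dotrDr dotrNr; ring.
Qed.

Lemma cmeasurable_char (xi : 'rV[R]_d) :
  cmeasurable setT (fun x => expi (- (2 * pi * dotr x xi))).
Proof. by apply: cmeasurable_wave => //; exact: measurable_id. Qed.

Lemma cintegrable_char f xi : cintegrable leb f ->
  cintegrable leb (fun x => expi (- (2 * pi * dotr x xi)) * f x).
Proof.
move=> fi; apply: (cintegrableMb (B := 1) fi); first exact: cmeasurable_char.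
by move=> x; rewrite cmod_expi.
Qed.

Lemma hatZ c f xi : cintegrable leb f -> hat (fun x => c * f x) xi = c * hat f xi.
Proof.
move=> fi; rewrite /hat -cintegralZ; last exact: cintegrable_char.
by congr cintegral; apply/funext => x; rewrite mulrCA.
Qed.

Lemma hatD f g xi : cintegrable leb f -> cintegrable leb g ->
  hat (fun x => f x + g x) xi = hat f xi + hat g xi.
Proof.
move=> fi gi; rewrite /hat -cintegralD; [|exact: cintegrable_char..].
by congr cintegral; apply/funext => x; rewrite mulrDr.
Qed.

Variables (K : set 'rV[R]_d).
Hypothesis cK : compact K.

Definition L2on f := L2fun leb f /\ forall x, ~ K x -> f x = 0.

Lemma L2on_cintegrable f : L2on f -> cintegrable leb f.
Proof.
move=> [Lf fK]; have [T [_ KT]] := compact_row_box cK.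
by apply: (cintegrable_box Lf (T := T)) => x xT; apply: fK => /KT.
Qed.

Lemma L2on_hat f : L2on f -> L2fun leb (hat f) /\ nrm2 leb (hat f) <= nrm2 leb f.
Proof.
move=> [Lf fK]; have [T [T0 KT]] := compact_row_box cK.
have [mf fi] := Lf.
have fT x : ~ row_box 0 T x -> f x = 0 by move=> xT; apply: fK => /KT.
have pl := plancherel_le T0 mf fT.
have foo : (\int[leb]_x (N (f x) ^+ 2)%:E < +oo)%E.
  by rewrite -EFin_nrm2// ltry.
have Lh : L2fun leb (hat f).
  by apply: L2fun_lty; [exact: cmeasurable_hat|exact: le_lt_trans foo].
by split => //; rewrite -lee_fin !EFin_nrm2.
Qed.

Lemma L2onM f (th : 'rV[R]_d -> R[i]) (B : R) : L2on f -> cmeasurable setT th ->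
  (forall x, K x -> N (th x) <= B) -> L2on (fun x => th x * f x).
Proof.
move=> [Lf fK] mth thB; split; last by move=> x /fK ->; rewrite mulr0.
have [mf fi] := Lf.
apply: (@le_L2fun _ _ _ _ _ (fun x => B ^+ 2 * N (f x) ^+ 2)).
- exact: cmeasurableM.
- move=> x; have [Kx|/fK ->] := pselect (K x); last first.
    by rewrite mulr0 cmod0 expr0n/= mulr0.
  rewrite cmodM exprMn ler_wpM2r ?sqr_ge0// lerXn2r ?nnegrE ?cmod_ge0//.
    exact: le_trans (cmod_ge0 _) (thB x Kx).
  exact: thB.
- by under eq_fun do rewrite EFinM; exact: integrableZl.
Qed.

Lemma nrm2onM f (th : 'rV[R]_d -> R[i]) (B : R) : L2on f -> cmeasurable setT th ->
  (forall x, K x -> N (th x) <= B) ->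
  nrm2 leb (fun x => th x * f x) <= B ^+ 2 * nrm2 leb f.
Proof.
move=> Lf mth thB; have [[mf fi] fK] := Lf.
have [[_ tfi] _] := L2onM Lf mth thB.
rewrite /nrm2 -RintegralZl//; apply: le_Rintegral => //.
  exact: integrableZl_EFin.
move=> x _; have [Kx|/fK ->] := pselect (K x); last first.
  by rewrite mulr0 cmod0 expr0n/= mulr0.
rewrite cmodM exprMn ler_wpM2r ?sqr_ge0// lerXn2r ?nnegrE ?cmod_ge0//.
  exact: le_trans (cmod_ge0 _) (thB x Kx).
exact: thB.
Qed.

Lemma L2onD f g : L2on f -> L2on g -> L2on (fun x => f x + g x).
Proof.
move=> [Lf fK] [Lg gK]; split; first exact: L2funD.
by move=> x Kx; rewrite fK// gK// addr0.
Qed.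

(** The transform is the pairing of [f] with the indicator of the box, up to a unimodular factor,
    estimated with weight 1. The bound is the domination used in [wnull_hat_box]. *)
Lemma cmod_hat_le f (T : R) xi : K `<=` row_box 0 T -> L2on f ->
  N (hat f xi) <= (nrm2 leb f + fine (leb (row_box 0 T))) / 2.
Proof.
move=> KT [Lf fK].
pose b (x : 'rV[R]_d) : R[i] := (\1_(row_box 0 T) x)%:C%C.
have mb := measurable_row_box (0 : 'rV[R]_d) T.
have ib : leb.-integrable setT (fun x => (\1_(row_box 0 T) x)%:E).
  apply/integrableP; split; first exact/measurable_EFinP/measurable_indic.
  under eq_integral do rewrite /= ger0_norm//.
  by rewrite integral_indic// setIT; exact: lebesgue_row_box.
have bE x : N (b x) ^+ 2 = \1_(row_box 0 T) x.
  rewrite /b cmodR indicE.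
  by case: (_ \in _); rewrite ?normr1 ?normr0 ?expr1n// expr0n.
have Lb : L2fun leb b.
  apply: (@le_L2fun _ _ _ _ _ (\1_(row_box 0 T))) => //.
  - by apply: cmeasurableR; exact: measurable_indic.
  - by move=> x; rewrite bE.
have w1 (x : 'rV[R]_d) : N (expi (- (2 * pi * dotr x xi))) <= 1 by rewrite cmod_expi.
have := cmod_cintegral_mul ltr01 (cmeasurable_char xi) w1 Lf Lb.
rewrite invr1 !mul1r.
rewrite (_ : nrm2 leb b = fine (leb (row_box 0 T))); last first.
  by rewrite /nrm2; under eq_Rintegral do rewrite bE; rewrite /Rintegral integral_indic// setIT.
congr (N (cintegral _ _ _) <= _); apply/funext => x; congr (_ * _).
have [Kx|/fK ->] := pselect (K x); last by rewrite mul0r.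
rewrite /b indicE mem_set; last exact: KT.
by rewrite (_ : (_%:R%:C%C)^* = 1) ?mulr1//; apply: complex_ext; rewrite ?ReJ ?ImJ/= ?oppr0.
Qed.

(** Bounded test functions include the characters, and they keep the class stable under
    multiplication by functions bounded on [K]. *)
Definition wnull (f : nat -> 'rV[R]_d -> R[i]) :=
  [/\ forall n, L2on (f n), exists M, forall n, nrm2 leb (f n) <= M &
   forall phi B, cmeasurable setT phi -> (forall x, N (phi x) <= B) ->
     ccvg \oo (fun n => cintegral leb setT (fun x => phi x * f n x)) 0].

(** The value of the transform at each [xi] is a pairing with a character and tends to 0. It is
    bounded uniformly in [n] and [xi], and the box has finite measure, so dominated convergence
    applies. *)
Lemma wnull_hat_box (f : nat -> 'rV[R]_d -> R[i]) (M : R) : wnull f ->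
  (fun n => nrm2 leb (fun xi => (\1_(row_box 0 M) xi)%:C%C * hat (f n) xi)) @ \oo
    --> (0 : R).
Proof.
move=> [Lf [B fB] f0].
have [T [_ KT]] := compact_row_box cK.
pose C := (B + fine (leb (row_box 0 T))) / 2.
have hC n xi : N (hat (f n) xi) <= C.
  apply: le_trans (cmod_hat_le xi KT (Lf n)) _.
  by rewrite /C ler_wpM2r// lerD2r.
have mb := measurable_row_box (0 : 'rV[R]_d) M.
pose F n (xi : 'rV[R]_d) := \1_(row_box 0 M) xi * N (hat (f n) xi) ^+ 2.
have FE n xi : N ((\1_(row_box 0 M) xi)%:C%C * hat (f n) xi) ^+ 2 = F n xi.
  rewrite cmodM exprMn cmodR /F indicE.
  by case: (_ \in _); rewrite ?normr1 ?normr0 ?expr1n// expr0n.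
have := @dominated_convergence _ _ R leb setT measurableT
  (fun n xi => (F n xi)%:E) (fun=> 0%E)
  (fun xi => (C ^+ 2 * \1_(row_box 0 M) xi)%:E).
case.
- move=> n; apply/measurable_EFinP; apply: measurable_funM; first exact: measurable_indic.
  by apply: measurable_sqr_cmod; apply: cmeasurable_hat; have [[]] := Lf n.
- exact: measurable_cst.
- apply: aeW => xi _; apply: cvg_EFin; first by near=> n.
  rewrite /comp/= -[X in _ --> X](mulr0 (\1_(row_box 0 M) xi)).
  apply: cvgMr.
  have w1 (x : 'rV[R]_d) : N (expi (- (2 * pi * dotr x xi))) <= 1 by rewrite cmod_expi.
  have h := f0 _ _ (cmeasurable_char xi) w1.
  apply/cvgrPdist_lt => e e0.
  have se0 : 0 < Num.sqrt e by rewrite sqrtr_gt0.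
  have := h _ se0; apply: filterS => n; rewrite subr0 -/(hat (f n) xi) => hn.
  rewrite sub0r normrN ger0_norm ?sqr_ge0// -[ltRHS](sqr_sqrtr (ltW e0)).
  by rewrite ltrXn2r ?nnegrE ?cmod_ge0.
- under eq_fun do rewrite EFinM; apply: integrableZl => //.
  apply/integrableP; split; first exact/measurable_EFinP/measurable_indic.
  under eq_integral do rewrite /= ger0_norm//.
  by rewrite integral_indic// setIT; exact: lebesgue_row_box.
- apply: aeW => xi n _; rewrite /= lee_fin ger0_norm; last first.
    by rewrite mulr_ge0 ?sqr_ge0.
  rewrite /F mulrC ler_wpM2r// lerXn2r ?nnegrE ?cmod_ge0//.
  exact: le_trans (cmod_ge0 _) (hC n xi).
- move=> _ _; rewrite integral0 => h.
  rewrite /nrm2; under eq_fun => n do under eq_Rintegral do rewrite FE.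
  exact: (fine_cvg h).
Unshelve. all: end_near. Qed.

End hat_theory.

(** * Commutation of multiplications with slowly varying multipliers *)

(** Here [x] is the low-frequency part of a squared norm, where the symbol is bounded by 2 B, while
    [y] and [z] are full squared norms; the symbol is at most e / (4 (M + 1)) at high frequencies.
    The weight [t] makes the low-frequency term in [z] at most e / 4, the bound on [x] does the same
    for the term in [t * x], and the high frequencies cost another e / 4. *)
Lemma commutator_estimate (R : realType) (e B M x y z : R) :
  0 < e -> 0 <= B -> 0 <= M -> 0 <= x -> y <= M -> z <= M ->
  let t := 4 * (B * M + 1) / e in
  x < e / (4 * ((B + 1) * t)) ->
  2 * B * ((t * x + t^-1 * z) / 2) + e / (4 * (M + 1)) * ((1 * y + 1^-1 * z) / 2) < e.
Proof.
move=> e0 B0 M0 x0 yM zM t.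
have BM0 : 0 < B * M + 1 by rewrite ltr_wpDl// mulr_ge0.
have t0 : 0 < t by rewrite divr_gt0// mulr_gt0.
have B10 : 0 < B + 1 by rewrite ltr_wpDl.
have M10 : 0 < M + 1 by rewrite ltr_wpDl.
have Bt0 : 0 < 4 * ((B + 1) * t) by apply: mulr_gt0 => //; exact: mulr_gt0.
rewrite ltr_pdivlMr// => xe; rewrite invr1 !mul1r.
have k1 : e / (4 * (M + 1)) * ((y + z) / 2) <= e / 4.
  rewrite -(ler_pM2r M10).
  have -> : e / (4 * (M + 1)) * ((y + z) / 2) * (M + 1) = e / 4 * ((y + z) / 2).
    by field; rewrite gt_eqF.
  rewrite ler_pM2l ?divr_gt0//; move: yM zM; lra.
have k2 : 2 * B * (t^-1 * z / 2) <= e / 4.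
  have -> : 2 * B * (t^-1 * z / 2) = B * z / t by field; rewrite gt_eqF.
  rewrite ler_pdivrMr// /t.
  have -> : e / 4 * (4 * (B * M + 1) / e) = B * M + 1 by field; rewrite gt_eqF.
  by rewrite (le_trans (ler_wpM2l B0 zM))// lerDl.
have k3 : 2 * B * (t * x / 2) <= e / 4.
  have -> : 2 * B * (t * x / 2) = B * (t * x) by field.
  have tx : 0 <= t * x by rewrite mulr_ge0// ltW.
  have : (B + 1) * (t * x) < e / 4.
    rewrite ltr_pdivlMr//; apply: le_lt_trans xe; rewrite le_eqVlt; apply/orP; left; apply/eqP; ring.
  rewrite mulrDl mul1r; move: tx; move: (B * (t * x)) (t * x) => u v; lra.
have -> : 2 * B * ((t * x + t^-1 * z) / 2) =
  2 * B * (t * x / 2) + 2 * B * (t^-1 * z / 2) by field; rewrite gt_eqF.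
move: k1 k2 k3 e0.
move: (e / (4 * _) * _) (2 * B * (t^-1 * _ / 2)) (2 * B * (t * _ / 2)) => a b c; lra.
Qed.

Section quadratic_form.
Context {R : realType} {d : nat}.
Local Notation N := (@Normc.normc R).
Local Notation leb := (@lebesgue_row R d).
Variable (K : set 'rV[R]_d).
Hypothesis cK : compact K.

Implicit Types (p f g : 'rV[R]_d -> R[i]).

(** The form is locked so that unification compares its arguments and does not unfold the
    integral. *)
Fact qform_key : unit. Proof. exact: tt. Qed.

Definition qform := locked_with qform_key (fun p f g =>
  cintegral leb setT (fun xi => p xi * (hat f xi * (hat g xi)^*))).

Lemma qformE p f g :
  qform p f g = cintegral leb setT (fun xi => p xi * (hat f xi * (hat g xi)^*)).
Proof. by rewrite /qform unlock. Qed.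

Lemma qform_integrable p B f g : cmeasurable setT p -> (forall x, N (p x) <= B) ->
  L2on K f -> L2on K g ->
  cintegrable leb (fun xi => p xi * (hat f xi * (hat g xi)^*)).
Proof.
move=> mp pB /(L2on_hat cK)[Lf _] /(L2on_hat cK)[Lg _].
apply: (cintegrableMb (B := B)) => //.
by apply: cintegrableM => //; exact: L2funJ.
Qed.

Lemma qformDl p B f1 f2 g : cmeasurable setT p -> (forall x, N (p x) <= B) ->
  L2on K f1 -> L2on K f2 -> L2on K g ->
  qform p (fun x => f1 x + f2 x) g = qform p f1 g + qform p f2 g.
Proof.
move=> mp pB L1 L2 Lg; rewrite !qformE -cintegralD; [|exact: qform_integrable..].
congr cintegral; apply/funext => xi.
by rewrite hatD ?mulrDl ?mulrDr//; exact: (L2on_cintegrable cK).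
Qed.

Lemma qformDr p B f g1 g2 : cmeasurable setT p -> (forall x, N (p x) <= B) ->
  L2on K f -> L2on K g1 -> L2on K g2 ->
  qform p f (fun x => g1 x + g2 x) = qform p f g1 + qform p f g2.
Proof.
move=> mp pB Lf L1 L2; rewrite !qformE -cintegralD; [|exact: qform_integrable..].
congr cintegral; apply/funext => xi.
by rewrite hatD ?rmorphD ?mulrDr//; exact: (L2on_cintegrable cK).
Qed.

Lemma qformZl p B c f g : cmeasurable setT p -> (forall x, N (p x) <= B) ->
  L2on K f -> L2on K g ->
  qform p (fun x => c * f x) g = c * qform p f g.
Proof.
move=> mp pB Lf Lg; rewrite !qformE -cintegralZ; last exact: qform_integrable.
congr cintegral; apply/funext => xi.
by rewrite hatZ; [ring|exact: (L2on_cintegrable cK)].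
Qed.

Lemma qformZr p B c f g : cmeasurable setT p -> (forall x, N (p x) <= B) ->
  L2on K f -> L2on K g ->
  qform p f (fun x => c * g x) = c^* * qform p f g.
Proof.
move=> mp pB Lf Lg; rewrite !qformE -cintegralZ; last exact: qform_integrable.
congr cintegral; apply/funext => xi.
by rewrite hatZ ?rmorphM; [ring|exact: (L2on_cintegrable cK)].
Qed.

Lemma L2onZ c f : L2on K f -> L2on K (fun x => c * f x).
Proof.
move=> Lf; apply: (@L2onM _ _ _ _ (fun=> c) (N c)) => //.
Qed.

Lemma qform_le p B f g t : 0 < t -> cmeasurable setT p -> (forall x, N (p x) <= B) ->
  L2on K f -> L2on K g ->
  N (qform p f g) <= B * ((t * nrm2 leb f + t^-1 * nrm2 leb g) / 2).
Proof.
rewrite qformE => t0 mp pB /(L2on_hat cK)[Lf fle] /(L2on_hat cK)[Lg gle].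
apply: le_trans (cmod_cintegral_mul t0 mp pB Lf Lg) _.
rewrite ler_wpM2l ?(le_trans (cmod_ge0 _) (pB 0))// ler_wpM2r// lerD//.
- by rewrite ler_wpM2l// ltW.
- by rewrite ler_wpM2l// invr_ge0 ltW.
Qed.

Lemma wnullM (f : nat -> 'rV[R]_d -> R[i]) (th : 'rV[R]_d -> R[i]) (B : R) :
  wnull K f -> cmeasurable setT th -> (forall x, K x -> N (th x) <= B) ->
  wnull K (fun n x => th x * f n x).
Proof.
move=> [Lf [M fM] f0] mth thB; split.
- by move=> n; exact: L2onM (Lf n) mth thB.
- exists (B ^+ 2 * M) => n; apply: le_trans (nrm2onM (Lf n) mth thB) _.
  by rewrite ler_wpM2l ?sqr_ge0.
- move=> phi C mphi phiC.
  have mK := compact_measurable_row cK.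
  pose th' x := (\1_K x)%:C%C * th x.
  have mth' : cmeasurable setT (fun x => phi x * th' x).
    apply: cmeasurableM => //; apply: cmeasurableM => //.
    by apply: cmeasurableR; exact: measurable_indic.
  have th'B x : N (phi x * th' x) <= C * `|B|.
    rewrite cmodM ler_pM ?cmod_ge0// /th' cmodM cmodR indicE.
    have [Kx|Kx] := pselect (K x).
      by rewrite mem_set// normr1 mul1r (le_trans (thB _ Kx))// ler_norm.
    by rewrite memNset// normr0 mul0r.
  have := f0 _ _ mth' th'B.
  congr (ccvg _ _ _); apply/funext => n; congr cintegral; apply/funext => x.
  rewrite -mulrA; congr (_ * _); rewrite /th' indicE.
  have [Kx|Kx] := pselect (K x); first by rewrite mem_set// mul1r.
  by have [_ ->] := Lf n; rewrite ?mulr0.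
Qed.

Section commutation.
Variables (psi : nat -> 'rV[R]_d -> R[i]) (B : R).
Hypothesis mpsi : forall n, cmeasurable setT (psi n).
Hypothesis psiB : forall n xi, N (psi n xi) <= B.
(** [M] is independent of [n]: the low-frequency box has to be fixed for [wnull_hat_box]. *)
Hypothesis psi_slow : forall (a : 'rV[R]_d) (e : R), 0 < e -> exists M : R,
  \forall n \near \oo, forall xi, ~ row_box 0 M xi ->
    N (psi n xi - psi n (xi - a)) <= e.

Let B0 : 0 <= B. Proof. exact: le_trans (cmod_ge0 _) (psiB 0%N 0). Qed.

(** Commutation in weak form: [th] may cross to the second argument of the form, which is
    antilinear, hence the conjugate. *)
Record commutes (th : 'rV[R]_d -> R[i]) : Prop := Commutes {
  _ : cmeasurable setT th ;
  _ : exists C, forall x, K x -> N (th x) <= C ;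
  _ : forall f g : nat -> 'rV[R]_d -> R[i], wnull K f -> wnull K g ->
    ccvg \oo (fun n => qform (psi n) (fun x => th x * f n x) (g n) -
      qform (psi n) (f n) (fun x => (th x)^* * g n x)) 0 }.

Lemma conj_cexp (a x : 'rV[R]_d) : (cexp a x)^* = cexp (- a) x.
Proof. by rewrite /cexp -expiN dotrNr mulrN. Qed.

(** Substituting xi - a for xi in the second term undoes the shift of the transform of [g], puts a
    shift on that of [f], where it is again multiplication by the character, and shifts the
    symbol. *)
Lemma qform_cexp n (a : 'rV[R]_d) f g : L2on K f -> L2on K g ->
  qform (psi n) (fun x => cexp a x * f x) g -
  qform (psi n) f (fun x => (cexp a x)^* * g x) =
  qform (fun xi : 'rV[R]_d => psi n xi - psi n (xi - a)) (fun x => cexp a x * f x) g.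
Proof.
move=> Lf Lg.
have Laf : L2on K (fun x => cexp a x * f x).
  apply: (L2onM (B := 1)) => //; first exact: cmeasurable_cexp.
  by move=> x _; rewrite cmod_expi.
have mshift : cmeasurable setT (fun xi : 'rV[R]_d => psi n (xi - a)).
  exact: (cmeasurable_comp (mpsi n) (measurable_row_shift (- a))).
have -> : qform (psi n) f (fun x => (cexp a x)^* * g x) =
    qform (fun xi : 'rV[R]_d => psi n (xi - a)) (fun x => cexp a x * f x) g.
  have [[mf _] _] := Lf; have [[mg _] _] := Lg.
  rewrite !qformE -(cintegral_row_shift (- a)); last first.
    apply: cmeasurableM => //; apply: cmeasurableM; first exact: cmeasurable_hat.
    apply: cmeasurableJ; apply: cmeasurable_hat; apply: cmeasurableM => //.
    by apply: cmeasurableJ; exact: cmeasurable_cexp.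
  congr cintegral; apply/funext => xi; congr (_ * (_ * _^*)).
    by rewrite hat_shift.
  under [X in hat X _]eq_fun do rewrite conj_cexp.
  by rewrite hat_shift opprK subrK.
rewrite !qformE -cintegralB.
- by congr cintegral; apply/funext => xi; rewrite mulrBl.
- exact: (qform_integrable (mpsi n) (psiB n)).
- by apply: (qform_integrable mshift) => // x; exact: psiB.
Qed.

(** The frequencies are split at the box given by [psi_slow]. Outside it the difference of the
    symbols is small; inside it this difference is only bounded by 2 B, but the transform of [A n]
    tends to 0 there in L^2. *)
Lemma commutes_cexp a : commutes (cexp a).
Proof.
split; first exact: cmeasurable_cexp.
  by exists 1 => x _; rewrite cmod_expi.
move=> f g wf wg e e0.
have [Lf [Mf fM] _] := wf; have [Lg [Mg gM] _] := wg.
pose A n x := cexp a x * f n x.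
have a1 (x : 'rV[R]_d) : K x -> N (cexp a x) <= 1 by rewrite cmod_expi.
have wA : wnull K A by apply: (wnullM wf) a1; exact: cmeasurable_cexp.
have [LA [MA AM] _] := wA.
pose M := `|MA| + `|Mg|.
have M0 : 0 <= M by rewrite addr_ge0.
have AM' n : nrm2 leb (A n) <= M.
  by rewrite (le_trans (AM n))// (le_trans (ler_norm _))// lerDl.
have gM' n : nrm2 leb (g n) <= M.
  by rewrite (le_trans (gM n))// (le_trans (ler_norm _))// lerDr.
pose dl := e / (4 * (M + 1)).
have dl0 : 0 < dl by rewrite divr_gt0// mulr_gt0// ltr_wpDl.
have [T hT] := psi_slow a dl0.
pose t := 4 * (B * M + 1) / e.
have t0 : 0 < t by rewrite divr_gt0// mulr_gt0// ltr_wpDl// mulr_ge0.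
pose c := e / (4 * ((B + 1) * t)).
have c0 : 0 < c by rewrite divr_gt0// mulr_gt0// mulr_gt0// ltr_wpDl.
have /cvgrPdist_lt/(_ _ c0) hA := @wnull_hat_box R d K cK A T wA.
move: hT hA; apply: filterS2 => n hT.
rewrite sub0r normrN (ger0_norm (nrm2_ge0 _ _)) => hA.
rewrite subr0 qform_cexp// qformE.
have LhA := (L2on_hat cK (LA n)).1; have Lhg := (L2on_hat cK (Lg n)).1.
have hAM := le_trans (L2on_hat cK (LA n)).2 (AM' n).
have hgM := le_trans (L2on_hat cK (Lg n)).2 (gM' n).
pose D (xi : 'rV[R]_d) := psi n xi - psi n (xi - a).
pose b (xi : 'rV[R]_d) : R[i] := (\1_(row_box 0 T) xi)%:C%C.
pose bc (xi : 'rV[R]_d) : R[i] := (\1_(~` row_box 0 T) xi)%:C%C.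
have mbox := measurable_row_box (0 : 'rV[R]_d) T.
have mb : cmeasurable setT b by apply: cmeasurableR; exact: measurable_indic.
have mbc : cmeasurable setT bc.
  by apply: cmeasurableR; apply: measurable_indic; exact: measurableC.
have mD : cmeasurable setT D.
  apply: cmeasurableB => //.
  exact: (cmeasurable_comp (mpsi n) (measurable_row_shift (- a))).
have b1 xi : N (b xi) <= 1.
  by rewrite cmodR indicE; case: (_ \in _); rewrite ?normr1// normr0.
have DB xi : N (D xi) <= 2 * B.
  by rewrite (le_trans (cmodB _ _))// mulr_natl mulr2n lerD.
have LbA : L2fun leb (fun xi => b xi * hat (A n) xi) by exact: L2funZb LhA mb b1.
have mDc : cmeasurable setT (fun xi => D xi * bc xi) by exact: cmeasurableM.
have Ddl xi : N (D xi * bc xi) <= dl.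
  rewrite cmodM cmodR indicE; have [xT|xT] := pselect (row_box 0 T xi).
    by rewrite memNset ?normr0 ?mulr0 ?(ltW dl0)//; apply/not_notP.
  by rewrite mem_set// normr1 mulr1; exact: hT.
have -> : cintegral leb setT (fun xi : 'rV[R]_d => (psi n xi - psi n (xi - a)) *
    (hat (fun x => cexp a x * f n x) xi * (hat (g n) xi)^*)) =
  cintegral leb setT (fun xi => D xi * ((b xi * hat (A n) xi) * (hat (g n) xi)^*)) +
  cintegral leb setT (fun xi => (D xi * bc xi) * (hat (A n) xi * (hat (g n) xi)^*)).
  rewrite -cintegralD.
  - congr cintegral; apply/funext => xi; rewrite -/(D xi) -/(A n).
    have bb : b xi + bc xi = 1.
      rewrite /b /bc -rmorphD/= !indicE in_setC.
      by case: (_ \in _); rewrite /= ?addr0 ?add0r.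
    rewrite -[LHS]mul1r -bb; ring.
  - apply: (cintegrableMb (B := 2 * B)) => //.
    by apply: cintegrableM => //; exact: L2funJ.
  - apply: (cintegrableMb (B := dl)) => //.
    by apply: cintegrableM => //; exact: L2funJ.
have h1 := cmod_cintegral_mul t0 mD DB LbA Lhg.
have h2 := cmod_cintegral_mul ltr01 mDc Ddl LhA Lhg.
rewrite (le_lt_trans (cmodD _ _))// (le_lt_trans (lerD h1 h2))//.
by apply: (commutator_estimate e0 B0 M0 (nrm2_ge0 _ _) hAM hgM hA).
Qed.

End commutation.
End quadratic_form.

(** * The uniformly closed algebra of commuting functions *)

Section commuting_algebra.
Context {R : realType} {d : nat}.
Local Notation N := (@Normc.normc R).
Local Notation leb := (@lebesgue_row R d).
Variable (K : set 'rV[R]_d).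
Hypothesis cK : compact K.
Variables (psi : nat -> 'rV[R]_d -> R[i]) (B : R).
Hypothesis mpsi : forall n, cmeasurable setT (psi n).
Hypothesis psiB : forall n xi, N (psi n xi) <= B.
Local Notation commutes := (commutes K psi).
Implicit Types (th : 'rV[R]_d -> R[i]).

Lemma commutes_cst c : commutes (fun=> c).
Proof.
split; first exact: cmeasurable_cst.
  by exists (N c).
move=> f g [Lf _ _] [Lg _ _] e e0; apply: nearW => n.
rewrite (qformZl cK _ (mpsi n) (psiB n))// (qformZr cK _ (mpsi n) (psiB n))//.
by rewrite conjCK subrr subr0 cmod0.
Qed.

Lemma commutes_add th1 th2 : commutes th1 -> commutes th2 ->
  commutes (fun x => th1 x + th2 x).
Proof.
move=> [m1 [C1 b1] h1] [m2 [C2 b2] h2]; split; first exact: cmeasurableD.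
  by exists (C1 + C2) => x Kx; rewrite (le_trans (cmodD _ _))// lerD ?b1 ?b2.
move=> f g wf wg; have [Lf _ _] := wf; have [Lg _ _] := wg.
have := @ccvgD R nat \oo eventually_filter _ _ _ _ (h1 _ _ wf wg) (h2 _ _ wf wg); rewrite addr0.
congr (ccvg _ _ _); apply/funext => n.
have L1 := L2onM (Lf n) m1 b1; have L2 := L2onM (Lf n) m2 b2.
have b1' x : K x -> N (th1 x)^* <= C1 by move=> Kx; rewrite cmodJ b1.
have b2' x : K x -> N (th2 x)^* <= C2 by move=> Kx; rewrite cmodJ b2.
have L1' := L2onM (Lg n) (cmeasurableJ m1) b1'.
have L2' := L2onM (Lg n) (cmeasurableJ m2) b2'.
rewrite [X in _ = qform _ X _ - _](_ : _ = fun x => th1 x * f n x + th2 x * f n x).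
  rewrite [X in _ = _ - qform _ _ X](_ : _ = fun x => (th1 x)^* * g n x + (th2 x)^* * g n x).
    by rewrite (qformDl cK (mpsi n) (psiB n))// (qformDr cK (mpsi n) (psiB n))//; ring.
  by apply/funext => x; rewrite rmorphD mulrDl.
by apply/funext => x; rewrite mulrDl.
Qed.

(** First [th1] crosses with [th2 * f] on the left, then [th2] crosses with the conjugate of [th1]
    times [g] on the right; the middle terms cancel. Both products are again weakly null. *)
Lemma commutes_mul th1 th2 : commutes th1 -> commutes th2 ->
  commutes (fun x => th1 x * th2 x).
Proof.
move=> [m1 [C1 b1] h1] [m2 [C2 b2] h2]; split; first exact: cmeasurableM.
  by exists (C1 * C2) => x Kx; rewrite cmodM ler_pM ?cmod_ge0 ?b1 ?b2.
move=> f g wf wg.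
have b1' x : K x -> N (th1 x)^* <= C1 by move=> Kx; rewrite cmodJ b1.
have wf2 := wnullM cK wf m2 b2.
have wg1 := wnullM cK wg (cmeasurableJ m1) b1'.
have := @ccvgD R nat \oo eventually_filter _ _ _ _ (h1 _ _ wf2 wg) (h2 _ _ wf wg1); rewrite addr0.
congr (ccvg _ _ _); apply/funext => n.
rewrite [X in _ = qform _ X _ - _](_ : _ = fun x => th1 x * (th2 x * f n x)).
  rewrite [X in _ = _ - qform _ _ X](_ : _ = fun x => (th2 x)^* * ((th1 x)^* * g n x)).
    by rewrite addrA subrK.
  by apply/funext => x; rewrite rmorphM/= -mulrA mulrCA.
by apply/funext => x; rewrite mulrA.
Qed.

(** The error [D] enters each of the two forms once. A weight c^-1 or c balances its squared norm,
    at most c^2 M, against M, so each form changes by at most B M c; [c] keeps the two changes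
    together within e / 2. *)
Lemma commutes_lim th : cmeasurable setT th ->
  (forall e : R, 0 < e -> exists2 th', commutes th' &
     forall x, K x -> N (th x - th' x) <= e) -> commutes th.
Proof.
move=> mth lim.
have [C bC] : exists C, forall x, K x -> N (th x) <= C.
  have [th' [_ [C bC] _] thth'] := lim 1 ltr01.
  exists (1 + C) => x Kx; rewrite -[th x](subrK (th' x)) (le_trans (cmodD _ _))//.
  by rewrite lerD ?thth' ?bC.
split => //; first by exists C.
move=> f g wf wg e e0.
have [Lf [Mf fM] _] := wf; have [Lg [Mg gM] _] := wg.
have B0 : 0 <= B := le_trans (cmod_ge0 _) (psiB 0%N 0).
pose M := `|Mf| + `|Mg|.
have M0 : 0 <= M by rewrite addr_ge0.
have fM' n : nrm2 leb (f n) <= M.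
  by rewrite (le_trans (fM n))// (le_trans (ler_norm _))// lerDl.
have gM' n : nrm2 leb (g n) <= M.
  by rewrite (le_trans (gM n))// (le_trans (ler_norm _))// lerDr.
pose c := e / (4 * (B * M + 1)).
have BM0 : 0 < B * M + 1 by rewrite ltr_wpDl// mulr_ge0.
have c0 : 0 < c by rewrite divr_gt0// mulr_gt0.
have [th' cth' thth'] := lim _ c0.
have [m' [C' b'] h'] := cth'.
have e2 : 0 < e / 2 by rewrite divr_gt0.
have := h' _ _ wf wg _ e2; apply: filterS => n.
rewrite [X in N X < _ -> _]subr0 => hn; rewrite [X in N X < _]subr0.
pose D x := th x - th' x.
have mD : cmeasurable setT D by exact: cmeasurableB.
have bD x : K x -> N (D x)^* <= c by move=> Kx; rewrite cmodJ thth'.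
have LD := L2onM (Lf n) mD thth'.
have LD' := L2onM (Lg n) (cmeasurableJ mD) bD.
have L1 := L2onM (Lf n) m' b'.
have bJ x : K x -> N (th' x)^* <= C' by move=> Kx; rewrite cmodJ b'.
have L1' := L2onM (Lg n) (cmeasurableJ m') bJ.
have -> : qform (psi n) (fun x => th x * f n x) (g n) -
    qform (psi n) (f n) (fun x => (th x)^* * g n x) =
  (qform (psi n) (fun x => th' x * f n x) (g n) -
    qform (psi n) (f n) (fun x => (th' x)^* * g n x)) +
  (qform (psi n) (fun x => D x * f n x) (g n) -
    qform (psi n) (f n) (fun x => (D x)^* * g n x)).
  rewrite [X in qform _ X _ - _](_ : _ = fun x => th' x * f n x + D x * f n x).
    rewrite [X in _ - qform _ _ X = _](_ : _ = fun x => (th' x)^* * g n x + (D x)^* * g n x).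
      by rewrite (qformDl cK (mpsi n) (psiB n))// (qformDr cK (mpsi n) (psiB n))//; ring.
    by apply/funext => x; rewrite -mulrDl -rmorphD addrC subrK.
  by apply/funext => x; rewrite -mulrDl addrC subrK.
have ci0 : 0 < c^-1 by rewrite invr_gt0.
have est1 : N (qform (psi n) (fun x => D x * f n x) (g n)) <= B * M * c.
  apply: le_trans (qform_le cK ci0 (mpsi n) (psiB n) LD (Lg n)) _.
  rewrite invrK -mulrA ler_wpM2l//.
  have h1 := nrm2onM (Lf n) mD thth'.
  have h2 : c^-1 * nrm2 leb (fun x => D x * f n x) <= c * M.
    rewrite mulrC ler_pdivrMr// (le_trans h1)//.
    by rewrite [leRHS]mulrAC -expr2 ler_wpM2l ?sqr_ge0.
  have h3 : c * nrm2 leb (g n) <= c * M by rewrite ler_wpM2l// ltW.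
  rewrite [M * c]mulrC; move: h2 h3.
  by move: (c^-1 * _) (c * nrm2 _ _) (c * M) => x y z; lra.
have est2 : N (qform (psi n) (f n) (fun x => (D x)^* * g n x)) <= B * M * c.
  apply: le_trans (qform_le cK c0 (mpsi n) (psiB n) (Lf n) LD') _.
  rewrite -mulrA ler_wpM2l//.
  have h1 := nrm2onM (Lg n) (cmeasurableJ mD) bD.
  have h2 : c^-1 * nrm2 leb (fun x => (D x)^* * g n x) <= c * M.
    rewrite mulrC ler_pdivrMr// (le_trans h1)//.
    by rewrite [leRHS]mulrAC -expr2 ler_wpM2l ?sqr_ge0.
  have h3 : c * nrm2 leb (f n) <= c * M by rewrite ler_wpM2l// ltW.
  rewrite [M * c]mulrC; move: h2 h3.
  by move: (c^-1 * _) (c * nrm2 _ _) (c * M) => x y z; lra.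
have BMc : B * M * c <= e / 4.
  apply: (@le_trans _ _ ((B * M + 1) * c)); first by rewrite ler_wpM2r ?(ltW c0)// lerDl.
  by rewrite /c le_eqVlt; apply/orP; left; apply/eqP; field; rewrite gt_eqF.
rewrite (le_lt_trans (cmodD _ _))//.
apply: lt_le_trans (ltr_leD hn (le_trans (cmodB _ _) (lerD est1 est2))) _.
by move: BMc; move: (B * M * c) => w; lra.
Qed.

Definition rcommutes (h : 'rV[R]_d -> R) := commutes (fun x => (h x)%:C%C).


Lemma rcommutes_cst c : rcommutes (fun=> c).
Proof. exact: commutes_cst. Qed.

Lemma rcommutesD h k : rcommutes h -> rcommutes k -> rcommutes (fun x => h x + k x).
Proof.
move=> ch ck; rewrite /rcommutes; under eq_fun do rewrite rmorphD; exact: commutes_add.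
Qed.

Lemma rcommutesM h k : rcommutes h -> rcommutes k -> rcommutes (fun x => h x * k x).
Proof.
move=> ch ck; rewrite /rcommutes; under eq_fun do rewrite rmorphM; exact: commutes_mul.
Qed.

Lemma rcommutesZ c h : rcommutes h -> rcommutes (fun x => c * h x).
Proof. by move=> ch; apply: rcommutesM => //; exact: rcommutes_cst. Qed.

Lemma rcommutesB h k : rcommutes h -> rcommutes k -> rcommutes (fun x => h x - k x).
Proof.
move=> ch ck; under eq_fun do rewrite -mulN1r.
by apply: rcommutesD => //; exact: rcommutesZ.
Qed.

Lemma rcommutes_prod I (s : seq I) (h : I -> 'rV[R]_d -> R) :
  (forall i, rcommutes (h i)) -> rcommutes (fun x => \prod_(i <- s) h i x).
Proof.
move=> ch; elim: s => [|i s ih].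
  by under eq_fun do rewrite big_nil; exact: rcommutes_cst.
by under eq_fun do rewrite big_cons; exact: rcommutesM.
Qed.


Lemma rcommutes_lim (h : 'rV[R]_d -> R) : measurable_fun setT h ->
  (forall e : R, 0 < e -> exists2 h', rcommutes h' &
     forall x, K x -> `|h x - h' x| <= e) -> rcommutes h.
Proof.
move=> mh lim; apply: commutes_lim; first exact: cmeasurableR.
move=> e /lim[h' ch' hh']; exists (fun x => (h' x)%:C%C) => // x Kx.
by rewrite -rmorphB cmodR hh'.
Qed.

(* The polynomials of the Newton-like iteration p' = p + (t - p^2) / 2
   increase to the square root on [0, 1]. *)
Fixpoint sqrt_iter (n : nat) (t : R) : R :=
  if n is n'.+1 then sqrt_iter n' t + (t - sqrt_iter n' t ^+ 2) / 2 else 0.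

(** With s the root and p the iterate, the error D = s - p becomes D (1 - (s + p) / 2) <= D (1 - D /
    2), a recursion that preserves D <= 2 / (n + 2). *)
Lemma sqrt_iter_cvg n t : 0 <= t <= 1 ->
  0 <= sqrt_iter n t <= Num.sqrt t /\ Num.sqrt t - sqrt_iter n t <= 2 / n.+2%:R.
Proof.
move=> /andP[t0 t1].
have s1 : Num.sqrt t <= 1 by rewrite -[leRHS]sqrtr1 ler_wsqrtr.
have s0 := sqrtr_ge0 t.
have ts := sqr_sqrtr t0.
move: (Num.sqrt t) ts s0 s1 => s <- {t t0 t1} s0 s1.
elim: n => [|n [/andP[p0 ps] ih]] /=.
  by rewrite lexx s0 subr0; split => //; apply: le_trans s1 _; rewrite divff.
have n0 : 0 < n.+2%:R :> R by [].
move: (sqrt_iter n _) p0 ps ih => p p0 ps ih.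
have -> : n.+3%:R = n.+2%:R + 1 :> R by rewrite natr1.
move: (n.+2%:R) n0 ih => m m0 ih.
split; first by apply/andP; split; nra.
have -> : s - (p + (s ^+ 2 - p ^+ 2) / 2) = (s - p) * (1 - (s + p) / 2) by field.
have h1 : (s - p) * (1 - (s + p) / 2) <= (s - p) * (1 - (s - p) / 2).
  by rewrite ler_wpM2l//; lra.
apply: le_trans h1 _.
have D0 : 0 <= s - p by lra.
have D1 : s - p <= 1 by lra.
move: (s - p) ih D0 D1 => D ih D0 D1.
rewrite ler_pdivlMr; last lra.
have : D * m <= 2 by rewrite -ler_pdivlMr.
move=> Dm.
have : D * m * (1 - D / 2) <= 2 * (1 - D / 2) by rewrite ler_wpM2r//; lra.
by have := sqr_ge0 D; rewrite expr2; lra.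
Qed.

Lemma rcommutes_sqrt_iter n h : rcommutes h ->
  rcommutes (fun x => sqrt_iter n (h x)).
Proof.
move=> ch; elim: n => [|n ih] /=; first exact: rcommutes_cst.
rewrite [X in rcommutes X](_ : _ = fun x => sqrt_iter n (h x) +
  2^-1 * (h x - sqrt_iter n (h x) * sqrt_iter n (h x))); last first.
  by apply/funext => x; rewrite expr2 (mulrC 2^-1).
exact: (rcommutesD ih (rcommutesZ _ (rcommutesB ch (rcommutesM ih ih)))).
Qed.

Lemma rcommutes_sqrt (h : 'rV[R]_d -> R) : measurable_fun setT h ->
  (forall x, K x -> 0 <= h x <= 1) -> rcommutes h ->
  rcommutes (fun x => Num.sqrt (h x)).
Proof.
move=> mh h01 ch; apply: rcommutes_lim.
  apply: (measurableT_comp (f := Num.sqrt : measurableTypeR R -> R)) => //.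
  by apply: continuous_measurable_fun; exact: sqrt_continuous.
move=> e e0; pose n := Num.truncn (2 / e).
exists (fun x => sqrt_iter n (h x)); first exact: rcommutes_sqrt_iter.
move=> x Kx; have [/andP[_ sle] est] := sqrt_iter_cvg n (h01 _ Kx).
rewrite ger0_norm ?subr_ge0//; apply: le_trans est _.
rewrite ler_pdivrMr// mulrC -ler_pdivrMr//.
have : 2 / e < n.+1%:R by exact: truncnS_gt.
have : n.+1%:R <= n.+2%:R :> R by rewrite ler_nat.
by move=> a b; exact: le_trans (ltW b) a.
Qed.

Lemma rcommutes_bounded h : rcommutes h ->
  exists2 C : R, 0 < C & forall x, K x -> `|h x| <= C.
Proof.
move=> [_ [C hC] _]; exists (`|C| + 1); first by rewrite ltr_wpDl.
move=> x Kx; have := hC _ Kx; rewrite cmodR => hx.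
by rewrite (le_trans hx)// (le_trans (ler_norm C))// lerDl.
Qed.

(** The absolute value is the square root of the square, after division by a bound [C] that brings
    the square into [0, 1]. *)
Lemma rcommutes_norm (h : 'rV[R]_d -> R) : measurable_fun setT h -> rcommutes h ->
  rcommutes (fun x => `|h x|).
Proof.
move=> mh ch; have [C C0 hC] := rcommutes_bounded ch.
rewrite [X in rcommutes X](_ : _ =
    fun x => C * Num.sqrt (C^-1 * h x * (C^-1 * h x))); last first.
  apply/funext => x; rewrite -expr2 sqrtr_sqr normrM gtr0_norm ?invr_gt0//.
  by rewrite mulVKf ?gt_eqF.
apply: rcommutesZ; apply: rcommutes_sqrt.
- have mC : measurable_fun setT (fun x => C^-1 * h x) by exact: measurable_funM.
  exact: measurable_funM.
- move=> x Kx; rewrite -expr2 sqr_ge0/= -[leRHS](expr1n _ 2).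
  rewrite -[leLHS]ger0_norm ?sqr_ge0// normrX lerXn2r ?nnegrE//.
  by rewrite normrM gtr0_norm ?invr_gt0// mulrC ler_pdivrMr// mul1r hC.
- exact: rcommutesM (rcommutesZ _ ch) (rcommutesZ _ ch).
Qed.

Hypothesis psi_slow : forall (a : 'rV[R]_d) (e : R), 0 < e -> exists M : R,
  \forall n \near \oo, forall xi, ~ row_box 0 M xi ->
    N (psi n xi - psi n (xi - a)) <= e.

(** Two applications of the mean value theorem. A quadratic error suffices for s^-1 sin (s x) to
    tend to x uniformly on bounded sets as s tends to 0. *)
Lemma sin_sub_le (u : R) : `|sin u - u| <= u ^+ 2.
Proof.
wlog u0 : u / 0 < u => [ih|].
  have [u0|u0|->] := ltgtP u 0; [|exact: ih|by rewrite sin0 subrr normr0 expr0n].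
  have := ih (- u); rewrite oppr_gt0 sinN sqrrN => /(_ u0).
  by rewrite -opprD normrN.
have [c + ->] : exists2 c, c \in `]0, u[ & sin u - u = (cos c - 1) * u.
  have [c cu e] := @MVT R sin cos 0 u u0 (fun x _ => is_derive_sin x)
    (continuous_subspaceT (@continuous_sin R)).
  by exists c => //; move: e; rewrite sin0 !subr0 => ->; rewrite mulrBl mul1r.
rewrite in_itv/= => /andP[c0 cu].
have [c' _ ->] : exists2 c', c' \in `]0, c[ & cos c - 1 = - sin c' * c.
  have [c' c'u e] := @MVT R cos (fun x => - sin x) 0 c c0 (fun x _ => is_derive_cos x)
    (continuous_subspaceT (@continuous_cos R)).
  by exists c' => //; move: e; rewrite cos0 subr0.
rewrite !normrM normrN (gtr0_norm c0) (gtr0_norm u0) expr2 ler_wpM2r ?(ltW u0)//.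
by rewrite -[leRHS]mul1r ler_pM ?(ltW c0) ?(ltW cu) ?sin_max.
Qed.

Lemma dotr_delta (x : 'rV[R]_d) (i : 'I_d) s : dotr x (s *: delta_mx 0 i) = s * x 0 i.
Proof.
rewrite /dotr (bigD1 i)//= big1 ?addr0 => [|j ji]; rewrite !mxE eqxx/=.
  by rewrite eqxx mulr1 mulrC.
by rewrite (negbTE ji) !mulr0.
Qed.

Lemma rcommutes_sin s (i : 'I_d) : rcommutes (fun x => sin (s * x 0 i)).
Proof.
have p0 : 2 * pi != 0 :> R by rewrite mulf_neq0// gt_eqF// pi_gt0.
pose a : 'rV[R]_d := (s / (2 * pi)) *: delta_mx 0 i.
have cE x : cexp a x = expi (s * x 0 i).
  by rewrite /cexp dotr_delta; congr expi; rewrite mulrA mulrCA divff// mulr1.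
have cc b := commutes_cexp cK mpsi psiB psi_slow b.
(* The constant is 1 / (2 i): the sine is a combination of two opposite characters. *)
have := commutes_mul (commutes_cst (0 -i* 2^-1)%C)
  (commutes_add (cc a) (commutes_mul (commutes_cst (- 1)) (cc (- a)))).
congr (commutes _); apply/funext => x.
rewrite -conj_cexp cE; apply: complex_ext; rewrite ?ReM ?ImM /= ?ReD ?ImD ?ReM ?ImM /=.
  by field.
by field.
Qed.

Lemma rcommutes_coord (i : 'I_d) : rcommutes (fun x => x 0 i).
Proof.
apply: rcommutes_lim; first exact: measurable_coord.
move=> e e0; have [T [T0 KT]] := compact_row_box cK.
(* For |x_i| < T the error s^-1 (s x_i)^2 = s x_i^2 is then at most e. *)
pose s := e / (T ^+ 2 + 1).
have T20 : 0 < T ^+ 2 + 1 by rewrite ltr_wpDl ?sqr_ge0.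
have s0 : 0 < s by rewrite divr_gt0.
exists (fun x => s^-1 * sin (s * x 0 i)); first exact: rcommutesZ (rcommutes_sin s i).
move=> x /KT/(_ i); rewrite mxE sub0r normrN => xT.
rewrite -{1}(mulKf (lt0r_neq0 s0) (x 0 i)) -mulrBr normrM gtr0_norm ?invr_gt0//.
rewrite mulrC ler_pdivrMr// distrC (le_trans (sin_sub_le _))//.
rewrite exprMn (expr2 s) -mulrA mulrC ler_wpM2r ?(ltW s0)//.
rewrite /s mulrAC ler_pdivrMr// ler_wpM2l ?(ltW e0)//.
rewrite -[x 0 i ^+ 2]ger0_norm ?sqr_ge0// normrX.
have : `|x 0 i| ^+ 2 <= T ^+ 2 by rewrite lerXn2r ?nnegrE ?(ltW T0)// ltW.
by move/le_trans; apply; rewrite lerDl.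
Qed.

Definition pospart (t : R) := 2^-1 * (t + `|t|).

Lemma rcommutes_pospart (h : 'rV[R]_d -> R) : measurable_fun setT h -> rcommutes h ->
  rcommutes (fun x => pospart (h x)).
Proof.
move=> mh ch; exact: (rcommutesZ _ (rcommutesD ch (rcommutes_norm mh ch))).
Qed.

End commuting_algebra.

(** * Square partitions of unity *)

Section partition_of_unity.
Context {R : realType} {d : nat}.
Local Notation N := (@Normc.normc R).

Record admissible (K : set 'rV[R]_d) (psi : nat -> 'rV[R]_d -> R[i]) (B : R) : Prop :=
  Admissible {
    _ : compact K ;
    _ : forall n, cmeasurable setT (psi n) ;
    _ : forall n xi, N (psi n xi) <= B ;
    _ : forall (a : 'rV[R]_d) (e : R), 0 < e -> exists M : R,
      \forall n \near \oo, forall xi, ~ row_box 0 M xi ->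
        N (psi n xi - psi n (xi - a)) <= e }.

(** At least 1 when the i-th coordinates differ by at most e / 2, and at most 0 when they differ by
    e or more. [cutoff] clamps it to [0, 1] with [pospart], an operation that preserves
    commutation. *)
Definition ramp (q : 'rV[R]_d) (e : R) (i : 'I_d) (x : 'rV[R]_d) : R :=
  2 - 2 / e * `|x 0 i - q 0 i|.

Definition cutoff (q : 'rV[R]_d) (e : R) (x : 'rV[R]_d) : R :=
  \prod_i (pospart (ramp q e i x) - pospart (ramp q e i x - 1)).

(* The factors telescope: the squares sum to [1 - \prod_j (1 - cutoff_j ^ 2)]. *)
Definition punity (q : seq 'rV[R]_d) (e : R) (m : nat) (x : 'rV[R]_d) : R :=
  cutoff (nth 0 q m) e x * \prod_(j < m) Num.sqrt (1 - cutoff (nth 0 q j) e x ^+ 2).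

Lemma measurable_ramp q e i : measurable_fun setT (ramp q e i).
Proof.
apply: measurable_funB => //; apply: measurable_funM => //.
apply: measurableT_comp => //; apply: measurable_funB => //.
exact: measurable_coord.
Qed.

Lemma measurable_pospart (h : 'rV[R]_d -> R) : measurable_fun setT h ->
  measurable_fun setT (fun x => pospart (h x)).
Proof.
move=> mh; apply: measurable_funM => //; apply: measurable_funD => //.
exact: measurableT_comp.
Qed.

Lemma measurable_cutoff q e : measurable_fun setT (cutoff q e).
Proof.
rewrite /cutoff; apply: measurable_prod => i _.
have mr := measurable_ramp q e i.
apply: measurable_funB; apply: measurable_pospart => //.
exact: measurable_funB.
Qed.

Lemma measurable_punity q e m : measurable_fun setT (punity q e m).
Proof.
apply: measurable_funM; first exact: measurable_cutoff.
apply: measurable_prod => j _.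
apply: (measurableT_comp (f := Num.sqrt : measurableTypeR R -> R)) => //.
  by apply: continuous_measurable_fun; exact: sqrt_continuous.
apply: measurable_funB => //; under eq_fun do rewrite expr2.
by apply: measurable_funM; exact: measurable_cutoff.
Qed.

Lemma ramp_factor01 (t : R) : 0 <= pospart t - pospart (t - 1) <= 1.
Proof.
by rewrite /pospart; case: (ger0P t) => t0; case: (ger0P (t - 1)) => t1;
  apply/andP; split; lra.
Qed.

Lemma cutoff01 q e x : 0 <= cutoff q e x <= 1.
Proof.
rewrite /cutoff; elim/big_ind : _ => [|a b /andP[a0 a1] /andP[b0 b1]|i _].
- by rewrite ler01 lexx.
- by rewrite mulr_ge0// -[leRHS]mul1r ler_pM.
- exact: ramp_factor01.
Qed.

Lemma cutoff_sqr01 q e x : 0 <= cutoff q e x ^+ 2 <= 1.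
Proof.
by have /andP[c0 c1] := cutoff01 q e x; rewrite sqr_ge0/= expr_le1.
Qed.

Lemma cutoff_supp q e x : 0 < e -> cutoff q e x != 0 -> row_box q e x.
Proof.
move=> e0 /prodf_neq0 c0 i; have := c0 i isT; apply: contraNT; rewrite -leNgt => h.
have r0 : ramp q e i x <= 0.
  rewrite /ramp subr_le0 mulrAC ler_pdivlMr// ler_pM2l//; first by rewrite distrC.
by rewrite /pospart !ler0_norm//; [|lra..]; apply/eqP; lra.
Qed.

Lemma cutoff1 q e x : 0 < e -> row_box q (e / 2) x -> cutoff q e x = 1.
Proof.
move=> e0 h; apply: big1 => i _; have := h i; rewrite distrC => {}h.
have r1 : 1 <= ramp q e i x.
  have : 2 / e * `|x 0 i - q 0 i| <= 1.
    by rewrite mulrAC ler_pdivrMr// mul1r mulrC -ler_pdivlMr// ltW.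
  by rewrite /ramp; lra.
by rewrite /pospart !ger0_norm; lra.
Qed.

Lemma punity_supp q e m x : 0 < e -> punity q e m x != 0 -> row_box (nth 0 q m) e x.
Proof. by move=> e0; rewrite mulf_eq0 negb_or => /andP[/(cutoff_supp e0)]. Qed.

Lemma sum_punity q e m x :
  \sum_(i < m) punity q e i x ^+ 2 = 1 - \prod_(j < m) (1 - cutoff (nth 0 q j) e x ^+ 2).
Proof.
elim: m => [|m ih]; first by rewrite !big_ord0 subrr.
rewrite !big_ord_recr/= ih /punity exprMn.
move: (cutoff (nth 0 q m) e x) => c; rewrite -prodrXl.
rewrite [X in _ + _ * X](eq_bigr (fun j : 'I_m => 1 - cutoff (nth 0 q j) e x ^+ 2)); first by ring.
move=> j _; rewrite sqr_sqrtr// subr_ge0.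
by have /andP[] := cutoff_sqr01 (nth 0 q j) e x.
Qed.

Lemma sum_punity_le1 q e m x : \sum_(i < m) punity q e i x ^+ 2 <= 1.
Proof.
rewrite sum_punity gerBl; apply: prodr_ge0 => j _; rewrite subr_ge0.
by have /andP[] := cutoff_sqr01 (nth 0 q j) e x.
Qed.

Lemma sum_punity1 q e x : 0 < e ->
  (exists2 p, p \in q & row_box p (e / 2) x) ->
  \sum_(i < size q) punity q e i x ^+ 2 = 1.
Proof.
move=> e0 [p pq px]; rewrite sum_punity.
have iq : (index p q < size q)%N by rewrite index_mem.
rewrite (bigD1 (Ordinal iq))//= nth_index// cutoff1// expr1n subrr mul0r subr0 //.
Qed.

Lemma rcommutes_punity q e m K psi B : admissible K psi B ->
  rcommutes K psi (punity q e m).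
Proof.
move=> [cK mpsi psiB slow].
have cramp p i : rcommutes K psi (ramp p e i).
  have cc := rcommutesB cK mpsi psiB (rcommutes_coord cK mpsi psiB slow i)
    (rcommutes_cst cK mpsi psiB (p 0 i)).
  have mc : measurable_fun setT (fun x : 'rV[R]_d => x 0 i - p 0 i).
    by apply: measurable_funB => //; exact: measurable_coord.
  exact: (rcommutesB cK mpsi psiB (rcommutes_cst cK mpsi psiB 2)
    (rcommutesZ cK mpsi psiB _ (rcommutes_norm cK mpsi psiB mc cc))).
have ccut p : rcommutes K psi (cutoff p e).
  apply: (rcommutes_prod cK mpsi psiB) => i.
  have mr := measurable_ramp p e i.
  apply: (rcommutesB cK mpsi psiB); apply: (rcommutes_pospart cK mpsi psiB) => //.
    exact: measurable_funB.
  exact: (rcommutesB cK mpsi psiB (cramp p i) (rcommutes_cst cK mpsi psiB 1)).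
suff cp : rcommutes K psi (fun x =>
    \prod_(j < m) Num.sqrt (1 - cutoff (nth 0 q j) e x ^+ 2)).
  exact: (rcommutesM cK (ccut _) cp).
apply: (rcommutes_prod cK mpsi psiB) => j.
have csq : rcommutes K psi (fun x => 1 - cutoff (nth 0 q j) e x ^+ 2).
  under eq_fun do rewrite expr2.
  exact: (rcommutesB cK mpsi psiB (rcommutes_cst cK mpsi psiB 1)
    (rcommutesM cK (ccut _) (ccut _))).
apply: (rcommutes_sqrt cK mpsi psiB) => //.
  apply: measurable_funB => //; under eq_fun do rewrite expr2.
  by apply: measurable_funM; exact: measurable_cutoff.
move=> x _; have := cutoff_sqr01 (nth 0 q j) e x.
by move: (cutoff _ _ _ ^+ 2) => c /andP[c0 c1]; rewrite subr_ge0 c1 lerBlDr lerDl.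
Qed.

End partition_of_unity.

Lemma ball_cover {R : realType} {T : pseudoMetricType R} (K : set T) (e : R) :
  compact K -> 0 < e ->
  exists q : seq T, (forall p, p \in q -> K p) /\
    forall x, K x -> exists2 p, p \in q & ball p e x.
Proof.
move=> cK e0.
(* The filter of finite lists directed by inclusion: compactness, as near covering along it, gives
   one list that serves all [x]. *)
pose F : set_system (seq T) := [set A : set (seq T) | exists2 s0 : seq T, (forall p, p \in s0 -> K p) &
  forall s : seq T, {subset s0 <= s} -> A s].
have FF : Filter F.
  split.
  - by exists [::].
  - move=> A B [s sK sA] [t tK tB]; exists (s ++ t).
      by move=> p; rewrite mem_cat => /orP[/sK|/tK].
    move=> w sw; split; [apply: sA|apply: tB] => p ps; apply: sw; rewrite mem_cat ps//.
    by rewrite orbT.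
  - by move=> A B AB [s sK sA]; exists s => // w /sA/AB.
have [x Kx|s sK h] := (compact_near_coveringP K).1 cK _ F
    (fun s x => exists2 p, p \in s & ball p e x) FF.
  exists (ball x e, [set s : seq T | x \in s]) => /=.
    split; first exact: nbhsx_ballx.
    exists [:: x] => [p|s]; first by rewrite inE => /eqP ->.
    by move=> /(_ x); apply; rewrite inE.
  by move=> [y s] /= [xy xs]; exists x.
by exists s; split => // x Kx; exact: (h s (fun _ => id) x Kx).
Qed.

(** * Localized sequences *)

Section localization.
Context {R : realType} {d : nat}.
Local Notation N := (@Normc.normc R).
Local Notation leb := (@lebesgue_row R d).
Implicit Types (K : set 'rV[R]_d) (f : 'rV[R]_d -> R[i]).

Definition crestrict K f : 'rV[R]_d -> R[i] := fun x => (\1_K x)%:C%C * f x.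

Lemma crestrictT K f x : K x -> crestrict K f x = f x.
Proof. by move=> Kx; rewrite /crestrict indicE mem_set// mul1r. Qed.

Lemma crestrictN K f x : ~ K x -> crestrict K f x = 0.
Proof. by move=> Kx; rewrite /crestrict indicE memNset// mul0r. Qed.

Lemma Re_crestrict K f : (fun x => complex.Re (crestrict K f x)) =
  (fun x => complex.Re (f x)) \_ K.
Proof.
apply/funext => x; rewrite patchE; have [xK|xK] := boolP (x \in K).
  by rewrite crestrictT//; exact: set_mem.
by move: xK; rewrite notin_setE => xK; rewrite crestrictN.
Qed.

Lemma Im_crestrict K f : (fun x => complex.Im (crestrict K f x)) =
  (fun x => complex.Im (f x)) \_ K.
Proof.
apply/funext => x; rewrite patchE; have [xK|xK] := boolP (x \in K).
  by rewrite crestrictT//; exact: set_mem.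
by move: xK; rewrite notin_setE => xK; rewrite crestrictN.
Qed.

Lemma cmeasurable_crestrict K f : measurable K -> cmeasurable K f ->
  cmeasurable setT (crestrict K f).
Proof.
move=> mK [f1 f2]; split.
- by rewrite Re_crestrict; apply/(measurable_restrictT _ mK).
- by rewrite Im_crestrict; apply/(measurable_restrictT _ mK).
Qed.

Lemma cintegral_crestrict K f :
  cintegral leb K f = cintegral leb setT (crestrict K f).
Proof.
rewrite /cintegral Re_crestrict Im_crestrict.
by rewrite -!Rintegral_mkcond.
Qed.

Lemma L2on_crestrict K f : compact K -> square_integrable K f ->
  L2on K (crestrict K f).
Proof.
move=> cK [mf fi]; have mK := compact_measurable_row cK.
split; last by move=> x /crestrictN.
split; first exact: cmeasurable_crestrict.
have := (integrable_mkcond (mu := leb) (fun x => (N (f x) ^+ 2)%:E) mK).1 fi.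
congr (_.-integrable _ _); apply/funext => x; rewrite patchE.
have [xK|xK] := boolP (x \in K).
  by rewrite crestrictT//; exact: set_mem.
by move: xK; rewrite notin_setE => xK; rewrite crestrictN// cmod0 expr0n.
Qed.

Section weak_limit.
Variables (r : nat) (Omega : set 'rV[R]_d) (u : nat -> 'rV[R]_d -> 'cV[R[i]]_r).
Hypothesis Omega_open : open Omega.
Hypothesis u_weak : weakly_null_L2loc Omega u.
Variables (K : set 'rV[R]_d) (cK : compact K) (KO : K `<=` Omega).

Let mK := compact_measurable_row cK.

Definition local_seq (j : 'I_r) (n : nat) : 'rV[R]_d -> R[i] :=
  crestrict K (fun x => u n x j 0).

Lemma L2on_local_seq j n : L2on K (local_seq j n).
Proof.
have [Lu _] := u_weak; have [_ /(_ _ cK KO)] := Lu n j.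
exact: L2on_crestrict.
Qed.

Lemma local_seq_weak j g : L2fun leb (crestrict K g) ->
  ccvg \oo (fun n => cintegral leb setT (fun x => g x * local_seq j n x)) 0.
Proof.
move=> Lg; have [_ uw] := u_weak.
(* The pairing conjugates the test function, so the conjugate of [g] is put in the component [j]. *)
pose v x : 'cV[R[i]]_r := \col_i (if i == j then (crestrict K g x)^* else 0).
have Lv : L2comp Omega v.
  split; last first.
    exists K; split => // x nKx; apply/matrixP => i k; rewrite !mxE.
    by rewrite crestrictN// rmorph0; case: ifP.
  move=> i; suff [mv vi] : L2fun leb (fun x => v x i 0).
    split; first by have [m1 m2] := mv; split; exact: measurable_funS measurableT _ _.
    by apply: integrableS vi => //; exact: open_measurable_row.
  under eq_fun do rewrite mxE.
  by case: (i == j); [exact: L2funJ|exact: L2fun0].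
have := uw v Lv => /ccvgP; congr (ccvg _ _ _); apply/funext => n.
rewrite cintegral_crestrict; congr cintegral; apply/funext => x.
rewrite /local_seq; have [Ox|nOx] := pselect (Omega x); last first.
  by rewrite crestrictN// [crestrict K _ x]crestrictN ?mulr0// => /KO.
rewrite crestrictT// (bigD1 j)//= big1 ?addr0 => [|i ij].
  rewrite mxE eqxx conjCK; have [Kx|nKx] := pselect (K x).
    by rewrite !crestrictT// mulrC.
  by rewrite !crestrictN// !mulr0.
by rewrite mxE (negbTE ij) rmorph0 mulr0.
Qed.

(** [weakly_null_bounded] concerns real functions; it is applied to the real and the imaginary
    parts, since a real test function pairs with each of them separately. *)
Lemma local_seq_bounded j : exists M : R, forall n, nrm2 leb (local_seq j n) <= M.
Proof.
have LR (f : 'rV[R]_d -> R[i]) : L2fun leb f ->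
    RL2 leb (fun x => complex.Re (f x)) /\ RL2 leb (fun x => complex.Im (f x)).
  move=> [[m1 m2] fi]; split; split => //.
  - apply: le_integrable fi => //.
      by apply/measurable_EFinP; under eq_fun do rewrite expr2; exact: measurable_funM.
    move=> x _; rewrite /= !lee_fin !ger0_norm ?sqr_ge0//.
    by rewrite sqr_cmod lerDl sqr_ge0.
  - apply: le_integrable fi => //.
      by apply/measurable_EFinP; under eq_fun do rewrite expr2; exact: measurable_funM.
    move=> x _; rewrite /= !lee_fin !ger0_norm ?sqr_ge0//.
    by rewrite sqr_cmod lerDr sqr_ge0.
have Lv v : RL2 leb v -> L2fun leb (crestrict K (fun x => (v x)%:C%C)).
  move=> [mv vi]; apply: (le_L2fun (g := fun x => v x ^+ 2)) => //.
    by apply: cmeasurable_crestrict => //; apply: cmeasurableR; exact: measurable_funTS.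
  move=> x; have [Kx|nKx] := pselect (K x).
    by rewrite crestrictT// cmodR real_normK ?num_real.
  by rewrite crestrictN// cmod0 expr0n sqr_ge0.
have [M1 h1] : exists M, forall n, ip leb (fun x => complex.Re (local_seq j n x))
    (fun x => complex.Re (local_seq j n x)) <= M.
  apply: weakly_null_bounded => [n|v Rv].
    by have [/LR[]] := L2on_local_seq j n.
  apply/cvgrPdist_lt => e e0; have := local_seq_weak j (Lv _ Rv) e0.
  apply: filterS => n; rewrite subr0 sub0r normrN => h.
  apply: le_lt_trans h; apply: le_trans (Re_le_cmod _).
  rewrite /ip /cintegral le_eqVlt; apply/orP; left; apply/eqP; congr `|_|; apply: eq_Rintegral => x _.
  rewrite [RHS]ReM; move: (local_seq j n x) => z /=; rewrite mul0r subr0.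
  by rewrite mulrC.
have [M2 h2] : exists M, forall n, ip leb (fun x => complex.Im (local_seq j n x))
    (fun x => complex.Im (local_seq j n x)) <= M.
  apply: weakly_null_bounded => [n|v Rv].
    by have [/LR[]] := L2on_local_seq j n.
  apply/cvgrPdist_lt => e e0; have := local_seq_weak j (Lv _ Rv) e0.
  apply: filterS => n; rewrite subr0 sub0r normrN => h.
  apply: le_lt_trans h; apply: le_trans (Im_le_cmod _).
  rewrite /ip /cintegral le_eqVlt; apply/orP; left; apply/eqP; congr `|_|; apply: eq_Rintegral => x _.
  rewrite [RHS]ImM; move: (local_seq j n x) => z /=; rewrite mul0r addr0.
  by rewrite mulrC.
exists (M1 + M2) => n; apply: le_trans (lerD (h1 n) (h2 n)).
have [/LR[[m1 i1] [m2 i2]] _] := L2on_local_seq j n.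
rewrite /ip -RintegralD//.
rewrite le_eqVlt; apply/orP; left; apply/eqP; apply: eq_Rintegral => x _.
by rewrite sqr_cmod !expr2.
Qed.

Lemma wnull_local_seq j : wnull K (local_seq j).
Proof.
split; [exact: L2on_local_seq|exact: local_seq_bounded|].
move=> phi B mphi phiB; apply: local_seq_weak.
have L1 : L2fun leb (crestrict K (fun=> 1)).
  apply: (le_L2fun (g := \1_K)) => //.
  - by apply: cmeasurable_crestrict => //; exact: cmeasurable_cst.
  - move=> x; have [Kx|nKx] := pselect (K x).
      by rewrite crestrictT// cmod1 expr1n indicE mem_set.
    by rewrite crestrictN// cmod0 expr0n/= indicE memNset.
  - rewrite (_ : (fun x => _) = EFin \o \1_K)//.
    apply/integrableP; split; first by apply/measurable_EFinP; exact: measurable_indic.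
    rewrite (eq_integral (fun x => (\1_K x)%:E)) => [|x _]; last first.
      by rewrite /= ger0_norm.
    by rewrite integral_indic// setIT compact_lty.
have := L2funZb L1 mphi phiB; congr (L2fun _ _); apply/funext => x.
by rewrite /crestrict mulr1 mulrC.
Qed.

End weak_limit.
End localization.

(** * The compactified frequency space *)

Section uniform_continuity.
Context {R : realType}.
Local Notation N := (@Normc.normc R).

Lemma ccontinuous_near (T : topologicalType) (f : T -> R[i]) (x : T) (e : R) :
  ccontinuous f -> 0 < e -> \forall y \near x, N (f x - f y) < e.
Proof.
move=> /(_ x)/ccvgP cf e0; have := cf e e0; apply: filterS => y.
by rewrite cmodBC.
Qed.

Lemma compact_ccontinuous_bounded (T : topologicalType) (f : T -> R[i]) (K : set T) :
  compact K -> ccontinuous f -> exists2 B : R, 0 < B & forall x, K x -> N (f x) <= B.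
Proof.
move=> cK cf.
have [|M _ h] := (compact_near_coveringP K).1 cK nat \oo
    (fun n x => N (f x) <= n%:R) _.
  move=> x Kx; exists ([set y | N (f x - f y) < 1],
      [set n | (Num.truncn (N (f x) + 1) < n)%N]) => /=.
    by split; [exact: ccontinuous_near|exists (Num.truncn (N (f x) + 1)).+1].
  move=> [y n] /= [xy xn]; rewrite -[f y](subKr (f x)) (le_trans (cmodB _ _))//.
  have : N (f x) + 1 < (Num.truncn (N (f x) + 1)).+1%:R by exact: truncnS_gt.
  have : (Num.truncn (N (f x) + 1)).+1%:R <= n%:R :> R by rewrite ler_nat.
  by move: (_.+1%:R) (n%:R) xy => a b ? ? ?; lra.
exists M.+1%:R => // x Kx; exact: (h M.+1 (leqnSn _) x Kx).
Qed.

(** Near covering along \oo with the candidate radius 1 / (n + 1). Half of the local radius locates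
    [x], and the other half is left for [y]. *)
Lemma compact_ccontinuous_unif (T : pseudoMetricType R) (f : T -> R[i])
    (K : set T) (e : R) : compact K -> ccontinuous f -> 0 < e ->
  exists2 dl : R, 0 < dl & forall x y, K x -> ball x dl y -> N (f x - f y) < e.
Proof.
move=> cK cf e0; have e2 : 0 < e / 2 by rewrite divr_gt0.
have [|M _ h] := (compact_near_coveringP K).1 cK nat \oo
    (fun n x => forall y, ball x n.+1%:R^-1 y -> N (f x - f y) < e) _.
  move=> x Kx; have /nbhs_ballP[r /= r0 xr] := ccontinuous_near x cf e2.
  have r2 : 0 < r / 2 by rewrite divr_gt0.
  have [k _ hk] := near_infty_natSinv_lt (PosNum r2).
  exists (ball x (r / 2), [set n | (k <= n)%N]) => /=.
    by split; [exact: nbhsx_ballx|exists k].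
  move=> [x' n] /= [xx' kn] y x'y.
  have xr' : ball x r x' by apply: le_ball xx'; lra.
  have yr : ball x r y.
    rewrite (splitr r); apply: ball_triangle xx' _; apply: le_ball x'y.
    exact: ltW (hk _ kn).
  have := xr _ xr' => /= h1; have := xr _ yr => /= h2.
  have -> : f x' - f y = (f x - f y) - (f x - f x') by ring.
  by rewrite (le_lt_trans (cmodB _ _))//; lra.
exists M.+1%:R^-1; first by rewrite invr_gt0.
by move=> x y Kx; apply: (h M) => //=.
Qed.

Lemma compact_ball_subset (T : pseudoMetricType R) (K U : set T) :
  compact K -> open U -> K `<=` U ->
  exists2 dl : R, 0 < dl & forall x, K x -> ball x dl `<=` U.
Proof.
move=> cK oU KU.
have [|M _ h] := (compact_near_coveringP K).1 cK nat \oo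
    (fun n x => ball x (n.+1%:R^-1 : R) `<=` U) _.
  move=> x Kx; have /nbhs_ballP[r /= r0 xr] : nbhs x U by exact/open_nbhs_nbhs/(conj oU (KU _ Kx)).
  have r2 : 0 < r / 2 by rewrite divr_gt0.
  have [k _ hk] := near_infty_natSinv_lt (PosNum r2).
  exists (ball x (r / 2), [set n | (k <= n)%N]) => /=.
    by split; [exact: nbhsx_ballx|exists k].
  move=> [x' n] /= [xx' kn] y x'y; apply: xr.
  rewrite (splitr r); apply: ball_triangle xx' _; apply: le_ball x'y.
  exact: ltW (hk _ kn).
exists M.+1%:R^-1; first by rewrite invr_gt0.
by move=> x Kx; apply: (h M) => //=.
Qed.

Lemma compact_subtype (T : pseudoMetricType R) (A K : set T) :
  compact K -> K `<=` A -> compact (set_val @^-1` K : set A).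
Proof.
move=> cK KA; apply/compact_near_coveringP => I F P FF cover.
have := (near_covering_withinP K).2 ((compact_near_coveringP K).1 cK) I F
  (fun i x => forall h : x \in A, P i (exist _ x h)) FF.
have H x : K x -> \forall x' \near x & i \near F,
    K x' -> forall h : x' \in A, P i (exist _ x' h).
  move=> Kx; have xA : x \in A by exact/mem_set/KA.
  have [[U V] /= [/nbhs_ballP[r /= r0 xr] FV] UV] := cover (exist _ x xA) Kx.
  exists (ball x r, V) => /=; first by split => //; exact: nbhsx_ballx.
  move=> [x' i] /= [xx' Vi] _ h; apply: (UV (exist _ x' h, i)); split => //=.
  exact: xr.
move=> /(_ H); apply: filterS => i Pi [x xA] Kx; exact: Pi.
Qed.

End uniform_continuity.

Section euclidean_norm.
Context {R : realType} {d : nat}.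
Implicit Types x y : 'rV[R]_d.

Lemma dotrC x y : dotr x y = dotr y x.
Proof. by apply: eq_bigr => i _; rewrite mulrC. Qed.

Lemma dotrDl x y z : dotr (x + y) z = dotr x z + dotr y z.
Proof. by rewrite dotrC dotrDr !(dotrC z). Qed.

Lemma dotrZr a x y : dotr x (a *: y) = a * dotr x y.
Proof. by rewrite /dotr mulr_sumr; apply: eq_bigr => i _; rewrite mxE; ring. Qed.

Lemma dotrZl a x y : dotr (a *: x) y = a * dotr x y.
Proof. by rewrite dotrC dotrZr dotrC. Qed.

Lemma dotrr_ge0 x : 0 <= dotr x x.
Proof. by apply: sumr_ge0 => i _; rewrite -expr2 sqr_ge0. Qed.

Lemma enorm_ge0 x : 0 <= enorm x. Proof. exact: sqrtr_ge0. Qed.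

Lemma sqr_enorm x : enorm x ^+ 2 = dotr x x.
Proof. by rewrite sqr_sqrtr// dotrr_ge0. Qed.

Lemma coord_le_enorm x i : `|x 0 i| <= enorm x.
Proof.
rewrite -(ler_pXn2r (n := 2)) ?nnegrE ?enorm_ge0// sqr_enorm real_normK ?num_real//.
rewrite /dotr (bigD1 i)//= -expr2 lerDl; apply: sumr_ge0 => j _.
by rewrite -expr2 sqr_ge0.
Qed.

Lemma enorm_eq0 x : enorm x = 0 -> x = 0.
Proof.
move=> x0; apply/rowP => i; rewrite mxE; apply/eqP.
by rewrite -normr_le0 -x0 coord_le_enorm.
Qed.

Lemma enormZ a x : enorm (a *: x) = `|a| * enorm x.
Proof. by rewrite /enorm dotrZl dotrZr mulrA -expr2 sqrtrM ?sqr_ge0// sqrtr_sqr. Qed.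

Lemma enormN x : enorm (- x) = enorm x.
Proof. by rewrite -scaleN1r enormZ normrN normr1 mul1r. Qed.

Lemma enorm0 : enorm (0 : 'rV[R]_d) = 0.
Proof. by rewrite -(scale0r (0 : 'rV[R]_d)) enormZ normr0 mul0r. Qed.

Lemma dotr_le_enorm x y : dotr x y <= enorm x * enorm y.
Proof.
have [x0|xn0] := eqVneq (enorm x) 0.
  by rewrite x0 mul0r (enorm_eq0 x0) -(scale0r (0 : 'rV[R]_d)) dotrZl mul0r.
have [y0|yn0] := eqVneq (enorm y) 0.
  by rewrite y0 mulr0 (enorm_eq0 y0) -(scale0r (0 : 'rV[R]_d)) dotrZr mul0r.
have := dotrr_ge0 (enorm y *: x - enorm x *: y).
have -> : dotr (enorm y *: x - enorm x *: y) (enorm y *: x - enorm x *: y) =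
    2 * (enorm x * enorm y) * (enorm x * enorm y - dotr x y).
  have hB (z u v : 'rV[R]_d) : dotr (u - v) z = dotr u z - dotr v z.
    by rewrite (dotrC (u - v)) dotrDr dotrNr !(dotrC z).
  rewrite dotrDr dotrNr !hB !dotrZl !dotrZr -!sqr_enorm (dotrC y x); ring.
have p : 0 < 2 * (enorm x * enorm y) by rewrite !mulr_gt0// lt0r ?xn0 ?yn0 enorm_ge0.
by rewrite (pmulr_rge0 _ p) subr_ge0.
Qed.

Lemma enormD x y : enorm (x + y) <= enorm x + enorm y.
Proof.
rewrite -(ler_pXn2r (n := 2)) ?nnegrE ?addr_ge0 ?enorm_ge0//.
rewrite sqr_enorm dotrDr !dotrDl (dotrC y x) sqrrD -!sqr_enorm.
by have := dotr_le_enorm x y; move: (dotr x y) => t; lra.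
Qed.

Lemma enormB_le x y : `|enorm x - enorm y| <= enorm (x - y).
Proof.
have h (z w : 'rV[R]_d) : enorm z - enorm w <= enorm (z - w).
  by rewrite lerBlDr -[z in X in X <= _](subrK w z) enormD.
by rewrite ler_norml h andbT lerNl opprB -(enormN (x - y)) opprB h.
Qed.

Lemma enorm_continuous : continuous (@enorm R d).
Proof.
move=> x; apply: continuous_comp; last exact: sqrt_continuous.
have ac : continuous (fun z : R * R => z.1 + z.2) by exact: add_continuous.
have : continuous (fun z : 'rV[R]_d => dotr z z); last exact.
apply: (continuous_big (P := xpredT) ac) => i _ z.
have ci := @coord_continuous R 1 d 0 i z.
exact: (cvgM ci ci).
Qed.

Lemma compact_sphere : compact [set x : 'rV[R]_d | enorm x = 1].
Proof.
apply: bounded_closed_compact.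
  exists 1; split => // M M1 x /= x1; apply/row_norm_leP; first by rewrite (le_trans ler01)// ltW.
  by move=> i; rewrite (le_trans (coord_le_enorm x i))// x1 ltW.
rewrite (_ : [set x | _] = @enorm R d @^-1` [set 1]); last by [].
by apply: closed_comp; [move=> x _; exact: enorm_continuous|exact: closed_eq].
Qed.

(** The metric of the extended line is pulled back by [contract], so [expand] maps [0, 1]
    isometrically onto [0, +oo], and the set is the image of the sphere times a segment. *)
Lemma compact_K0inf : compact (@K0inf R d).
Proof.
pose S := [set x : 'rV[R]_d | enorm x = 1] `*` ([set` `[(0 : R), 1]] : set R).
have cS : compact S by apply: compact_setX; [exact: compact_sphere|exact: segment_compact].
rewrite (_ : @K0inf R d = (fun p : 'rV[R]_d * R => (p.1, expand p.2)) @` S).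
  apply: continuous_compact => //; apply/subspace_continuousP => p Sp.
  apply/cvg_ballP => e e0; apply/nbhs_ballP; exists e => //= q [pq1 pq2] Sq.
  split => //=; rewrite /ball/= /ereal_ball.
  move: Sp Sq => [_ /=]; rewrite !in_itv/= => /andP[p0 p1] [_ /andP[q0 q1]].
  by rewrite !expandK// inE/= ger0_norm.
apply/seteqP; split => [[x t] /= [x1 t0]|p [[x t] [/= x1]]].
  exists (x, contract t); last by rewrite /= contractK.
  split => //=; rewrite in_itv/= -(contract0 R) le_contract t0/=.
  by have := contract_le1 t; rewrite ler_norml => /andP[].
rewrite in_itv/= => /andP[t0 t1] <-; split => //=.
by rewrite -expand0; exact: le_expand.
Qed.

End euclidean_norm.

(** * Extension by zero *)

Section extension.
Context {R : realType}.
Local Notation N := (@Normc.normc R).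

Lemma valL_in (T : Type) (A : set T) (f : A -> R[i]) (a : A) :
  'valL_ 0 f (set_val a) = f a.
Proof. by rewrite /= oinv_set_val set_valE valK. Qed.

Lemma valL_inE (T : Type) (A : set T) (f : A -> R[i]) x (h : x \in A) :
  'valL_ 0 f x = f (exist _ x h).
Proof. exact: (valL_in f (exist _ x h)). Qed.

Lemma valL_out (T : Type) (A : set T) (f : A -> R[i]) x :
  ~ A x -> 'valL_ 0 f x = 0.
Proof.
by move=> nAx; rewrite /= oinv_set_val insubN//; apply/negP => /set_mem.
Qed.

Lemma valL_bounded (T : Type) (A : set T) (f : A -> R[i]) B : 0 <= B ->
  (forall a, N (f a) <= B) -> forall x, N ('valL_ 0 f x) <= B.
Proof.
move=> B0 fB x; have [Ax|nAx] := pselect (A x).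
  by rewrite (valL_inE f (mem_set Ax)).
by rewrite valL_out// cmod0.
Qed.

Lemma valL_unif (T : pseudoMetricType R) (A : set T) (f : A -> R[i]) (e : R) :
  compact A -> ccontinuous f -> 0 < e ->
  exists2 dl : R, 0 < dl & forall x y, A x -> A y -> ball x dl y ->
    N ('valL_ 0 f x - 'valL_ 0 f y) < e.
Proof.
move=> cA cf e0.
have [dl dl0 h] := compact_ccontinuous_unif (compact_subtype cA (@subset_refl _ A)) cf e0.
exists dl => // x y Ax Ay xy.
by rewrite (valL_inE f (mem_set Ax)) (valL_inE f (mem_set Ay)); apply: h.
Qed.

Lemma Cc_valL (T : pseudoMetricType R) (A : set T) (f : A -> R[i]) :
  open A -> Cc f -> exists K : set T,
  [/\ compact K, K `<=` A, forall x, ~ K x -> 'valL_ 0 f x = 0,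
    exists2 B : R, 0 < B & forall x, N ('valL_ 0 f x) <= B &
    forall e : R, 0 < e -> exists2 dl : R, 0 < dl &
      forall x y, ball x dl y -> N ('valL_ 0 f x - 'valL_ 0 f y) < e].
Proof.
move=> oA [cf [K0 cK0 K0f]]; pose K := set_val @` K0.
have cK : compact K.
  apply: continuous_compact => //; apply: continuous_subspaceT.
  exact: initial_continuous.
have KA : K `<=` A by move=> _ [[a aA] _ <-]; exact: set_mem aA.
have Kf x : ~ K x -> 'valL_ 0 f x = 0.
  move=> nKx; have [Ax|nAx] := pselect (A x); last by rewrite valL_out.
  by rewrite (valL_inE f (mem_set Ax)) K0f// => K0x; apply: nKx; exists (exist _ x (mem_set Ax)).
exists K; split => //.
  have [B B0 fB] := compact_ccontinuous_bounded cK0 cf.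
  exists B => // x; have [[a Ka <-]|/Kf ->] := pselect (K x).
    by rewrite valL_in fB.
  by rewrite cmod0 ltW.
move=> e e0; have [d1 d10 h1] := compact_ball_subset cK oA KA.
have [d2 d20 h2] := compact_ccontinuous_unif cK0 cf e0.
exists (Num.min d1 d2); first by rewrite lt_min d10.
(* One point in [K] is enough: within d1 of it the other point is still in [A], where the extension
   is [f]. If neither is in [K], both values are 0. *)
have half x y : K x -> ball x (Num.min d1 d2) y -> N ('valL_ 0 f x - 'valL_ 0 f y) < e.
  move=> [a Ka <-] xy; have xy1 : ball (set_val a) d1 y.
    by apply: le_ball xy; rewrite ge_min lexx.
  have xy2 : ball (set_val a) d2 y by apply: le_ball xy; rewrite ge_min lexx orbT.
  have Ay : A y by apply: h1 xy1; exists a.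
  by rewrite valL_in (valL_inE f (mem_set Ay)); apply: h2.
move=> x y xy; have [Kx|nKx] := pselect (K x); first exact: half.
have [Ky|nKy] := pselect (K y); first by rewrite cmodBC; apply: half => //; exact: ball_sym.
by rewrite !Kf// subrr cmod0.
Qed.

Lemma cmeasurable_unif (d : nat) (f : 'rV[R]_d -> R[i]) :
  (forall e : R, 0 < e -> exists2 dl : R, 0 < dl &
      forall x y, ball x dl y -> N (f x - f y) < e) -> cmeasurable setT f.
Proof.
move=> uf; split.
- apply: continuous_measurable_row; first exact: openT.
  move=> x _ U /nbhs_ballP[e /= e0 eU]; have [dl dl0 h] := uf e e0.
  suff : nbhs x ((fun y => complex.Re (f y)) @^-1` U) by [].
  apply/nbhs_ballP; exists dl => // y /h xy; apply: eU; rewrite -ball_normE/=.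
  by apply: le_lt_trans xy; rewrite -ReN -ReD Re_le_cmod.
- apply: continuous_measurable_row; first exact: openT.
  move=> x _ U /nbhs_ballP[e /= e0 eU]; have [dl dl0 h] := uf e e0.
  suff : nbhs x ((fun y => complex.Im (f y)) @^-1` U) by [].
  apply/nbhs_ballP; exists dl => // y /h xy; apply: eU; rewrite -ball_normE/=.
  by apply: le_lt_trans xy; rewrite -ImN -ImD Im_le_cmod.
Qed.

Lemma cmeasurable_unif_lim d (T : measurableType d) (f : T -> R[i]) :
  (forall e : R, 0 < e -> exists2 g, cmeasurable setT g & forall x, N (f x - g x) <= e) ->
  cmeasurable setT f.
Proof.
move=> lim; have /choice[g gP] : forall n, exists g : T -> R[i],
    cmeasurable setT g /\ forall x, N (f x - g x) <= n.+1%:R^-1.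
  move=> n.
  by have [|g mg gf] := lim n.+1%:R^-1; [rewrite invr_gt0|exists g].
have cvg (p : R[i] -> R) : (forall z w, `|p z - p w| <= N (z - w)) ->
    forall x, (fun n => p (g n x)) @ \oo --> p (f x).
  move=> pL x; apply/cvgrPdist_lt => e e0.
  have := near_infty_natSinv_lt (PosNum e0); apply: filterS => n /= ne.
  by apply: le_lt_trans (pL _ _) _; have [_ /(_ x) h] := gP n; exact: le_lt_trans h ne.
split.
- apply: (measurable_fun_cvg (h := fun n x => complex.Re (g n x))).
    by move=> n; have [[]] := gP n.
  by move=> x _; apply: cvg => z w; rewrite -ReN -ReD Re_le_cmod.
- apply: (measurable_fun_cvg (h := fun n x => complex.Im (g n x))).
    by move=> n; have [[]] := gP n.
  by move=> x _; apply: cvg => z w; rewrite -ImN -ImD Im_le_cmod.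
Qed.

End extension.

(** * Symbols and frequency cells *)

Section symbols.
Context {R : realType} {d : nat}.
Local Notation N := (@Normc.normc R).
Local Notation S := (@K0inf R d).

Lemma enorm_gt0 (x : 'rV[R]_d) : x != 0 -> 0 < enorm x.
Proof.
move=> x0; rewrite lt0r enorm_ge0 andbT; apply: contraNneq x0 => /enorm_eq0 ->.
by [].
Qed.

Lemma polar_K0inf (x : 'rV[R]_d) : x != 0 -> S (polar x).
Proof.
move=> x0; split => /=; last by rewrite lee_fin enorm_ge0.
have e0 := enorm_gt0 x0.
by rewrite enormZ gtr0_norm ?invr_gt0// mulVf// gt_eqF.
Qed.

Lemma symbol0 (psi : S -> R[i]) : symbol psi 0 = 0.
Proof.
rewrite /symbol valL_out// => -[/= + _].
by rewrite scaler0 enorm0 => /eqP; rewrite eq_sym oner_eq0.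
Qed.

Lemma polar_continuous (x : 'rV[R]_d) : x != 0 -> {for x, continuous (@polar R d)}.
Proof.
move=> x0; have e0 := enorm_gt0 x0.
have c1 : {for x, continuous (fun y : 'rV[R]_d => (enorm y)^-1 *: y)}.
  have cv : {for x, continuous (fun y : 'rV[R]_d => (enorm y)^-1)}.
    exact: (cvgV (lt0r_neq0 e0) (@enorm_continuous R d x)).
  exact: (@cvgZ _ _ _ _ _ (fun y : 'rV[R]_d => (enorm y)^-1) id _ _ cv cvg_id).
have c2 : {for x, continuous (fun y : 'rV[R]_d => (enorm y)%:E)}.
  have ec : (fine \o (fun y : 'rV[R]_d => (enorm y)%:E)) @ x --> enorm x.
    exact: enorm_continuous.
  by apply: cvg_EFin ec; exact: nearW.
move=> U [[U1 U2] /= [/c1 n1 /c2 n2] sU].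
suff : nbhs x (@polar R d @^-1` U) by [].
have m1 : nbhs x ((fun y : 'rV[R]_d => (enorm y)^-1 *: y) @^-1` U1) := n1.
have m2 : nbhs x ((fun y : 'rV[R]_d => (enorm y)%:E) @^-1` U2) := n2.
apply: (@filterS _ (nbhs x) (nbhs_filter x) _ _ _ (filterI m1 m2)) => y [y1 y2].
exact: (sU (_, _)).
Qed.

(** The interior makes the set open, hence measurable. At the origin [polar] leaves [K0inf] and
    every symbol is 0. *)
Definition net_set (s : seq ('rV[R]_d * \bar R)) (eta : R) (l : nat) : set 'rV[R]_d :=
  [set x | x != 0 /\ (ball (nth (0, 0%E) s l) eta)° (polar x)].

(** The indicator of the l-th set minus the earlier ones, as a product so that sums over [l]
    telescope. *)
Definition net_cell s eta l (x : 'rV[R]_d) : R :=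
  \1_(net_set s eta l) x * \prod_(k < l) (1 - \1_(net_set s eta k) x).

Lemma measurable_net_set s eta l : measurable (net_set s eta l).
Proof.
apply: open_measurable_row; rewrite openE => x [x0 bx].
have : \forall y \near x, (ball (nth (0, 0%E) s l) eta)° (polar y).
  by apply: (polar_continuous x0); apply: open_nbhs_nbhs; split => //; exact: open_interior.
have : \forall y \near x, y != 0.
  have ox : nbhs (enorm x) [set t | 0 < t].
    by apply: open_nbhs_nbhs; split; [exact: open_gt|exact: enorm_gt0].
  have : nbhs x (@enorm R d @^-1` [set t | 0 < t]) := enorm_continuous ox.
  apply: filterS => y /= y0.
  by apply: contraTneq y0 => ->; rewrite enorm0 ltxx.
by apply: filterS2 => y y0 py; split.
Qed.

Lemma measurable_net_cell s eta l : measurable_fun setT (net_cell s eta l).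
Proof.
apply: measurable_funM; first by apply: measurable_indic; exact: measurable_net_set.
apply: measurable_prod => k _; apply: measurable_funB => //.
by apply: measurable_indic; exact: measurable_net_set.
Qed.

Lemma indic01 (T : Type) (A : set T) x : 0 <= (\1_A x : R) <= 1.
Proof. by rewrite indicE; case: (_ \in _); rewrite /= ?ler01 ?lexx. Qed.

Lemma net_cell_ge0 s eta l x : 0 <= net_cell s eta l x.
Proof.
have h k := indic01 (net_set s eta k) x.
apply: mulr_ge0; first by have /andP[] := h l.
by apply: prodr_ge0 => k _; rewrite subr_ge0; have /andP[] := h k.
Qed.

Lemma net_cell_supp s eta l x : net_cell s eta l x != 0 -> net_set s eta l x.
Proof.
rewrite mulf_eq0 negb_or => /andP[+ _]; rewrite indicE pnatr_eq0 eqb0 negbK.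
exact: set_mem.
Qed.

Lemma sum_net_cell s eta m x :
  \sum_(l < m) net_cell s eta l x = 1 - \prod_(k < m) (1 - \1_(net_set s eta k) x).
Proof.
elim: m => [|m ih]; first by rewrite !big_ord0 subrr.
by rewrite !big_ord_recr/= ih /net_cell; move: (\prod_(_ < _) _) (\1_ _ _) => a b; ring.
Qed.

Lemma sum_net_cell_le1 s eta m x : \sum_(l < m) net_cell s eta l x <= 1.
Proof.
rewrite sum_net_cell gerBl; apply: prodr_ge0 => k _; rewrite subr_ge0.
by have /andP[] := indic01 (net_set s eta k) x.
Qed.

Lemma sum_net_cell1 s eta x l : (l < size s)%N -> net_set s eta l x ->
  \sum_(l < size s) net_cell s eta l x = 1.
Proof.
move=> ls lx; rewrite sum_net_cell (bigD1 (Ordinal ls))//= indicE mem_set//.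
by rewrite subrr mul0r subr0.
Qed.

Lemma net_sum_bounded s eta m (f : nat -> R[i]) B x : (forall l, N (f l) <= B) ->
  N (\sum_(l < m) f l * (net_cell s eta l x)%:C%C) <= B.
Proof.
move=> fB; have B0 : 0 <= B := le_trans (cmod_ge0 _) (fB 0%N).
apply: le_trans (cmod_sum _ _ _) _.
apply: (@le_trans _ _ (\sum_(l < m) B * net_cell s eta l x)).
  apply: ler_sum => l _; rewrite cmodM cmodR ger0_norm ?net_cell_ge0//.
  by rewrite ler_wpM2r ?net_cell_ge0.
by rewrite -mulr_sumr -[leRHS]mulr1 ler_wpM2l// sum_net_cell_le1.
Qed.

(** Covering at eta / 2 puts every point in the interior of a ball of radius eta, as [net_set]
    requires. *)
Definition is_net (s : seq ('rV[R]_d * \bar R)) (eta : R) :=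
  (forall p, p \in s -> S p) /\
  forall x, S x -> exists2 p, p \in s & ball p (eta / 2) x.

Lemma exists_net eta : 0 < eta -> exists s, is_net s eta.
Proof.
by move=> eta0; apply: (ball_cover (@compact_K0inf R d)); rewrite divr_gt0.
Qed.

(** At the origin both terms vanish. Elsewhere the cells sum to 1, so the difference is an average
    of differences between the value at [polar x] and those at nodes within eta of it. *)
Lemma net_approx s eta (psi : S -> R[i]) e : 0 < eta -> is_net s eta -> 0 <= e ->
  (forall x y, S x -> S y -> ball x eta y -> N ('valL_ 0 psi x - 'valL_ 0 psi y) <= e) ->
  forall x, N (symbol psi x -
    \sum_(l < size s) 'valL_ 0 psi (nth (0, 0%E) s l) * (net_cell s eta l x)%:C%C) <= e.
Proof.
move=> eta0 [sS scov] e0 h x; have [->|x0] := eqVneq x 0.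
  rewrite symbol0 big1 ?subrr ?cmod0// => l _.
  have [->|/net_cell_supp[]] := eqVneq (net_cell s eta l 0) 0; first by rewrite mulr0.
  by rewrite eqxx.
have Sx := polar_K0inf x0.
have [p ps px] := scov _ Sx.
have ls : (index p s < size s)%N by rewrite index_mem.
have lx : net_set s eta (index p s) x.
  split => //; rewrite nth_index//; apply/nbhs_ballP; exists (eta / 2) => /=.
    by rewrite divr_gt0.
  by move=> y xy; rewrite (splitr eta); exact: ball_triangle px xy.
rewrite -[symbol psi x]mulr1 -[1](_ : \sum_(l < size s) (net_cell s eta l x)%:C%C = 1); last first.
  by rewrite -rmorph_sum/= (sum_net_cell1 ls lx).
rewrite mulr_sumr -sumrB.
apply: le_trans (cmod_sum _ _ _) _.
apply: (@le_trans _ _ (\sum_(l < size s) e * net_cell s eta l x)).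
  apply: ler_sum => l _; rewrite -mulrBl cmodM cmodR ger0_norm ?net_cell_ge0//.
  have [->|/net_cell_supp[_ lx']] := eqVneq (net_cell s eta l x) 0; first by rewrite !mulr0.
  rewrite ler_wpM2r ?net_cell_ge0// cmodBC; apply: h => //.
    by apply: sS; rewrite mem_nth.
  exact: interior_subset lx'.
by rewrite -mulr_sumr -[leRHS]mulr1 ler_wpM2l// sum_net_cell_le1.
Qed.

Lemma symbol_bounded (psi : S -> R[i]) : ccontinuous psi ->
  exists2 B : R, 0 < B & forall p, N ('valL_ 0 psi p) <= B.
Proof.
move=> cpsi.
have cT : compact [set: S].
  have := compact_subtype (@compact_K0inf R d) (@subset_refl _ _).
  by congr compact; apply/seteqP; split => // -[x xS] _; exact: set_mem xS.
have [B B0 hB] := compact_ccontinuous_bounded cT cpsi.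
exists B => //; apply: valL_bounded; first exact: ltW.
by move=> a; exact: hB.
Qed.

(** The symbol is a uniform limit of step functions on the cells of ever finer nets. *)
Lemma cmeasurable_symbol (psi : S -> R[i]) : ccontinuous psi ->
  cmeasurable setT (symbol psi).
Proof.
move=> cpsi; apply: cmeasurable_unif_lim => e e0.
have [dl dl0 h] := valL_unif (@compact_K0inf R d) cpsi e0.
have [s sn] := exists_net dl0.
exists (fun x => \sum_(l < size s) 'valL_ 0 psi (nth (0, 0%E) s l) * (net_cell s dl l x)%:C%C).
  apply: cmeasurable_sum => l; apply: cmeasurableM; first exact: cmeasurable_cst.
  by apply: cmeasurableR; exact: measurable_net_cell.
apply: net_approx => //; first exact: ltW.
by move=> x y Sx Sy xy; apply/ltW/h.
Qed.

Lemma polarZ (a : R) (x : 'rV[R]_d) : 0 < a ->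
  polar (a *: x) = ((enorm x)^-1 *: x, (a * enorm x)%:E).
Proof.
move=> a0; rewrite /polar enormZ gtr0_norm//; congr pair.
by rewrite invfM scalerA mulrAC mulVf ?mul1r// gt_eqF.
Qed.

Lemma contract_dist_le (s t : R) : 0 <= s -> 0 <= t ->
  `|contract s%:E - contract t%:E| <= `|s - t|.
Proof.
move=> s0 t0; rewrite /contract (ger0_norm s0) (ger0_norm t0).
have s1 : 0 < 1 + s by rewrite ltr_pwDl.
have t1 : 0 < 1 + t by rewrite ltr_pwDl.
have -> : s / (1 + s) - t / (1 + t) = (s - t) / ((1 + s) * (1 + t)).
  by field; rewrite !gt_eqF.
rewrite normrM ler_piMr// normfV gtr0_norm ?mulr_gt0// invf_le1 ?mulr_gt0//.
by rewrite -[leLHS]mul1r ler_pM// lerDl.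
Qed.

Lemma enorm_direction (x a : 'rV[R]_d) : x != 0 -> x - a != 0 ->
  enorm ((enorm x)^-1 *: x - (enorm (x - a))^-1 *: (x - a)) <= 2 * enorm a / enorm x.
Proof.
move=> /enorm_gt0 x0 /enorm_gt0 y0; set y := x - a in y0 *.
have -> : (enorm x)^-1 *: x - (enorm y)^-1 *: y =
    (enorm x)^-1 *: (x - y) + (((enorm y) - enorm x) / (enorm x * enorm y)) *: y.
  have -> : (enorm y - enorm x) / (enorm x * enorm y) = (enorm x)^-1 - (enorm y)^-1.
    by field; rewrite !gt_eqF.
  by apply/rowP => i; rewrite !mxE; ring.
apply: le_trans (enormD _ _) _; rewrite !enormZ.
have -> : x - y = a by rewrite /y opprB addrC subrK.
rewrite gtr0_norm ?invr_gt0// normrM normfV (gtr0_norm (mulr_gt0 x0 y0)).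
have h : `|enorm y - enorm x| <= enorm a.
  by apply: le_trans (enormB_le _ _) _; rewrite /y addrC addKr enormN.
have -> : `|enorm y - enorm x| / (enorm x * enorm y) * enorm y =
   `|enorm y - enorm x| / enorm x by field; rewrite !gt_eqF.
rewrite [_^-1 * _]mulrC -mulrDl ler_wpM2r ?invr_ge0 ?(ltW x0)//; lra.
Qed.

(** In polar form the shift by [a] moves the direction by at most 2 |a| / |xi|, small for large xi,
    and the radius om n |xi| by at most om n |a|, small for large n; psi is uniformly continuous in
    these coordinates. *)
Lemma symbol_slow (psi : S -> R[i]) (om : nat -> R) : ccontinuous psi ->
  (forall n, 0 < om n) -> om @ \oo --> (0 : R) ->
  forall (a : 'rV[R]_d) (e : R), 0 < e -> exists M : R,
    \forall n \near \oo, forall xi, ~ row_box 0 M xi ->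
      N (symbol psi (om n *: xi) - symbol psi (om n *: (xi - a))) <= e.
Proof.
move=> cpsi om0 omc a e e0.
have [dl dl0 h] := valL_unif (@compact_K0inf R d) cpsi e0.
have a0 := enorm_ge0 a.
(* The first term controls the directions; the others keep both [xi] and [xi - a] nonzero. *)
exists (2 * enorm a / dl + enorm a + 1).
have ea : 0 < dl / (enorm a + 1) by rewrite divr_gt0// ltr_wpDl.
move/cvgrPdist_lt : omc => /(_ _ ea); apply: filterS => n.
rewrite sub0r normrN gtr0_norm// => omn xi nxi.
have xiM : 2 * enorm a / dl + enorm a + 1 <= enorm xi.
  rewrite leNgt; apply/negP => lt; apply: nxi => i; rewrite mxE sub0r normrN.
  exact: le_lt_trans (coord_le_enorm xi i) lt.
have q0 : 0 <= 2 * enorm a / dl by rewrite divr_ge0 ?mulr_ge0// ltW.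
have xi0 : 0 < enorm xi by lra.
have xin0 : xi != 0 by apply: contraTneq xi0 => ->; rewrite enorm0 ltxx.
have xian0 : xi - a != 0.
  rewrite subr_eq0; apply: contraTneq xiM => ->; rewrite -ltNge; lra.
have [om1 on0] : 0 < om n /\ om n != 0 by rewrite gt_eqF.
apply/ltW/h; [apply: polar_K0inf; rewrite scaler_eq0 negb_or on0//..|].
rewrite !polarZ//; split => /=.
  rewrite row_ballE// => i; have := coord_le_enorm ((enorm xi)^-1 *: xi -
    (enorm (xi - a))^-1 *: (xi - a)) i.
  rewrite [X in `|X|]mxE [X in _ + X]mxE => /le_lt_trans; apply.
  apply: le_lt_trans (enorm_direction xin0 xian0) _.
  rewrite ltr_pdivrMr// [dl * _]mulrC -ltr_pdivrMr//; apply: lt_le_trans xiM.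
  by rewrite -addrA ltrDl ltr_wpDl.
rewrite /ball/= /ereal_ball.
apply: le_lt_trans (contract_dist_le _ _) _; [by rewrite mulr_ge0 ?enorm_ge0// ltW..|].
rewrite -mulrBr normrM gtr0_norm//.
have h1 : `|enorm xi - enorm (xi - a)| <= enorm a.
  by apply: le_trans (enormB_le _ _) _; rewrite opprB addrC subrK.
apply: (@le_lt_trans _ _ (om n * (enorm a + 1))).
  by rewrite ler_pM2l//; lra.
by rewrite -ltr_pdivlMr// ltr_wpDl.
Qed.

Lemma cmeasurable_symbolZ (psi : S -> R[i]) (a : R) : ccontinuous psi ->
  cmeasurable setT (fun xi : 'rV[R]_d => symbol psi (a *: xi)).
Proof.
move=> cpsi; apply: (cmeasurable_comp (cmeasurable_symbol cpsi)).
apply: measurable_fun_rowP => i; under eq_fun do rewrite mxE.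
by apply: measurable_funM => //; exact: measurable_coord.
Qed.

Lemma admissible_symbol (psi : S -> R[i]) (om : nat -> R) (K : set 'rV[R]_d) :
  compact K -> ccontinuous psi -> (forall n, 0 < om n) -> om @ \oo --> (0 : R) ->
  exists2 B, 0 < B & admissible K (fun n xi => symbol psi (om n *: xi)) B.
Proof.
move=> cK cpsi om0 omc; have [B B0 psiB] := symbol_bounded cpsi.
exists B => //; split => //.
- by move=> n; exact: cmeasurable_symbolZ.
- by move=> n xi; exact: psiB.
- exact: symbol_slow.
Qed.

End symbols.

(** * A compact exhaustion of Omega *)

Section exhaustion.
Context {R : realType} {d : nat}.
Variables (Omega : set 'rV[R]_d).

Definition exhaustion (n : nat) : set 'rV[R]_d :=
  [set x | `|x| <= n.+1%:R /\ forall y, ~ Omega y -> n.+1%:R^-1 <= `|x - y|].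

Lemma exhaustion_subset n : exhaustion n `<=` Omega.
Proof.
move=> x [_ h]; apply: contrapT => /h; rewrite subrr normr0.
by apply/negP; rewrite -ltNge invr_gt0.
Qed.

Lemma compact_exhaustion n : compact (exhaustion n).
Proof.
apply: bounded_closed_compact.
  by exists n.+1%:R; split => // M nM x [xn _]; exact: le_trans xn (ltW nM).
rewrite (_ : exhaustion n = (fun x => `|x|) @^-1` [set t | t <= n.+1%:R] `&`
    \bigcap_(y in ~` Omega) (fun x => `|x - y|) @^-1` [set t | n.+1%:R^-1 <= t]); last first.
  by apply/seteqP; split => x [x1 x2].
apply: closedI.
  by apply: closed_comp => [x _|]; [exact: norm_continuous|exact: closed_le].
apply: closed_bigI => y _; apply: closed_comp => [x _|]; last exact: closed_ge.
apply: continuous_comp; last exact: norm_continuous.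
exact: (@cvgB _ _ _ (nbhs x) _ id (cst y) x y cvg_id (cvg_cst y)).
Qed.

(** The radius is twice the mesh 1 / (n0 + 1), so that any mesh box of level n >= n0 that meets [K]
    lies in the exhaustion sets from n0 on. *)
Lemma exhaustion_absorbs K : open Omega -> compact K -> K `<=` Omega ->
  exists n0, forall n, (n0 <= n)%N -> forall x, K x ->
    ball x (2 / n0.+1%:R : R) `<=` exhaustion n.
Proof.
move=> oO cK KO; have [dl dl0 h] := compact_ball_subset cK oO KO.
have [M [M0 KM]] := compact_row_box cK.
(* M + 2 bounds the points of the balls, whose radius is at most 2. The other term makes the radius
   plus 1 / (n + 1) smaller than [dl], so the balls keep the required distance from the
   complement. *)
pose n0 := (Num.truncn (M + 2) + Num.truncn (4 / dl))%N.
have p0 : 0 < n0.+1%:R :> R by [].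
have h1 : M + 2 < n0.+1%:R.
  apply: lt_le_trans (truncnS_gt _) _; rewrite ler_nat ltnS /n0 leq_addr//.
have h2 : 4 / dl < n0.+1%:R.
  apply: lt_le_trans (truncnS_gt _) _; rewrite ler_nat ltnS /n0 leq_addl//.
have h3 : 4 / n0.+1%:R < dl.
  by rewrite ltr_pdivrMr// mulrC -ltr_pdivrMr.
exists n0 => n n0n x Kx z; rewrite -ball_normE/= => xz.
have nn : n0.+1%:R <= n.+1%:R :> R by rewrite ler_nat.
have q : 2 / n0.+1%:R <= 2 :> R by rewrite ler_pdivrMr// ler_peMr// ler1n.
split.
  have xM : `|x| <= M.
    by apply/row_norm_leP => [|i]; [exact: ltW|have := KM _ Kx i; rewrite mxE sub0r normrN => /ltW].
  have : `|z| <= `|x| + `|x - z| by rewrite -[X in `|X| <= _](subKr x) ler_normB.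
  move/le_trans; apply; apply: le_trans (lerD xM (le_trans (ltW xz) q)) _.
  exact: le_trans (ltW h1) nn.
move=> y nOy; rewrite leNgt; apply/negP => zy; apply: nOy; apply: (h x Kx).
rewrite -ball_normE/=.
have tr : `|x - y| <= `|x - z| + `|z - y| by exact: ler_distD.
have ni : n.+1%:R^-1 <= n0.+1%:R^-1 :> R by rewrite lef_pV2 ?posrE.
have : (n0.+1%:R)^-1 <= 2 / n0.+1%:R :> R by rewrite ler_pMl ?invr_gt0// ler1n.
move: h3; have -> : 4 / n0.+1%:R = 2 / n0.+1%:R + 2 / n0.+1%:R :> R.
  by rewrite -mulrDl; congr (_ / _); rewrite -natrD.
move=> h4 h5; apply: le_lt_trans tr (lt_trans (ltrD xz _) h4).
exact: lt_le_trans zy (le_trans ni h5).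
Qed.

End exhaustion.

(** * Localization of the quadratic form *)

Section qform_symbol.
Context {R : realType} {d : nat}.
Local Notation N := (@Normc.normc R).
Local Notation leb := (@lebesgue_row R d).
Variable (K : set 'rV[R]_d).
Hypothesis cK : compact K.
Implicit Types (p f g : 'rV[R]_d -> R[i]).

Definition bounded_symbol p B := cmeasurable setT p /\ forall x, N (p x) <= B.

Lemma qformZp p B c f g : bounded_symbol p B -> L2on K f -> L2on K g ->
  qform (fun x => c * p x) f g = c * qform p f g.
Proof.
move=> [mp pB] Lf Lg; rewrite !qformE -cintegralZ; last exact: (qform_integrable cK mp pB).
by congr cintegral; apply/funext => xi; rewrite -!mulrA.
Qed.

Lemma qform_sump I (s : seq I) (p : I -> 'rV[R]_d -> R[i]) B f g :
  (forall i, bounded_symbol (p i) B) -> L2on K f -> L2on K g ->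
  qform (fun x => \sum_(i <- s) p i x) f g = \sum_(i <- s) qform (p i) f g.
Proof.
move=> pB Lf Lg; rewrite qformE; under [RHS]eq_bigr do rewrite qformE.
rewrite -cintegral_sum => [|i _]; last first.
  by have [m b] := pB i; exact: (qform_integrable cK m b).
by congr cintegral; apply/funext => xi; rewrite mulr_suml.
Qed.

Lemma qformBp p1 p2 B1 B2 f g : bounded_symbol p1 B1 -> bounded_symbol p2 B2 ->
  L2on K f -> L2on K g ->
  qform (fun x => p1 x - p2 x) f g = qform p1 f g - qform p2 f g.
Proof.
move=> [m1 b1] [m2 b2] Lf Lg; rewrite !qformE -cintegralB.
- by congr cintegral; apply/funext => xi; rewrite mulrBl.
- exact: (qform_integrable cK m1 b1).
- exact: (qform_integrable cK m2 b2).
Qed.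

Lemma qformJ p B f g : bounded_symbol p B -> L2on K f -> L2on K g ->
  (qform p f g)^* = qform (fun x => (p x)^*) g f.
Proof.
move=> [m b] Lf Lg; rewrite !qformE -cintegralJ; last exact: (qform_integrable cK m b).
congr cintegral; apply/funext => xi.
by rewrite !rmorphM/= conjCK mulrA mulrAC -mulrA; congr (_ * _); rewrite mulrC.
Qed.

Lemma L2onM_le f (th : 'rV[R]_d -> R[i]) C dl : L2on K f -> cmeasurable setT th ->
  (forall x, N (th x) <= C) -> 0 <= dl -> (forall x, f x != 0 -> N (th x) <= dl) ->
  L2on K (fun x => th x * f x) /\ nrm2 leb (fun x => th x * f x) <= dl ^+ 2 * nrm2 leb f.
Proof.
move=> Lf mth thC dl0 thd.
have L1 : L2on K (fun x => th x * f x) by exact: (L2onM Lf mth (fun x _ => thC x)).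
split => //; have L2 : L2on K (fun x => dl%:C%C * f x) by exact: L2onZ.
have -> : dl ^+ 2 = N dl%:C%C ^+ 2 by rewrite cmodR ger0_norm.
rewrite -nrm2Z; last by have [] := Lf.
apply: le_nrm2; [by have [] := L1|by have [] := L2|move=> x].
rewrite !cmodM cmodR ger0_norm//.
have [->|/thd h] := eqVneq (f x) 0; first by rewrite cmod0 !mulr0.
by rewrite ler_wpM2r// cmod_ge0.
Qed.

(** Three replacements, of phi1 by [a], phi2 by [b] and psi by psiq, one for each summand of the
    constant. The squared norms on the right make the errors summable over the blocks. *)
Lemma qform_local psi psiq B C dl (phi1 phi2 : 'rV[R]_d -> R[i]) a b F G :
  0 < dl -> bounded_symbol psi B -> bounded_symbol psiq B ->
  (forall x, N (psi x - psiq x) <= dl) ->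
  bounded_symbol phi1 C -> bounded_symbol phi2 C -> N a <= C -> N b <= C ->
  L2on K F -> L2on K G ->
  (forall x, F x != 0 -> N (phi1 x - a) <= dl) ->
  (forall x, G x != 0 -> N (phi2 x - b) <= dl) ->
  N (qform psi (fun x => phi1 x * F x) (fun x => phi2 x * G x) -
     qform (fun x => a * b^* * psiq x) F G) <=
  dl * (B * (1 + C ^+ 2) + B * C + C ^+ 2) * ((nrm2 leb F + nrm2 leb G) / 2).
Proof.
move=> dl0 bpsi bpsiq psid bphi1 bphi2 aC bC LF LG near1 near2.
have [mpsi psiB] := bpsi; have [mpsiq psiqB] := bpsiq.
have [m1 b1] := bphi1; have [m2 b2] := bphi2.
have B0 : 0 <= B := le_trans (cmod_ge0 _) (psiB 0).
have C0 : 0 <= C := le_trans (cmod_ge0 _) aC.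
have nF : 0 <= nrm2 leb F := nrm2_ge0 leb F.
have nG : 0 <= nrm2 leb G := nrm2_ge0 leb G.
have mc c : cmeasurable setT (fun _ : 'rV[R]_d => c : R[i]) := cmeasurable_cst _ c.
have [LG2 nG2] := L2onM_le LG m2 b2 C0 (fun x _ => b2 x).
have bd1 x : N (phi1 x - a) <= C + C by rewrite (le_trans (cmodB _ _))// lerD.
have bd2 x : N (phi2 x - b) <= C + C by rewrite (le_trans (cmodB _ _))// lerD.
have [LF' nF'] := L2onM_le LF (cmeasurableB m1 (mc a)) bd1 (ltW dl0) near1.
have [LG' nG'] := L2onM_le LG (cmeasurableB m2 (mc b)) bd2 (ltW dl0) near2.
have LaF := L2onZ a LF; have LbG := L2onZ b LG.
have e1 : qform psi (fun x => phi1 x * F x) (fun x => phi2 x * G x) =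
    a * qform psi F (fun x => phi2 x * G x) +
    qform psi (fun x => (phi1 x - a) * F x) (fun x => phi2 x * G x).
  rewrite -(qformZl cK _ mpsi psiB)// -(qformDl cK mpsi psiB)//.
  by congr (qform _ _ _); apply/funext => x; rewrite -mulrDl addrC subrK.
have e2 : qform psi F (fun x => phi2 x * G x) =
    b^* * qform psi F G + qform psi F (fun x => (phi2 x - b) * G x).
  rewrite -(qformZr cK _ mpsi psiB)// -(qformDr cK mpsi psiB)//.
  by congr (qform _ _ _); apply/funext => x; rewrite -mulrDl addrC subrK.
have -> : qform psi (fun x => phi1 x * F x) (fun x => phi2 x * G x) -
     qform (fun x => a * b^* * psiq x) F G =
   qform psi (fun x => (phi1 x - a) * F x) (fun x => phi2 x * G x) +
   (a * qform psi F (fun x => (phi2 x - b) * G x) +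
   a * b^* * qform (fun x => psi x - psiq x) F G).
  by rewrite e1 e2 (qformZp _ bpsiq)// (qformBp bpsi bpsiq)//; ring.
(* The weights dl^-1 and dl offset the factor dl^2 in [nF'] and [nG'], leaving bounds linear in
   [dl]. *)
have dli0 : 0 < dl^-1 by rewrite invr_gt0.
have h1 := qform_le cK dli0 mpsi psiB LF' LG2.
have h2 := qform_le cK dl0 mpsi psiB LF LG'.
have h3 := qform_le cK ltr01 (cmeasurableB mpsi mpsiq) psid LF LG.
have q1 : B * ((dl^-1 * nrm2 leb (fun x => (phi1 x - a) * F x) +
    dl^-1^-1 * nrm2 leb (fun x => phi2 x * G x)) / 2) <=
    dl * (B * (1 + C ^+ 2)) * ((nrm2 leb F + nrm2 leb G) / 2).
  rewrite invrK [dl * (B * _)]mulrCA -[leRHS]mulrA ler_wpM2l//.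
  have k1 : dl^-1 * nrm2 leb (fun x => (phi1 x - a) * F x) <= dl * nrm2 leb F.
    by rewrite mulrC ler_pdivrMr// mulrAC -expr2.
  have k2 : dl * nrm2 leb (fun x => phi2 x * G x) <= dl * (C ^+ 2 * nrm2 leb G).
    by rewrite ler_wpM2l// ltW.
  have k3 : 0 <= dl * (C ^+ 2 * nrm2 leb F) by rewrite !mulr_ge0 ?sqr_ge0// ltW.
  have k4 : 0 <= dl * nrm2 leb G by rewrite mulr_ge0// ltW.
  move: k1 k2 k3 k4; move: (dl^-1 * _) (dl * nrm2 _ (fun x => phi2 x * _)).
  move: (nrm2 leb F) (nrm2 leb G) => u v w z k1 k2 k3 k4.
  have -> : dl * (1 + C ^+ 2) * ((u + v) / 2) =
    (dl * u + dl * v + (dl * (C ^+ 2 * u) + dl * (C ^+ 2 * v))) / 2 by field.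
  by rewrite ler_wpM2r//; lra.
have q2 : B * ((dl * nrm2 leb F + dl^-1 * nrm2 leb (fun x => (phi2 x - b) * G x)) / 2) <=
    dl * B * ((nrm2 leb F + nrm2 leb G) / 2).
  rewrite (mulrC dl B) -mulrA ler_wpM2l//.
  have k1 : dl^-1 * nrm2 leb (fun x => (phi2 x - b) * G x) <= dl * nrm2 leb G.
    by rewrite mulrC ler_pdivrMr// mulrAC -expr2.
  move: k1; move: (dl^-1 * _) (nrm2 leb F) (nrm2 leb G) => w u v k1.
  by rewrite mulrA ler_wpM2r// mulrDr lerD2l.
move: h1 h2 h3 q1 q2; rewrite invr1 !mul1r.
move: (qform psi (fun x => (phi1 x - a) * F x) _) => X1.
move: (qform psi F _) (qform (fun x => psi x - psiq x) F G) => X2 X3.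
move: (B * ((dl^-1 * _ + _) / 2)) (B * ((dl * _ + _) / 2)) => Y1 Y2.
move: ((nrm2 leb F + nrm2 leb G) / 2) => W h1 h2 h3 q1 q2.
apply: le_trans (cmodD _ _) _.
have k1 : N X1 <= dl * (B * (1 + C ^+ 2)) * W := le_trans h1 q1.
have k2 : N (a * X2) <= dl * (B * C) * W.
  rewrite cmodM (_ : dl * (B * C) * W = C * (dl * B * W)); last by ring.
  by rewrite ler_pM ?cmod_ge0// (le_trans h2).
have k3 : N (a * b^* * X3) <= dl * C ^+ 2 * W.
  rewrite cmodM cmodM cmodJ (_ : dl * C ^+ 2 * W = (C * C) * (dl * W)); last by ring.
  by rewrite ler_pM ?cmod_ge0 ?mulr_ge0 ?cmod_ge0// ler_pM ?cmod_ge0.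
have := cmodD (a * X2) (a * b^* * X3).
rewrite !mulrDr !mulrDl; move: k1 k2 k3; rewrite !mulrDr !mulrDl.
move: (N _) (N _) (N _) (N _) => A1 A2 A3 A4 *; lra.
Qed.

End qform_symbol.

Section punity_norm.
Context {R : realType} {d : nat}.
Local Notation N := (@Normc.normc R).
Local Notation leb := (@lebesgue_row R d).
Variables (q : seq 'rV[R]_d) (e : R).

Definition cpunity i (x : 'rV[R]_d) : R[i] := (punity q e i x)%:C%C.

Lemma punity_le1 i x : `|punity q e i x| <= 1.
Proof.
rewrite -(ler_pXn2r (n := 2)) ?nnegrE// expr1n real_normK ?num_real//.
apply: le_trans (sum_punity_le1 q e i.+1 x); rewrite big_ord_recr/= lerDr.
by apply: sumr_ge0 => k _; exact: sqr_ge0.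
Qed.

Lemma bounded_cpunity i : bounded_symbol (cpunity i) 1.
Proof.
split; first by apply: cmeasurableR; exact: measurable_punity.
by move=> x; rewrite cmodR punity_le1.
Qed.

Lemma L2fun_cpunity i f : L2fun leb f -> L2fun leb (fun x => cpunity i x * f x).
Proof. by move=> Lf; have [m b] := bounded_cpunity i; exact: L2funZb Lf m b. Qed.

Lemma sum_nrm2_punity m f : L2fun leb f ->
  \sum_(i < m) nrm2 leb (fun x => cpunity i x * f x) <= nrm2 leb f.
Proof.
move=> Lf.
have Lsum : forall m, [/\ leb.-integrable setT (fun x =>
      (\sum_(i < m) N (cpunity i x * f x) ^+ 2)%:E) &
    \int[leb]_x (\sum_(i < m) N (cpunity i x * f x) ^+ 2) =
    \sum_(i < m) nrm2 leb (fun x => cpunity i x * f x)].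
  elim=> [|k [ik ek]].
    split; first by under eq_fun do rewrite big_ord0; exact: integrable0.
    by under eq_Rintegral do rewrite big_ord0; rewrite Rintegral_cst// mul0r big_ord0.
  have [_ Lk] := L2fun_cpunity k Lf.
  split.
    under eq_fun do rewrite big_ord_recr/= EFinD.
    exact: integrableD.
  rewrite [RHS]big_ord_recr/= -ek -RintegralD//.
  by apply: eq_Rintegral => x _; rewrite big_ord_recr.
have [im <-] := Lsum m; have [_ fi] := Lf.
apply: le_Rintegral => // x _.
rewrite (eq_bigr (fun i : 'I_m => punity q e i x ^+ 2 * N (f x) ^+ 2)) => [|i _].
  by rewrite -mulr_suml -[leRHS]mul1r ler_wpM2r ?sqr_ge0// sum_punity_le1.
by rewrite cmodM exprMn cmodR real_normK ?num_real.
Qed.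

End punity_norm.

(** * Ultralimits *)

Section ultralimit.
Context {R : realType}.
Local Notation N := (@Normc.normc R).
Variable U : set_system nat.
Hypothesis UU : UltraFilter U.
Hypothesis Uoo : \oo `<=` U.

Let PU : ProperFilter U. Proof. exact: ultra_proper. Qed.

(** The image of [U] contains a compact segment, and a cluster point of an ultrafilter is a
    limit. *)
Lemma bounded_ultra_cvg (f : nat -> R) M : (\forall n \near U, `|f n| <= M) ->
  exists l : R, f @ U --> l.
Proof.
move=> fM; have FM : (f @ U) `[- M, M]%classic.
  by apply: filterS fM => n; rewrite /= in_itv/= ler_norml.
have [l [_ lc]] := @segment_compact R (- M) M (f @ U) _ FM.
exists l => V lV; have [//|h] := in_ultra_setVsetC (f @^-1` V) UU.
by have [x [/= nVx Vx]] := lc (~` V) V h lV.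
Qed.

Definition ebounded (f : nat -> R[i]) := exists M, \forall n \near \oo, N (f n) <= M.

Definition ulim (f : nat -> R[i]) : R[i] := xget 0 [set l | ccvg U f l].

Lemma ulimP f : ebounded f -> ccvg U f (ulim f).
Proof.
move=> [M /Uoo fM].
have [a ha] : exists l : R, (fun n => complex.Re (f n)) @ U --> l.
  apply: (@bounded_ultra_cvg _ M); apply: filterS fM => n; exact/le_trans/Re_le_cmod.
have [b hb] : exists l : R, (fun n => complex.Im (f n)) @ U --> l.
  apply: (@bounded_ultra_cvg _ M); apply: filterS fM => n; exact/le_trans/Im_le_cmod.
suff h : [set l | ccvg U f l] (a +i* b)%C by exact: (xgetPex 0 (ex_intro _ _ h)).
move=> e e0; have e2 : 0 < e / 2 by rewrite divr_gt0.
move/cvgrPdist_lt : ha => /(_ _ e2) ha; move/cvgrPdist_lt : hb => /(_ _ e2) hb.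
apply: filterS2 ha hb => n; rewrite distrC [X in _ -> X < _ -> _]distrC => h1 h2.
rewrite (le_lt_trans (cmod_le _))// ReD ImD ReN ImN /= (splitr e).
exact: ltrD.
Qed.

Lemma ulimE f l : ccvg U f l -> ulim f = l.
Proof.
move=> fl; apply: (@ccvg_unique R _ U _ f) => //.
exact: (xgetPex 0 (ex_intro _ l fl)).
Qed.

(** The m-th index lies beyond the previous one and in the finite intersection of members of [U] on
    which the first m sequences are within 1 / (m + 1) of their limits; members of [U] are
    nonempty. *)
Lemma diagonal_subseq (c : nat -> nat -> R[i]) (l : nat -> R[i]) :
  (forall t, ccvg U (c^~ t) (l t)) ->
  exists s : nat -> nat, {homo s : m n / (m < n)%N} /\
    forall t, ccvg \oo (fun m => c (s m) t) (l t).
Proof.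
move=> cl.
have step (mp : nat * nat) : exists n, (mp.2 < n)%N /\
    forall t, (t < mp.1)%N -> N (c n t - l t) < mp.1.+1%:R^-1.
  case: mp => m p /=.
  have e0 : 0 < m.+1%:R^-1 :> R by rewrite invr_gt0.
  have h : \forall n \near U, forall t, (t < m)%N -> N (c n t - l t) < m.+1%:R^-1.
    elim: {1 3}m => [|k ih]; first exact: nearW.
    apply: filterS2 ih (cl k _ e0) => n h1 h2 t; rewrite ltnS leq_eqVlt.
    by case/orP => [/eqP ->//|/h1].
  have hp : \forall n \near U, (p < n)%N by apply: Uoo; exists p.+1.
  have [n [h1 h2]] := filter_ex (filterI hp h); by exists n.
have {step} [nx nxP] := choice step.
pose s := fix s m := if m is m'.+1 then nx (m'.+1, s m') else nx (0%N, 0%N).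
have sS m : (s m < s m.+1)%N by have [] := nxP (m.+1, s m).
have sP m t : (t < m)%N -> N (c (s m) t - l t) < m.+1%:R^-1.
  by case: m => // m; have [_ /(_ t)] := nxP (m.+1, s m).
exists s; split.
  by apply: homo_ltn => //; exact: ltn_trans.
move=> t e e0; have := near_infty_natSinv_lt (PosNum e0).
have tm : \forall m \near \oo, (t < m)%N by exists t.+1.
apply: filterS2 tm => m tm /= me; exact: lt_trans (sP _ _ tm) me.
Qed.

End ultralimit.

Lemma exists_ultra_infty : exists2 U : set_system nat, UltraFilter U & \oo `<=` U.
Proof. by have [U [UU sU]] := ultraFilterLemma eventually_filter; exists U. Qed.

Lemma strict_homo_ge (s : nat -> nat) : {homo s : m n / (m < n)%N} ->
  forall m, (m <= s m)%N.
Proof. by move=> hs; elim=> // m ih; exact: leq_ltn_trans ih (hs _ _ (ltnSn m)). Qed.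

(** * Discrete approximations *)

Lemma conjR (R : realType) (t : R) : (t%:C%C : R[i])^* = t%:C%C.
Proof. by apply: complex_ext; rewrite ?ReJ ?ImJ /= ?oppr0. Qed.

Section approximants.
Context {R : realType} {d r : nat}.
Local Notation N := (@Normc.normc R).
Local Notation leb := (@lebesgue_row R d).
Variables (Omega : set 'rV[R]_d) (u : nat -> 'rV[R]_d -> 'cV[R[i]]_r).
Variable omega : nat -> R.
Hypothesis Omega_open : open Omega.
Hypothesis u_weak : weakly_null_L2loc Omega u.
Hypothesis omega_gt0 : forall n, 0 < omega n.
Hypothesis omega_cvg : omega @ \oo --> (0 : R).
Implicit Types (m n i l : nat) (j k : 'I_r).

(** The radius of both the boxes in space and the cells in frequency. *)
Definition mesh m : R := m.+1%:R^-1.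

Lemma mesh_gt0 m : 0 < mesh m. Proof. by rewrite invr_gt0. Qed.

Variable q : nat -> seq 'rV[R]_d.
Hypothesis q_cover : forall m x, exhaustion Omega m x ->
  exists2 p, p \in q m & ball p (mesh m / 2) x.
Variable s : nat -> seq ('rV[R]_d * \bar R).
Hypothesis s_net : forall m, is_net (s m) (mesh m).

Definition block m n i j (x : 'rV[R]_d) : R[i] :=
  cpunity (q m) (mesh m) i x * local_seq u (exhaustion Omega m) j n x.

Definition cell m n l (xi : 'rV[R]_d) : R[i] :=
  (net_cell (s m) (mesh m) l (omega n *: xi))%:C%C.

Definition coef m i l j k n : R[i] :=
  qform (cell m n l) (block m n i j) (block m n i k).

(** The integral of [f] against the m-th discrete measure, before the limit in [n]. *)
Definition apx m (f : 'rV[R]_d -> 'rV[R]_d * \bar R -> R[i]) j k n : R[i] :=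
  \sum_(i < size (q m)) \sum_(l < size (s m))
    f (nth 0 (q m) i) (nth (0, 0%E) (s m) l) * coef m i l j k n.

Local Notation cE m := (@compact_exhaustion R d Omega m).
Local Notation sE m := (@exhaustion_subset R d Omega m).

Lemma L2on_exhaustion m j n :
  L2on (exhaustion Omega m) (local_seq u (exhaustion Omega m) j n).
Proof. exact: (L2on_local_seq u_weak (cE m) (sE m)). Qed.

Lemma L2on_block m n i j : L2on (exhaustion Omega m) (block m n i j).
Proof.
have [mt bt] := bounded_cpunity (q m) (mesh m) i.
exact: (L2onM (L2on_exhaustion m j n) mt (fun x _ => bt x)).
Qed.

Lemma measurable_row_scale (a : R) :
  measurable_fun setT (fun xi : 'rV[R]_d => a *: xi).
Proof.
apply: measurable_fun_rowP => i; under eq_fun do rewrite mxE.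
by apply: measurable_funM => //; exact: measurable_coord.
Qed.

Lemma bounded_cell_sum m n (c : nat -> R[i]) B : (forall l, N (c l) <= B) ->
  bounded_symbol (fun xi => \sum_(l < size (s m)) c l * cell m n l xi) B.
Proof.
move=> cB; split.
  apply: cmeasurable_sum => l; apply: cmeasurableM; first exact: cmeasurable_cst.
  apply: cmeasurableR; apply: (measurableT_comp (measurable_net_cell _ _ _)).
  exact: measurable_row_scale.
by move=> xi; exact: net_sum_bounded.
Qed.

Lemma bounded_cell m n l : bounded_symbol (cell m n l) 1.
Proof.
split.
  apply: cmeasurableR; apply: (measurableT_comp (measurable_net_cell _ _ _)).
  exact: measurable_row_scale.
move=> xi; rewrite cmodR ger0_norm ?net_cell_ge0//.
apply: le_trans (sum_net_cell_le1 (s m) (mesh m) l.+1 (omega n *: xi)).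
by rewrite big_ord_recr/= lerDr; apply: sumr_ge0 => t _; exact: net_cell_ge0.
Qed.

Lemma apxE m f B j k n : (forall x p, N (f x p) <= B) ->
  apx m f j k n = \sum_(i < size (q m)) qform
    (fun xi => \sum_(l < size (s m)) f (nth 0 (q m) i) (nth (0, 0%E) (s m) l) * cell m n l xi)
    (block m n i j) (block m n i k).
Proof.
move=> fB; apply: eq_bigr => i _.
have Lj := L2on_block m n i j; have Lk := L2on_block m n i k.
rewrite (@qform_sump _ _ _ (cE m) _ _ _ B)//.
  by apply: eq_bigr => l _; rewrite (qformZp (cE m) _ (bounded_cell m n l)).
move=> l; have [mc bc] := bounded_cell m n l; split.
  by apply: cmeasurableM => //; exact: cmeasurable_cst.
by move=> x; rewrite cmodM -[leRHS]mulr1 ler_pM ?cmod_ge0.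
Qed.

Lemma block_eq m m0 n i j : row_box (nth 0 (q m) i) (mesh m) `<=` exhaustion Omega m0 ->
  row_box (nth 0 (q m) i) (mesh m) `<=` exhaustion Omega m ->
  block m n i j = fun x => cpunity (q m) (mesh m) i x *
    local_seq u (exhaustion Omega m0) j n x.
Proof.
move=> h0 h; apply/funext => x; rewrite /block.
have [p0|] := eqVneq (punity (q m) (mesh m) i x) 0.
  by rewrite /cpunity p0 !mul0r.
move=> /(punity_supp (mesh_gt0 m)) bx; congr (_ * _); rewrite /local_seq.
by rewrite !crestrictT//; [exact: h0|exact: h].
Qed.

(** On such a box the block may be cut out of the local sequence of the fixed level [m0], whose
    norms are bounded independently of [m]. *)
Definition absorbed m m0 i :=
  row_box (nth 0 (q m) i) (mesh m) `<=` exhaustion Omega m0 /\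
  row_box (nth 0 (q m) i) (mesh m) `<=` exhaustion Omega m.

Lemma sum_block_norm m m0 n j k (P : pred 'I_(size (q m))) (c : R) :
  0 <= c -> (forall i : 'I_(size (q m)), P i -> absorbed m m0 i) ->
  \sum_(i < size (q m) | P i) c *
      ((nrm2 leb (block m n i j) + nrm2 leb (block m n i k)) / 2) <=
  c * ((nrm2 leb (local_seq u (exhaustion Omega m0) j n) +
        nrm2 leb (local_seq u (exhaustion Omega m0) k n)) / 2).
Proof.
move=> c0 hP; rewrite -mulr_sumr ler_wpM2l// -mulr_suml ler_wpM2r// big_split/=.
have h j' : \sum_(i < size (q m) | P i) nrm2 leb (block m n i j') <=
    nrm2 leb (local_seq u (exhaustion Omega m0) j' n).
  have [L _] := L2on_exhaustion m0 j' n.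
  apply: le_trans (sum_nrm2_punity (q m) (mesh m) (size (q m)) L).
  rewrite [leRHS](bigID P)/= -[leLHS]addr0 lerD//.
    apply: ler_sum => i /hP[h1 h2]; rewrite (block_eq _ _ h1 h2)//.
  by apply: sumr_ge0 => i _; exact: nrm2_ge0.
by rewrite lerD.
Qed.

Lemma apx_le m m0 f B j k n : (forall x p, N (f x p) <= B) ->
  (forall i, (i < size (q m))%N -> (exists p, f (nth 0 (q m) i) p != 0) ->
     absorbed m m0 i) ->
  N (apx m f j k n) <= B * ((nrm2 leb (local_seq u (exhaustion Omega m0) j n) +
        nrm2 leb (local_seq u (exhaustion Omega m0) k n)) / 2).
Proof.
move=> fB habs; have B0 : 0 <= B := le_trans (cmod_ge0 _) (fB 0 (0, 0%E)).
rewrite (apxE _ _ _ _ fB).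
pose P (i : 'I_(size (q m))) := `[< exists p, f (nth 0 (q m) i) p != 0 >].
apply: le_trans (cmod_sum _ _ _) _; rewrite (bigID P)/=.
rewrite [X in _ + X]big1 ?addr0 => [|i /asboolPn nP]; last first.
  rewrite qformE (_ : (fun xi => _) = (fun=> 0)) ?cintegral0 ?cmod0//.
  apply/funext => xi; rewrite big1 ?mul0r// => l _.
  have [->|fn0] := eqVneq (f (nth 0 (q m) i) (nth (0, 0%E) (s m) l)) 0.
    by rewrite mul0r.
  by exfalso; apply: nP; exists (nth (0, 0%E) (s m) l).
apply: le_trans (sum_block_norm n j k B0 (P := P) (m0 := m0) _); last first.
  by move=> i /asboolP; exact: habs.
apply: ler_sum => i _.
have [mc bc] := bounded_cell_sum m n (fun l => fB (nth 0 (q m) i) (nth (0, 0%E) (s m) l)).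
have := qform_le (cE m) ltr01 mc bc (L2on_block m n i j) (L2on_block m n i k).
by rewrite invr1 !mul1r.
Qed.

Lemma coef_ebounded m i l j k : ebounded (coef m i l j k).
Proof.
have [M1 h1] := local_seq_bounded Omega_open u_weak (cE m) (sE m) j.
have [M2 h2] := local_seq_bounded Omega_open u_weak (cE m) (sE m) k.
exists ((M1 + M2) / 2); apply: nearW => n.
have [mc bc] := bounded_cell m n l.
have := qform_le (cE m) ltr01 mc bc (L2on_block m n i j) (L2on_block m n i k).
rewrite invr1 !mul1r => /le_trans; apply; rewrite ler_wpM2r//.
have le1 j' : nrm2 leb (block m n i j') <= nrm2 leb (local_seq u (exhaustion Omega m) j' n).
  have [mt bt] := bounded_cpunity (q m) (mesh m) i.
  by have := nrm2onM (L2on_exhaustion m j' n) mt (fun x _ => bt x); rewrite expr1n mul1r.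
by rewrite lerD// (le_trans (le1 _)).
Qed.

Definition tame (phi : 'rV[R]_d -> R[i]) (K : set 'rV[R]_d) (C : R) :=
  [/\ bounded_symbol phi C, forall x, ~ K x -> phi x = 0 &
    forall e : R, 0 < e -> exists2 dl : R, 0 < dl &
      forall x y, ball x dl y -> N (phi x - phi y) < e].

Section main_approximation.
Variables (phi1 phi2 : 'rV[R]_d -> R[i]) (K1 : set 'rV[R]_d) (C : R).
Hypothesis cK1 : compact K1.
Hypothesis K1O : K1 `<=` Omega.
Hypothesis tame1 : tame phi1 K1 C.
Hypothesis tame2 : tame phi2 K1 C.
Variable psi : @K0inf R d -> R[i].
Hypothesis psi_cont : ccontinuous psi.
Variables j k : 'I_r.

Let psin n (xi : 'rV[R]_d) := symbol psi (omega n *: xi).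
Let v m j n := local_seq u (exhaustion Omega m) j n.

Definition limit_form n : R[i] :=
  qform (psin n) (fun x => phi1 x * u n x j 0) (fun x => phi2 x * u n x k 0).

Lemma limit_form_local m n : K1 `<=` exhaustion Omega m ->
  limit_form n = qform (psin n) (fun x => phi1 x * v m j n x) (fun x => phi2 x * v m k n x).
Proof.
move=> K1m; have [_ s1 _] := tame1; have [_ s2 _] := tame2.
congr (qform _ _ _); apply/funext => x.
- have [K1x|/s1 ->] := pselect (K1 x); last by rewrite !mul0r.
  by rewrite /v /local_seq crestrictT//; exact: K1m.
- have [K1x|/s2 ->] := pselect (K1 x); last by rewrite !mul0r.
  by rewrite /v /local_seq crestrictT//; exact: K1m.
Qed.

(** One factor of each theta_i^2 crosses to the second argument. The symbol is still the continuous
    psi, to which [symbol_slow] applies. *)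
Lemma local_form_split m :
  ccvg \oo (fun n => qform (psin n) (fun x => phi1 x * v m j n x) (fun x => phi2 x * v m k n x) -
    \sum_(i < size (q m)) qform (psin n) (fun x => phi1 x * block m n i j x)
       (fun x => phi2 x * block m n i k x)) 0.
Proof.
have [[m1 b1] _ _] := tame1; have [[m2 b2] _ _] := tame2.
have cKm := cE m; have KmO := sE m.
have wj := wnullM cKm (wnull_local_seq Omega_open u_weak cKm KmO j) m1 (fun x _ => b1 x).
have wk := wnullM cKm (wnull_local_seq Omega_open u_weak cKm KmO k) m2 (fun x _ => b2 x).
have [B B0 adm] := admissible_symbol cKm psi_cont omega_gt0 omega_cvg.
have [_ mpsi psiB _] := adm.
(* The commutator for theta_i. Its first terms carry theta_i^2 on the left and sum to the undivided
   form. *)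
pose T n (i : 'I_(size (q m))) :=
  qform (psin n) (fun x => cpunity (q m) (mesh m) i x * (phi1 x * block m n i j x))
       (fun x => phi2 x * v m k n x) -
  qform (psin n) (fun x => phi1 x * block m n i j x) (fun x => phi2 x * block m n i k x).
have hT (i : 'I_(size (q m))) : ccvg \oo (T ^~ i) 0.
  have [mt bt] := bounded_cpunity (q m) (mesh m) i.
  have wf := wnullM cKm wj mt (fun x _ => bt x).
  have [_ _ /(_ _ _ wf wk)] := rcommutes_punity (q m) (mesh m) i adm.
  congr (ccvg _ _ _); apply/funext => n; rewrite /T.
  congr (_ - _); first congr (qform _ _ _).
    by apply/funext => x; rewrite /block [cpunity _ _ _ _ * (_ * _)]mulrCA.
  congr (qform _ _ _); apply/funext => x.
    by rewrite /block mulrCA.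
  by rewrite conjR /block mulrCA.
have := @ccvg_sum R nat \oo eventually_filter _ (index_enum 'I_(size (q m))) xpredT
  (fun (i : 'I_(size (q m))) n => T n i) (fun=> 0) (fun t _ => hT t).
rewrite big1//; congr (ccvg _ _ _); apply/funext => n.
rewrite sumrB; congr (_ - _).
have [Lk _ _] := wk; have [Lj _ _] := wj.
have mt i : cmeasurable setT (cpunity (q m) (mesh m) i) by have [] := bounded_cpunity (q m) (mesh m) i.
have bt i x : exhaustion Omega m x -> N (cpunity (q m) (mesh m) i x) <= 1.
  by move=> _; have [_] := bounded_cpunity (q m) (mesh m) i.
have LT i : L2on (exhaustion Omega m) (fun x => cpunity (q m) (mesh m) i x * (phi1 x * block m n i j x)).
  apply: L2onM (mt i) (bt i); apply: (L2onM _ m1 (fun x _ => b1 x)).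
  exact: L2on_block.
have suml (J : seq 'I_(size (q m))) : L2on (exhaustion Omega m)
    (fun x => \sum_(i <- J) cpunity (q m) (mesh m) i x * (phi1 x * block m n i j x)) /\
    \sum_(i <- J) qform (psin n) (fun x => cpunity (q m) (mesh m) i x * (phi1 x * block m n i j x))
       (fun x => phi2 x * v m k n x) = qform (psin n)
     (fun x => \sum_(i <- J) cpunity (q m) (mesh m) i x * (phi1 x * block m n i j x))
     (fun x => phi2 x * v m k n x).
  elim: J => [|i J [ih1 ih2]].
    rewrite big_nil; split.
      under eq_fun do rewrite big_nil; split => //; exact: L2fun0.
    rewrite [X in _ = qform _ X _](_ : _ = fun x => 0 * (phi1 x * v m j n x)).
      by rewrite (qformZl cKm 0 (mpsi n) (psiB n) (Lj n) (Lk n)) mul0r.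
    by apply/funext => x; rewrite big_nil mul0r.
  rewrite big_cons ih2; split.
    by under eq_fun do rewrite big_cons; exact: L2onD.
  rewrite -(qformDl cKm (mpsi n) (psiB n) (LT i) ih1 (Lk n)).
  by congr (qform _ _ _); apply/funext => x; rewrite big_cons.
have [_ ->] := suml (index_enum 'I_(size (q m))).
congr (qform _ _ _); apply/funext => x.
have [Ex|nEx] := pselect (exhaustion Omega m x); last first.
  rewrite big1 => [|i _]; last by rewrite /block /local_seq crestrictN// !mulr0.
  by rewrite /v /local_seq crestrictN// mulr0.
(* The nodes cover at half the mesh, where a cutoff equals 1, so the squares sum to 1 on the whole
   exhaustion set. *)
have := @sum_punity1 R d (q m) (mesh m) x (mesh_gt0 m).
have [p pq px] := q_cover Ex.
have bx : row_box p (mesh m / 2) x by rewrite -row_ballE// divr_gt0// mesh_gt0.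
move=> /(_ (ex_intro2 _ _ p pq bx)) s1.
rewrite (eq_bigr (fun i : 'I_(size (q m)) => (punity (q m) (mesh m) i x ^+ 2)%:C%C * (phi1 x * v m j n x))).
  by rewrite -mulr_suml -rmorph_sum/= s1 mul1r.
move=> i _; rewrite /block /cpunity /v.
have -> : (punity (q m) (mesh m) i x ^+ 2)%:C%C =
    (punity (q m) (mesh m) i x)%:C%C * (punity (q m) (mesh m) i x)%:C%C :> R[i].
  by rewrite expr2 rmorphM.
by move: (_%:C%C) (local_seq _ _ _ _ _) => a b; ring.
Qed.

(** The order of the choices matters: [dl] from e, then a mesh below the moduli of continuity at
    [dl], and last [n] so large that the form has split into blocks at that mesh. *)
Lemma main_approximation (e : R) : 0 < e -> exists m1, forall m, (m1 <= m)%N ->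
  \forall n \near \oo, N (limit_form n -
    apx m (fun x p => phi1 x * (phi2 x)^* * 'valL_ 0 psi p) j k n) <= e.
Proof.
move=> e0; have [bphi1 s1 unif1] := tame1; have [bphi2 s2 unif2] := tame2.
have C0 : 0 <= C by have [_ b] := bphi1; exact: le_trans (cmod_ge0 _) (b 0).
have [B B0 psiB] := symbol_bounded psi_cont.
(* The norms are taken at the fixed level [n0]: [dl] depends on them and is chosen before [m]. *)
have [n0 absorb] := exhaustion_absorbs Omega_open cK1 K1O.
have [M1 hM1] := local_seq_bounded Omega_open u_weak (cE n0) (sE n0) j.
have [M2 hM2] := local_seq_bounded Omega_open u_weak (cE n0) (sE n0) k.
pose M := (M1 + M2) / 2.
have M0 : 0 <= M.
  rewrite divr_ge0// addr_ge0//.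
    exact: le_trans (nrm2_ge0 _ _) (hM1 0%N).
  exact: le_trans (nrm2_ge0 _ _) (hM2 0%N).
pose CC := B * (1 + C ^+ 2) + B * C + C ^+ 2.
have CC0 : 0 <= CC.
  by rewrite !addr_ge0 ?mulr_ge0 ?addr_ge0 ?sqr_ge0// ltW.
pose dl := e / (2 * (CC * M + 1)).
have p0 : 0 < CC * M + 1 by rewrite ltr_wpDl// mulr_ge0.
have dl0 : 0 < dl by rewrite divr_gt0// mulr_gt0.
have dlCM : dl * CC * M <= e / 2.
  rewrite -mulrA; apply: (@le_trans _ _ (dl * (CC * M + 1))).
    by rewrite ler_wpM2l ?(ltW dl0)// lerDl.
  rewrite /dl le_eqVlt; apply/orP; left; apply/eqP; field.
  by rewrite gt_eqF.
have [d1 d10 h1] := unif1 _ dl0; have [d2 d20 h2] := unif2 _ dl0.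
have [d3 d30 h3] := valL_unif (@compact_K0inf R d) psi_cont dl0.
have near_mesh t : 0 < t -> \forall m \near \oo, mesh m < t.
  by move=> t0; exact: (near_infty_natSinv_lt (PosNum t0)).
have [m1 _ hm1] := filterI (near_mesh _ d10) (filterI (near_mesh _ d20) (near_mesh _ d30)).
exists (maxn n0 m1) => m; rewrite geq_max => /andP[n0m m1m].
have [em1 [em2 em3]] := hm1 _ m1m.
have K1m : K1 `<=` exhaustion Omega m.
  by move=> x Kx; apply: (absorb m n0m x Kx); exact: ballxx.
have habs i x : row_box (nth 0 (q m) i) (mesh m) x -> K1 x -> absorbed m n0 i.
  move=> bx Kx.
  have sub : row_box (nth 0 (q m) i) (mesh m) `<=` ball x (2 / n0.+1%:R : R).
    move=> y by_; have mn : mesh m <= n0.+1%:R^-1 by rewrite lef_pV2 ?posrE// ler_nat.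
    have m0 := mesh_gt0 m.
    have : ball x (mesh m + mesh m) y.
      apply: (@ball_triangle _ _ (nth 0 (q m) i)); first by apply: ball_sym; rewrite row_ballE.
      by rewrite row_ballE.
    by apply: le_ball; rewrite mulr_natl mulr2n lerD.
  by split => y /sub; exact: absorb.
have e2 : 0 < e / 2 by rewrite divr_gt0.
have := local_form_split m e2; apply: filterS => n; rewrite subr0.
rewrite (limit_form_local n K1m).
move: (qform _ _ _) => Q; set S := \sum_(i < _) _ => QS.
pose f x p := phi1 x * (phi2 x)^* * 'valL_ 0 psi p.
rewrite (_ : Q - _ = (Q - S) + (S - apx m f j k n)); last by ring.
rewrite (le_trans (cmodD _ _))// (splitr e) lerD//; first exact: ltW.
apply: le_trans dlCM.
have fB x p : N (phi1 x * (phi2 x)^* * 'valL_ 0 psi p) <= C * C * B.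
  have [_ b1] := bphi1; have [_ b2] := bphi2.
  by rewrite !cmodM cmodJ ler_pM ?mulr_ge0 ?cmod_ge0// ler_pM ?cmod_ge0.
rewrite (apxE _ _ _ _ fB) /S -sumrB.
apply: le_trans (cmod_sum _ _ _) _.
(* A box that misses [K1] contributes 0 to both sums: phi1 vanishes on the block and at the node,
   the centre of the box. The other boxes are absorbed at level [n0]. *)
pose P (i : 'I_(size (q m))) := `[< exists2 x, row_box (nth 0 (q m) i) (mesh m) x & K1 x >].
rewrite (bigID P)/= [X in _ + X]big1 ?addr0 => [|i /asboolPn nP]; last first.
  have off x : row_box (nth 0 (q m) i) (mesh m) x -> phi1 x = 0.
    by move=> bx; apply: s1 => K1x; apply: nP; exists x.
  rewrite [X in X - _](_ : _ = 0) ?sub0r.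
    rewrite qformE (_ : (fun xi => _) = (fun=> 0)) ?cintegral0 ?oppr0 ?cmod0//.
    apply/funext => xi; rewrite big1 ?mul0r// => l _.
    rewrite off ?mul0r// => i'; rewrite subrr normr0; exact: mesh_gt0.
  rewrite qformE (_ : (fun xi => _) = (fun=> 0)) ?cintegral0//.
  apply/funext => xi; rewrite (_ : (fun x => _) = (fun=> 0)).
    rewrite (_ : hat _ xi = 0) ?mul0r ?mulr0//.
    by rewrite /hat; under eq_fun do rewrite mulr0; exact: cintegral0.
  apply/funext => x; have [pn|/(punity_supp (mesh_gt0 m)) bx] := eqVneq (punity (q m) (mesh m) i x) 0.
    by rewrite /block /cpunity pn mul0r mulr0.
  by rewrite off// mul0r.
have CM : dl * CC * ((nrm2 leb (v n0 j n) + nrm2 leb (v n0 k n)) / 2) <= dl * CC * M.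
  apply: ler_wpM2l; first by rewrite mulr_ge0// ltW.
  by rewrite /M ler_wpM2r//; exact: lerD (hM1 n) (hM2 n).
apply: le_trans CM.
have dC0 : 0 <= dl * CC by rewrite mulr_ge0// ltW.
apply: le_trans (sum_block_norm n j k dC0 (P := P) (m0 := n0) _); last first.
  by move=> i /asboolP[x bx Kx]; exact: habs bx Kx.
apply: ler_sum => i _.
pose psiq xi := \sum_(l < size (s m)) 'valL_ 0 psi (nth (0, 0%E) (s m) l) * cell m n l xi.
rewrite [X in _ - qform X _ _](_ : _ = fun xi => phi1 (nth 0 (q m) i) *
    (phi2 (nth 0 (q m) i))^* * psiq xi); last first.
  by apply/funext => xi; rewrite /psiq mulr_sumr; apply: eq_bigr => l _; rewrite mulrA.
have bpsi : bounded_symbol (psin n) B.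
  by split; [exact: cmeasurable_symbolZ|move=> x; exact: psiB].
have bpsiq : bounded_symbol psiq B :=
  bounded_cell_sum m n (fun l => psiB (nth (0, 0%E) (s m) l)).
have near_box phi : (forall x y, ball x (mesh m) y -> N (phi x - phi y) < dl) ->
    forall j' x, block m n i j' x != 0 -> N (phi x - phi (nth 0 (q m) i)) <= dl.
  move=> h j' x bn0; rewrite cmodBC; apply/ltW/h; rewrite row_ballE; last exact: mesh_gt0.
  apply: (punity_supp (mesh_gt0 m)); apply: contraNneq bn0 => pn.
  by rewrite /block /cpunity pn mul0r.
apply: (qform_local (cE m) dl0 bpsi bpsiq _ bphi1 bphi2).
- move=> xi; apply: (net_approx (mesh_gt0 m) (s_net m) (ltW dl0)) => x y Sx Sy xy.
  by apply/ltW/h3 => //; apply: le_ball xy; exact: ltW.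
- by have [_] := bphi1.
- by have [_] := bphi2.
- exact: L2on_block.
- exact: L2on_block.
- by apply: near_box => x y xy; apply: h1; apply: le_ball xy; exact: ltW.
- by apply: near_box => x y xy; apply: h2; apply: le_ball xy; exact: ltW.
Qed.

End main_approximation.
End approximants.

(** * The limit measure *)

Section positivity.
Context {R : realType}.
Local Notation N := (@Normc.normc R).

Lemma ge0_complexP (z : R[i]) : 0 <= z <-> complex.Im z = 0 /\ 0 <= complex.Re z.
Proof.
case: z => a b; rewrite lecE /=; split => [/andP[/eqP -> ->//]|[-> ->]].
by rewrite eqxx.
Qed.

Lemma ccvg_ge0 (T : Type) (F : set_system T) (FF : ProperFilter F) (f : T -> R[i]) l :
  ccvg F f l -> (forall x, 0 <= f x) -> 0 <= l.
Proof.
move=> fl f0; apply/ge0_complexP; split.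
  apply/eqP; rewrite -normr_le0; apply/ler_addgt0Pl => e e0; rewrite addr0.
  have [x hx] := filter_ex (fl _ e0); have [/ge0_complexP[i0 _]] := f0 x.
  have := Im_le_cmod (f x - l); rewrite ImD ImN i0 sub0r normrN => h.
  exact: le_trans h (ltW hx).
rewrite leNgt; apply/negP => l0; have nl0 : 0 < - complex.Re l by rewrite oppr_gt0.
have [x hx] := filter_ex (fl _ nl0); have [/ge0_complexP[_ r0]] := f0 x.
have := Re_le_cmod (f x - l); rewrite ReD ReN => h.
have := le_lt_trans (le_trans (ler_norm _) h) hx.
by rewrite gtrDr ltNge r0.
Qed.

Lemma ccvg_cmod_le (T : Type) (F : set_system T) (FF : ProperFilter F) (f : T -> R[i]) l M :
  ccvg F f l -> (\forall x \near F, N (f x) <= M) -> N l <= M.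
Proof.
move=> fl fM; apply/ler_addgt0Pr => e e0.
have [x [xM xl]] := filter_ex (filterI fM (fl _ e0)).
rewrite -[l](subKr (f x)) (le_trans (cmodB _ _))//.
by rewrite lerD// ltW.
Qed.

Lemma cintegral_ge0 d (T : measurableType d) (mu : {measure set T -> \bar R})
    (f : T -> R[i]) : (forall x, 0 <= f x) -> 0 <= cintegral mu setT f.
Proof.
move=> f0; apply/ge0_complexP; rewrite /cintegral /=; split.
  under eq_Rintegral => x _ do rewrite (proj1 ((ge0_complexP _).1 (f0 x))).
  by rewrite Rintegral_cst// mul0r.
by apply: Rintegral_ge0 => x _; have /ge0_complexP[] := f0 x.
Qed.

End positivity.

Section extension_product.
Context {R : realType} {T1 T2 : Type}.
Variables (A : set T1) (B : set T2).

Definition extend (f : A * B -> R[i]) (x : T1) (p : T2) : R[i] :=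
  'valL_ 0 (fun a : A => 'valL_ 0 (fun b : B => f (a, b)) p) x.

(** The point (a, b) is chosen before [f], so that one case distinction serves identities between
    several functions. *)
Lemma extendP (x : T1) (p : T2) :
  (exists (a : A) (b : B), [/\ set_val a = x, set_val b = p &
     forall f, extend f x p = f (a, b)]) \/
  (~ (A x /\ B p) /\ forall f, extend f x p = 0).
Proof.
have [[Ax Bp]|nAB] := pselect (A x /\ B p).
  left; exists (exist _ x (mem_set Ax)), (exist _ p (mem_set Bp)); split => // f.
  by rewrite /extend (valL_inE _ (mem_set Ax)) (valL_inE _ (mem_set Bp)).
right; split => // f; rewrite /extend.
have [Ax|nAx] := pselect (A x); last by rewrite valL_out.
by rewrite (valL_inE _ (mem_set Ax)) valL_out// => Bp; apply: nAB.
Qed.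

End extension_product.

Section limit_measure.
Context {R : realType} {d r : nat}.
Local Notation N := (@Normc.normc R).
Local Notation leb := (@lebesgue_row R d).
Local Notation S := (@K0inf R d).
Variables (Omega : set 'rV[R]_d) (u : nat -> 'rV[R]_d -> 'cV[R[i]]_r).
Variable omega : nat -> R.
Hypothesis Omega_open : open Omega.
Hypothesis u_weak : weakly_null_L2loc Omega u.
Hypothesis omega_gt0 : forall n, 0 < omega n.
Hypothesis omega_cvg : omega @ \oo --> (0 : R).
Variable q : nat -> seq 'rV[R]_d.
Hypothesis q_cover : forall m x, exhaustion Omega m x ->
  exists2 p, p \in q m & ball p (mesh m / 2 : R) x.
Variable s : nat -> seq ('rV[R]_d * \bar R).
Hypothesis s_net : forall m, is_net (s m) (mesh m).
Variable U : set_system nat.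
Hypothesis UU : UltraFilter U.
Hypothesis Uoo : \oo `<=` U.

Let PU : ProperFilter U. Proof. exact: ultra_proper. Qed.
Let FU : Filter U. Proof. typeclasses eauto. Qed.

Local Notation cf := (coef Omega u omega q s).
Local Notation ax := (apx Omega u omega q s).

Definition coef_lim m i l (j k : 'I_r) : R[i] := ulim U (cf m i l j k).

Definition apx_lim m (f : 'rV[R]_d -> 'rV[R]_d * \bar R -> R[i]) (j k : 'I_r) : R[i] :=
  \sum_(i < size (q m)) \sum_(l < size (s m))
    f (nth 0 (q m) i) (nth (0, 0%E) (s m) l) * coef_lim m i l j k.

Lemma coef_ulim m i l j k : ccvg U (cf m i l j k) (coef_lim m i l j k).
Proof. exact: (ulimP UU Uoo (coef_ebounded omega Omega_open u_weak q s m i l j k)). Qed.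

Lemma apx_ccvg (F : set_system nat) (t : nat -> nat) m f j k : Filter F ->
  (forall i l, ccvg F (fun n => cf m i l j k (t n)) (coef_lim m i l j k)) ->
  ccvg F (fun n => ax m f j k (t n)) (apx_lim m f j k).
Proof.
move=> FF h; apply: ccvg_sum => i _; apply: ccvg_sum => l _.
exact: ccvgZ.
Qed.

(** [M] comes from the norms on one exhaustion set that absorbs [K], hence is uniform in the mesh.
    This yields both the existence of the ultralimits and the continuity of the limit functional. *)
Lemma apx_lim_bound (K : set 'rV[R]_d) (j k : 'I_r) : compact K -> K `<=` Omega ->
  exists2 M : R, 0 <= M & exists m1, forall m, (m1 <= m)%N -> forall f B,
    (forall x p, N (f x p) <= B) -> (forall x p, ~ K x -> f x p = 0) ->
    N (apx_lim m f j k) <= M * B.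
Proof.
move=> cK KO; have [n0 absorb] := exhaustion_absorbs Omega_open cK KO.
have cE := @compact_exhaustion R d Omega n0.
have sE := @exhaustion_subset R d Omega n0.
have [M1 hM1] := local_seq_bounded Omega_open u_weak cE sE j.
have [M2 hM2] := local_seq_bounded Omega_open u_weak cE sE k.
exists ((M1 + M2) / 2).
  rewrite divr_ge0// addr_ge0//.
    exact: le_trans (nrm2_ge0 _ _) (hM1 0%N).
  exact: le_trans (nrm2_ge0 _ _) (hM2 0%N).
exists n0 => m n0m f B fB f0.
have B0 : 0 <= B := le_trans (cmod_ge0 _) (fB 0 (0, 0%E)).
have := @apx_ccvg U id m f j k FU (fun i l => @coef_ulim m i l j k).
move=> /(ccvg_cmod_le PU); apply; apply: nearW => n.
apply: le_trans (apx_le omega u_weak s (m0 := n0) j k n fB _) _.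
  move=> i im [p fp]; have Kq : K (nth 0 (q m) i).
    by apply: contrapT => /f0 f0'; move: fp; rewrite f0' eqxx.
  have sub : row_box (nth 0 (q m) i) (mesh m) `<=` ball (nth 0 (q m) i) (2 / n0.+1%:R : R).
    move=> y; rewrite -row_ballE ?mesh_gt0//; apply: le_ball.
    rewrite (@le_trans _ _ n0.+1%:R^-1)//; first by rewrite lef_pV2 ?posrE// ler_nat.
    by rewrite ler_pMl ?invr_gt0// ler1n.
  by split => y /sub; exact: absorb.
rewrite mulrC ler_wpM2r// ler_wpM2r//; exact: lerD (hM1 n) (hM2 n).
Qed.

(** A second limit along [U], now in the mesh index. *)
Definition lim_entry (f : Omega * S -> R[i]) (j k : 'I_r) : R[i] :=
  ulim U (fun m => apx_lim m (extend f) j k).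

(* The limits of the coefficients are the entries of the conjugate of mu, which
   is the transpose of mu: hence the swapped indices. *)
Definition lim_measure (f : Omega * S -> R[i]) : 'M[R[i]]_r :=
  \matrix_(j, k) lim_entry f k j.

Lemma extend_bounded (f : Omega * S -> R[i]) B : 0 <= B -> (forall z, N (f z) <= B) ->
  forall x p, N (extend f x p) <= B.
Proof.
move=> B0 fB x p; have [[a [b [_ _ ->]]]|[_ ->]] := @extendP R _ _ Omega S x p.
  exact: fB.
by rewrite cmod0.
Qed.

Lemma lim_entry_cvg (K : set 'rV[R]_d) (f : Omega * S -> R[i]) B j k :
  compact K -> K `<=` Omega -> (forall z, N (f z) <= B) ->
  (forall x p, ~ K x -> extend f x p = 0) ->
  ccvg U (fun m => apx_lim m (extend f) j k) (lim_entry f j k).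
Proof.
move=> cK KO fB f0; apply: (ulimP UU Uoo).
have [M M0 [m1 h]] := apx_lim_bound j k cK KO.
exists (M * `|B|); exists m1 => // m m1m; apply: h => //.
apply: extend_bounded => // z; exact: le_trans (fB z) (ler_norm B).
Qed.

Lemma Cc_support (K : set (Omega * S)) : compact K ->
  exists K1 : set 'rV[R]_d, [/\ compact K1, K1 `<=` Omega &
    forall f : Omega * S -> R[i], (forall z, ~ K z -> f z = 0) -> forall x p, ~ K1 x -> extend f x p = 0].
Proof.
move=> cK; exists ((fun z : Omega * S => set_val z.1) @` K); split.
- apply: continuous_compact => //; apply: continuous_subspaceT => z.
  apply: (@continuous_comp _ _ _ fst set_val); first exact: cvg_fst.
  exact: initial_continuous.
- by move=> _ [[[a aO] b] _ <-] /=; exact: set_mem aO.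
- move=> f fK x p nK; have [[a [b [ax bp ->]]]|[_ ->]//] := @extendP R _ _ Omega S x p.
  by apply: fK => Kab; apply: nK; exists (a, b).
Qed.

Lemma Cc_bounded (f : Omega * S -> R[i]) : Cc f -> exists2 B : R, 0 <= B & forall z, N (f z) <= B.
Proof.
move=> [fc [K cK fK]]; have [B B0 hB] := compact_ccontinuous_bounded cK fc.
exists B; first exact: ltW.
move=> z; have [/hB//|/fK ->] := pselect (K z); by rewrite cmod0 ltW.
Qed.

Lemma Cc_lim_entry (f : Omega * S -> R[i]) j k : Cc f ->
  ccvg U (fun m => apx_lim m (extend f) j k) (lim_entry f j k).
Proof.
move=> Cf; have [B _ fB] := Cc_bounded Cf; have [_ [K cK fK]] := Cf.
have [K1 [cK1 K1O h]] := Cc_support cK.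
by apply: (lim_entry_cvg j k cK1 K1O fB) => x p; exact: h.
Qed.

Lemma radon_lim_measure : matrix_radon_measure lim_measure.
Proof.
move=> j k; split => [a f g Cf Cg|K cK]; rewrite /lim_measure.
  rewrite !mxE; apply: (ulimE UU).
  have := @ccvgD R nat U FU _ _ _ _ (@ccvgZ R nat U FU _ _ a (Cc_lim_entry k j Cf)) (Cc_lim_entry k j Cg).
  congr (ccvg _ _ _); apply/funext => m.
  rewrite /apx_lim mulr_sumr -big_split; apply: eq_bigr => i _.
  rewrite mulr_sumr -big_split; apply: eq_bigr => l _ /=.
  have [[x [y [_ _ e]]]|[_ e]] := @extendP R _ _ Omega S (nth 0 (q m) i) (nth (0, 0%E) (s m) l).
    by rewrite !e; ring.
  by rewrite !e; ring.
have [K1 [cK1 K1O h]] := Cc_support cK.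
have [M M0 [m1 hM]] := apx_lim_bound k j cK1 K1O.
(* A point of the space forces 0 <= B. On an empty space [B] may be negative, and the constant has
   to be 0. *)
have [[z0 _]|nz] := pselect (exists z : Omega * S, True).
  exists M => f B Cf fK fB; have B0 : 0 <= B := le_trans (cmod_ge0 _) (fB z0).
  rewrite mxE; apply: (ccvg_cmod_le PU (Cc_lim_entry k j Cf)).
  apply: Uoo; exists m1 => // m m1m; apply: hM => //.
    exact: extend_bounded.
  by move=> x p; exact: h.
exists 0 => f B Cf fK fB; rewrite mxE (_ : lim_entry f k j = 0) ?cmod0 ?mul0r//.
apply: (ulimE UU) => e e0; apply: nearW => m; rewrite /apx_lim big1 ?subrr ?cmod0// => i _.
rewrite big1// => l _.
have [[x [y _]]|[_ ->]] := @extendP R _ _ Omega S (nth 0 (q m) i) (nth (0, 0%E) (s m) l).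
  by exfalso; apply: nz; exists (x, y).
by rewrite mul0r.
Qed.

(** The cells are real-valued, so exchanging the arguments of the form conjugates it. *)
Lemma coef_limJ m i l j k : (coef_lim m i l j k)^* = coef_lim m i l k j.
Proof.
apply/esym/(ulimE UU); have := @ccvgJ R nat U FU _ _ (@coef_ulim m i l j k).
congr (ccvg _ _ _); apply/funext => n; rewrite /coef.
have cE := @compact_exhaustion R d Omega m.
have L := L2on_block u_weak q m n i.
rewrite (qformJ cE (bounded_cell omega s m n l) (L j) (L k)).
by congr (qform _ _ _); apply/funext => xi; rewrite /cell conjR.
Qed.

Lemma lim_entryJ (f : Omega * S -> R[i]) j k :
  ccvg U (fun m => apx_lim m (extend f) j k) (lim_entry f j k) ->
  (lim_entry (fun z => (f z)^*) k j)^* = lim_entry f j k.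
Proof.
move=> hf; rewrite -[RHS]conjCK; congr (_^*); apply: (ulimE UU).
have := @ccvgJ R nat U FU _ _ hf; congr (ccvg _ _ _); apply/funext => m.
rewrite /apx_lim rmorph_sum; apply: eq_bigr => i _.
rewrite rmorph_sum; apply: eq_bigr => l _; rewrite rmorphM /= coef_limJ.
have [[x [y [_ _ e]]]|[_ e]] := @extendP R _ _ Omega S (nth 0 (q m) i) (nth (0, 0%E) (s m) l).
  by rewrite !e.
by rewrite !e rmorph0.
Qed.

Lemma hermitian_lim_measure : hermitian_measure lim_measure.
Proof.
move=> f Cf; apply/matrixP => j k; rewrite !mxE.
by rewrite lim_entryJ//; exact: Cc_lim_entry.
Qed.

Lemma conj_lim_measure (f : Omega * S -> R[i]) j k :
  ccvg U (fun m => apx_lim m (extend f) j k) (lim_entry f j k) ->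
  conj_measure lim_measure f j k = lim_entry f j k.
Proof. by move=> hf; rewrite !mxE lim_entryJ. Qed.

(** The same cutoff stands in both arguments, so the sum is the integral of the cell times the
    squared modulus of a single function, the combination [w] of the transforms. *)
Lemma coef_ge0 m i l n (z : 'I_r -> R[i]) :
  0 <= \sum_j \sum_k ((z j)^* * z k) * cf m i l k j n.
Proof.
have cE := @compact_exhaustion R d Omega m.
have [mc bc] := bounded_cell omega s m n l.
pose b j xi := hat (block Omega u q m n i j) xi.
have ib j k : cintegrable leb (fun xi => ((z j)^* * z k) *
    (cell omega s m n l xi * (b k xi * (b j xi)^*))).
  apply: cintegrableZ; have L := L2on_block u_weak q m n i.
  exact: (qform_integrable cE mc bc (L k) (L j)).
have -> : \sum_j \sum_k ((z j)^* * z k) * cf m i l k j n =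
    cintegral leb setT (fun xi => \sum_j \sum_k ((z j)^* * z k) *
      (cell omega s m n l xi * (b k xi * (b j xi)^*))).
  rewrite cintegral_sum => [|j _]; last by apply: cintegrable_sum => k _.
  apply: eq_bigr => j _; rewrite cintegral_sum => [|k _]; last exact: ib.
  apply: eq_bigr => k _; rewrite /coef qformE -cintegralZ//.
  have L := L2on_block u_weak q m n i.
  exact: (qform_integrable cE mc bc (L k) (L j)).
apply: cintegral_ge0 => xi.
pose w := \sum_k z k * b k xi.
have -> : \sum_j \sum_k ((z j)^* * z k) * (cell omega s m n l xi * (b k xi * (b j xi)^*)) =
    cell omega s m n l xi * (w * w^*).
  have -> : w^* = \sum_j (z j)^* * (b j xi)^*.
    by rewrite /w rmorph_sum; apply: eq_bigr => j _; rewrite rmorphM.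
  rewrite mulr_sumr [RHS]mulr_sumr; apply: eq_bigr => j _.
  rewrite /w mulr_suml mulr_sumr; apply: eq_bigr => k _.
  by ring.
by rewrite mul_conjc /cell -rmorphM ler0c mulr_ge0 ?net_cell_ge0 ?sqr_ge0.
Qed.

Lemma nonneg_lim_measure : nonneg_measure lim_measure.
Proof.
move=> f Cf f0 z.
have -> : ((map_mx Num.conj z)^T *m lim_measure f *m z) 0 0 =
    \sum_j \sum_k ((z j 0)^* * z k 0) * lim_entry f k j.
  rewrite mxE exchange_big /=; apply: eq_bigr => k _; rewrite mxE mulr_suml.
  by apply: eq_bigr => j _; rewrite !mxE; ring.
have cv : ccvg U (fun m => \sum_j \sum_k ((z j 0)^* * z k 0) * apx_lim m (extend f) k j)
    (\sum_j \sum_k ((z j 0)^* * z k 0) * lim_entry f k j).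
  apply: ccvg_sum => j _; apply: ccvg_sum => k _; apply: ccvgZ; exact: Cc_lim_entry.
apply: (ccvg_ge0 PU cv) => m.
have -> : \sum_j \sum_k ((z j 0)^* * z k 0) * apx_lim m (extend f) k j =
    \sum_(i < size (q m)) \sum_(l < size (s m))
      extend f (nth 0 (q m) i) (nth (0, 0%E) (s m) l) *
      \sum_j \sum_k ((z j 0)^* * z k 0) * coef_lim m i l k j.
  rewrite /apx_lim.
  under eq_bigr do under eq_bigr do rewrite mulr_sumr.
  under eq_bigr do rewrite exchange_big.
  rewrite exchange_big; apply: eq_bigr => i _ /=.
  under eq_bigr do under eq_bigr do rewrite mulr_sumr.
  under eq_bigr do rewrite exchange_big.
  rewrite exchange_big; apply: eq_bigr => l _ /=.
  rewrite mulr_sumr; apply: eq_bigr => j _; rewrite mulr_sumr; apply: eq_bigr => k _.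
  by ring.
apply: sumr_ge0 => i _; apply: sumr_ge0 => l _; apply: mulr_ge0.
  have [[x [y [_ _ ->]]]|[_ ->]//] := @extendP R _ _ Omega S (nth 0 (q m) i) (nth (0, 0%E) (s m) l).
  exact: f0.
apply: (@ccvg_ge0 _ _ U PU (fun n => \sum_j \sum_k ((z j 0)^* * z k 0) * cf m i l k j n)).
  apply: ccvg_sum => j _; apply: ccvg_sum => k _; apply: ccvgZ; exact: coef_ulim.
by move=> n; exact: coef_ge0.
Qed.

Lemma common_subseq : exists t : nat -> nat, {homo t : m n / (m < n)%N} /\
  forall m i l j k, ccvg \oo (fun n => cf m i l j k (t n)) (coef_lim m i l j k).
Proof.
(* The indices of all coefficients form a countable type, coded by natural numbers for
   [diagonal_subseq]. *)
pose D := (nat * nat * nat * 'I_r * 'I_r)%type.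
pose c n p : R[i] := if (unpickle p : option D) is Some (m, i, l, j, k)
  then cf m i l j k n else 0.
pose L p : R[i] := if (unpickle p : option D) is Some (m, i, l, j, k)
  then coef_lim m i l j k else 0.
have [p|t [ht cvt]] := @diagonal_subseq R U UU Uoo c L.
  rewrite /c /L; case: (unpickle p) => [[[[[m i] l] j] k]|]; first exact: coef_ulim.
  by move=> e e0; apply: nearW => n; rewrite subrr cmod0.
exists t; split => // m i l j k.
have := cvt (pickle ((m, i, l, j, k) : D)).
by rewrite /c /L pickleK.
Qed.

(** For each e a single mesh [m] is drawn from a member of [U] on which the discrete approximation
    and the limit in [m] are both accurate to e / 3. At this fixed [m] the finitely many
    coefficients converge along [t], which gives genuine convergence along [t]. *)
Lemma limit_form_cvg (t : nat -> nat) (phi1 phi2 : Omega -> R[i]) (psi : S -> R[i]) j k :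
  {homo t : m n / (m < n)%N} ->
  (forall m i l j k, ccvg \oo (fun n => cf m i l j k (t n)) (coef_lim m i l j k)) ->
  Cc phi1 -> Cc phi2 -> ccontinuous psi ->
  let f p := phi1 p.1 * (phi2 p.1)^* * psi p.2 in
  ccvg \oo (fun n => limit_form u omega ('valL_ 0 phi1) ('valL_ 0 phi2) psi j k (t n))
    (conj_measure lim_measure f j k).
Proof.
move=> ht cvt C1 C2 psic f.
have [K1 [cK1 K1O s1 [B1 B10 b1] u1]] := Cc_valL Omega_open C1.
have [K2 [cK2 K2O s2 [B2 B20 b2] u2]] := Cc_valL Omega_open C2.
have [B3 B30 b3] := symbol_bounded psic.
have cK : compact (K1 `|` K2) by exact: compactU.
have KO : K1 `|` K2 `<=` Omega by move=> x [/K1O|/K2O].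
pose C := Num.max B1 B2.
have t1 : tame ('valL_ 0 phi1) (K1 `|` K2) C.
  split; [split|move=> x nK; apply: s1 => ?; apply: nK; by left|exact: u1].
    exact: cmeasurable_unif u1.
  by move=> x; rewrite le_max b1.
have t2 : tame ('valL_ 0 phi2) (K1 `|` K2) C.
  split; [split|move=> x nK; apply: s2 => ?; apply: nK; by right|exact: u2].
    exact: cmeasurable_unif u2.
  by move=> x; rewrite le_max b2 orbT.
have ef x p : extend f x p = 'valL_ 0 phi1 x * ('valL_ 0 phi2 x)^* * 'valL_ 0 psi p.
  have [[a [b [<- <- ->]]]|[nxp ->]] := @extendP R _ _ Omega S x p.
    by rewrite !valL_in.
  have [Ox|nOx] := pselect (Omega x); last by rewrite (valL_out _ nOx) !mul0r.
  have nSp : ~ S p by move=> Sp; apply: nxp.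
  by rewrite (valL_out psi nSp) mulr0.
have fB z : N (f z) <= B1 * B2 * B3.
  case: z => a b; have := b1 (set_val a); have := b2 (set_val a); have := b3 (set_val b).
  rewrite !valL_in => h3 h2 h1; rewrite /f /= !cmodM cmodJ.
  by rewrite ler_pM ?mulr_ge0 ?cmod_ge0// ler_pM ?cmod_ge0.
have fK x p : ~ (K1 `|` K2) x -> extend f x p = 0.
  by move=> nK; rewrite ef s1 ?mul0r// => K1x; apply: nK; left.
have hf := lim_entry_cvg j k cK KO fB fK.
rewrite (conj_lim_measure hf) => e e0.
have e3 : 0 < e / 3 by rewrite divr_gt0.
have [m1 hm1] := main_approximation Omega_open u_weak omega_gt0 omega_cvg q_cover s_net
  cK KO t1 t2 psic j k e3.
have Um1 : \forall m \near U, (m1 <= m)%N by apply: Uoo; exists m1.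
have [m [m1m hm]] := filter_ex (filterI Um1 (hf _ e3)).
have [n1 _ hn1] := hm1 _ m1m.
have tn1 : \forall n \near \oo, (n1 <= t n)%N.
  exists n1 => // n /= n1n; exact: leq_trans n1n (strict_homo_ge ht n).
have := @apx_ccvg \oo t m (extend f) j k eventually_filter (fun i l => cvt m i l j k) _ e3.
apply: filterS2 tn1 => n n1t h2.
have := hn1 _ n1t => /= h1.
have ee : (fun x p => 'valL_ 0 phi1 x * ('valL_ 0 phi2 x)^* * 'valL_ 0 psi p) = extend f.
  by apply/funext => x; apply/funext => p; rewrite ef.
move: h1; rewrite ee; move: (limit_form _ _ _ _ _ _ _ _) hm h2.
move: (ax m _ j k (t n)) (apx_lim m _ j k) (lim_entry f j k) => a b c Q hm h2 h1.
have -> : Q - c = (Q - a) + ((a - b) + (b - c)) by ring.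
rewrite (le_lt_trans (cmodD _ _))//; have := cmodD (a - b) (b - c).
by move: (N _) (N _) (N _) (N _) hm h2 h1 => *; lra.
Qed.

End limit_measure.

Section form_integral.
Context {R : realType} {d r : nat}.
Local Notation N := (@Normc.normc R).

Lemma mxintegral_form (u : 'rV[R]_d -> 'cV[R[i]]_r) (p f g : 'rV[R]_d -> R[i]) (j k : 'I_r) :
  mxintegral (fun xi => p xi *: tensor (fourier (fun x => f x *: u x) xi)
    (fourier (fun x => g x *: u x) xi)) j k =
  qform p (fun x => f x * u x j 0) (fun x => g x * u x k 0).
Proof.
rewrite mxE qformE; congr cintegral; apply/funext => xi.
have e h (i : 'I_r) : fourier (fun x => h x *: u x) xi i 0 = hat (fun x => h x * u x i 0) xi.
  by rewrite mxE /hat; congr cintegral; apply/funext => x; rewrite mxE.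
by rewrite mxE; congr (_ * _); rewrite mxE !e.
Qed.

Lemma mx_ccvg (f : nat -> 'M[R[i]]_r) (M : 'M[R[i]]_r) :
  (forall j k, ccvg \oo (fun n => f n j k) (M j k)) ->
  f @ \oo --> (M : 'M[R[i]^o]_r).
Proof.
move=> h A [P hP PA].
have H : \forall n \near \oo, forall jk : 'I_r * 'I_r, P jk.1 jk.2 (f n jk.1 jk.2).
  apply: filter_forall => -[j k] /=.
  exact: ((@ccvgP R nat \oo eventually_filter _ _).2 (h j k) _ (hP j k)).
suff : \forall n \near \oo, A (f n) by [].
by apply: filterS H => n Hn; apply: PA => j k; exact: (Hn (j, k)).
Qed.

End form_integral.

Unset Implicit Arguments.
Set Strict Implicit.

Theorem theorem6 (R : realType) (d r : nat) (d_gt0 : (0 < d)%N)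
    (Omega : set 'rV[R]_d) (Omega_open : open Omega)
    (u : nat -> 'rV[R]_d -> 'cV[R[i]]_r)
    (u_weak : weakly_null_L2loc Omega u)
    (omega : nat -> R) (omega_gt0 : forall n, 0 < omega n)
    (omega_cvg : omega @ \oo --> (0 : R)) :
  exists2 s : nat -> nat, {homo s : m n / (m < n)%N} &
  exists mu : (Omega * @K0inf R d -> R[i]) -> 'M[R[i]]_r,
    [/\ matrix_radon_measure mu, hermitian_measure mu, nonneg_measure mu &
      forall (phi1 phi2 : Omega -> R[i]) (psi : @K0inf R d -> R[i]),
        Cc phi1 -> Cc phi2 -> ccontinuous psi ->
        (fun n => mxintegral (fun xi =>
           symbol psi (omega (s n) *: xi) *:
             tensor (fourier (fun x => 'valL_ 0 phi1 x *: u (s n) x) xi)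
                    (fourier (fun x => 'valL_ 0 phi2 x *: u (s n) x) xi)))
          @ \oo -->
        (conj_measure mu (fun p => phi1 p.1 * (phi2 p.1)^* * psi p.2)
           : 'M[R[i]^o]_r)].

Proof.
have /choice[q qc] : forall m, exists q : seq 'rV[R]_d,
    forall x, exhaustion Omega m x -> exists2 p, p \in q & ball p (mesh m / 2 : R) x.
  move=> m; have m2 : 0 < mesh m / 2 :> R by rewrite divr_gt0// mesh_gt0.
  have [q [_ qc]] := ball_cover (@compact_exhaustion R d Omega m) m2.
  by exists q.
have /choice[s sP] : forall m, exists s, @is_net R d s (mesh m).
  by move=> m; apply: exists_net; exact: mesh_gt0.
have [U UU Uoo] := exists_ultra_infty.
have [t [ht cvt]] := @common_subseq R d r Omega u omega Omega_open u_weak q s U UU Uoo.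
exists t => //; exists (@lim_measure R d r Omega u omega q s U); split.
- exact: radon_lim_measure.
- exact: hermitian_lim_measure.
- exact: nonneg_lim_measure.
move=> phi1 phi2 psi C1 C2 psic; apply: mx_ccvg => j k.
have := limit_form_cvg Omega_open u_weak omega_gt0 omega_cvg qc sP UU Uoo j k ht cvt C1 C2 psic.
by congr (ccvg _ _ _); apply/funext => n; rewrite mxintegral_form.
Qed.
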